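(* There exist multisets $\Sigma_n$ ($n\ge1$) of single-variable $\mathcal{L}_u$-formulas with $|\Sigma_n|\le n^{O(1)}$ and $\mathbf{LK}\vdash\ \Rightarrow\bigwedge\Sigma_n^f$, together with $\mathbf{FL_e}$-proofs of size $n^{O(1)}$ of $\Sigma_n,\ Clique_n(\bar p,\bar r)\Rightarrow\overline{Color}_n(\bar p,\bar s)$, such that, writing $\Sigma_n^{\bar p,\bar s}$ for the sub-multiset of those $A\in\Sigma_n$ (with the same multiplicities) whose variables all lie in $\bar p\cup\bar s$ and $\Pi_n:=\Sigma_n\setminus\Sigma_n^{\bar p,\bar s}$, the sequents $$S_n:=\ Clique_n(\bar p,\bar r),\ \Pi_n\ \Rightarrow\ \circledast\Sigma_n^{\bar p,\bar s}\to\overline{Color}_n(\bar p,\bar s)$$ have $\mathbf{FL_e}$-proofs of size $n^{O(1)}$, while every $\mathbf{LK_!^-}$-proof of $S_n$ has size $2^{n^{\Omega(1)}}$.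
   Context: Formulas. $\mathcal{L}_u$-formulas are built from atoms and constants $0,1$ by $\wedge,\vee,*,\to$; $\mathcal{L}_b$ adds constants $\top,\bot$; $\mathcal{L}_!$ further adds unary $!$. $\neg A:=A\to0$. $\circledast\{A_1,\dots,A_m\}:=A_1*\cdots*A_m$ ($\circledast\emptyset:=1$). A formula is single-variable if it contains at most one propositional atom. A sequent is $\Gamma\Rightarrow\Delta$, $\Gamma,\Delta$ finite multisets. Calculi. $\mathbf{FL_e}$ is the single-conclusion calculus (all sequents have at most one succedent formula) with axioms $A\Rightarrow A$, $\Rightarrow1$, $0\Rightarrow$ and rules: from $\Gamma\Rightarrow\Delta$ infer $\Gamma,1\Rightarrow\Delta$; from $\Gamma\Rightarrow$ infer $\Gamma\Rightarrow0$; from $\Gamma,A_i\Rightarrow\Delta$ infer $\Gamma,A_0\wedge A_1\Rightarrow\Delta$; from $\Gamma\Rightarrow A$ and $\Gamma\Rightarrow B$ infer $\Gamma\Rightarrow A\wedge B$; from $\Gamma,A\Rightarrow\Delta$ and $\Gamma,B\Rightarrow\Delta$ infer $\Gamma,A\vee B\Rightarrow\Delta$; from $\Gamma\Rightarrow A_i$ infer $\Gamma\Rightarrow A_0\vee A_1$; from $\Gamma,A,B\Rightarrow\Delta$ infer $\Gamma,A*B\Rightarrow\Delta$; from $\Gamma\Rightarrow A$ and $\Sigma\Rightarrow B$ infer $\Gamma,\Sigma\Rightarrow A*B$; from $\Gamma\Rightarrow A$ and $\Sigma,B\Rightarrow\Lambda$ infer $\Gamma,\Sigma,A\to B\Rightarrow\Lambda$;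 from $\Gamma,A\Rightarrow B$ infer $\Gamma\Rightarrow A\to B$; cut: from $\Gamma\Rightarrow A$ and $\Sigma,A\Rightarrow\Lambda$ infer $\Gamma,\Sigma\Rightarrow\Lambda$. $\mathbf{LK_!}$ is the multi-conclusion calculus over $\mathcal{L}_!$ with the multi-conclusion versions of all these rules (contexts $\Delta,\Lambda$ allowed on the right, e.g. from $\Gamma\Rightarrow\Delta$ infer $\Gamma\Rightarrow0,\Delta$, and the $*$-right/$\to$-left rules combine right contexts), plus axioms $\Gamma\Rightarrow\top,\Delta$, $\Gamma,\bot\Rightarrow\Delta$, left and right weakening and contraction, and the exponential rules: from $!\Gamma\Rightarrow A$ infer $!\Gamma\Rightarrow!A$; from $\Gamma,A\Rightarrow\Delta$ infer $\Gamma,!A\Rightarrow\Delta$; from $\Gamma\Rightarrow\Delta$ infer $\Gamma,!A\Rightarrow\Delta$; from $\Gamma,!A,!A\Rightarrow\Delta$ infer $\Gamma,!A\Rightarrow\Delta$. $\mathbf{LK_!^-}$ is $\mathbf{LK_!}$ without cut. $\mathbf{LK}$ is the usual classical sequent calculus (with cut, weakening, contraction) over $\mathcal{L}_p$: atoms, $\top,\bot,\wedge,\vee,\to$. Size = number of symbols; $|\Sigma|$ is the total size of a multiset. Forgetful translation $(\cdot)^f:\mathcal{L}_!\to\mathcal{L}_p$: $p^f=p$, $0^f=\bot$, $1^f=\top$, $(A*B)^f=A^f\wedge B^f$, $(A\circ B)^f=A^f\circ B^f$ for $\circ\in\{\wedge,\vee,\to\}$, $(!A)^f=A^f$; $\Sigma^f$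 is applied elementwise. Clique–Color. For $n,k,m\ge1$: atoms $p_{ij}$ for $\{i,j\}\in\binom{[n]}{2}$, $r_{ui}$ ($u\in[k],i\in[n]$), $s_{ia}$ ($i\in[n],a\in[m]$). $Clique^k_n(\bar p,\bar r)$ is the conjunction of: $\bigvee_{i\in[n]}r_{ui}$ ($u\in[k]$); $\neg r_{ui}\vee\neg r_{uj}$ ($u\in[k]$, $i\ne j$); $\neg r_{ui}\vee\neg r_{vi}$ ($u\ne v$, $i\in[n]$); $\neg r_{ui}\vee\neg r_{vj}\vee p_{ij}$ ($u\ne v$, $\{i,j\}\in\binom{[n]}2$). $Color^m_n(\bar p,\bar s)$ is the conjunction of: $\bigvee_{a\in[m]}s_{ia}$ ($i\in[n]$); $\neg s_{ia}\vee\neg s_{ib}$ ($a\ne b$); $\neg s_{ia}\vee\neg s_{ja}\vee\neg p_{ij}$ ($a\in[m]$, $\{i,j\}\in\binom{[n]}2$). $Clique_n:=Clique^{\lfloor\sqrt n\rfloor+1}_n$, $Color_n:=Color^{\lfloor\sqrt n\rfloor}_n$. $\overline{Color}_n$ is the negation normal form of $\neg Color_n$: the disjunction over the clauses of $Color_n$ of the conjunction of the complements of its literals (complement of $x$ is $\neg x$, of $\neg x$ is $x$). Here $\neg x$ is read as $x\to0$ in $\mathcal{L}_u$ (and as $x\to\bot$ after applying $(\cdot)^f$). *)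

(* Defs.v *)
(* MathComp for syntax and finite combinatorics; the Stdlib reals are used
   only for the bound 2^(n^eps). *)
From Stdlib Require Import Reals.
From HB Require Import structures.
From mathcomp Require Import all_boot.

Set Implicit Arguments.
Unset Strict Implicit.
Unset Printing Implicit Defensive.

(* The index sets [n], [k], [m] are 0-based.  Throughout, the atom p_{ij} of an
   unordered pair {i,j} is [Avar i j] with i < j. *)
Inductive atom : Type :=
| Avar of nat & nat    (* p_{ij} *)
| Rvar of nat & nat    (* r_{ui} *)
| Svar of nat & nat.   (* s_{ia} *)

Lemma atom_comparable : comparable atom.
Proof. by move=> x y; rewrite /decidable; decide equality; apply: eq_comparable. Defined.
HB.instance Definition _ := comparableMixin atom_comparable.

(** * Formulas *)

(* The language L_u. *)
Inductive uformula : Type :=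
| UAtom of atom
| UZero
| UOne
| UAnd of uformula & uformula
| UOr of uformula & uformula
| UMul of uformula & uformula
| UImp of uformula & uformula.

(* The language L_!. *)
Inductive xformula : Type :=
| XAtom of atom
| XZero
| XOne
| XTop
| XBot
| XAnd of xformula & xformula
| XOr of xformula & xformula
| XMul of xformula & xformula
| XImp of xformula & xformula
| XBang of xformula.

(* The language L_p. *)
Inductive pformula : Type :=
| PAtom of atom
| PTop
| PBot
| PAnd of pformula & pformula
| POr of pformula & pformula
| PImp of pformula & pformula.

Lemma uformula_comparable : comparable uformula.
Proof. by move=> x y; rewrite /decidable; decide equality; apply: eq_comparable. Defined.
HB.instance Definition _ := comparableMixin uformula_comparable.

Lemma xformula_comparable : comparable xformula.
Proof. by move=> x y; rewrite /decidable; decide equality; apply: eq_comparable. Defined.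
HB.instance Definition _ := comparableMixin xformula_comparable.

Lemma pformula_comparable : comparable pformula.
Proof. by move=> x y; rewrite /decidable; decide equality; apply: eq_comparable. Defined.
HB.instance Definition _ := comparableMixin pformula_comparable.

Definition UNeg (A : uformula) : uformula := UImp A UZero.

Fixpoint usize (A : uformula) : nat :=
  match A with
  | UAtom _ | UZero | UOne => 1
  | UAnd A B | UOr A B | UMul A B | UImp A B => (usize A + usize B).+1
  end.

Fixpoint xsize (A : xformula) : nat :=
  match A with
  | XAtom _ | XZero | XOne | XTop | XBot => 1
  | XAnd A B | XOr A B | XMul A B | XImp A B => (xsize A + xsize B).+1
  | XBang A => (xsize A).+1
  end.

Fixpoint uvars (A : uformula) : seq atom :=
  match A with
  | UAtom x => [:: x]
  | UZero | UOne => [::]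
  | UAnd A B | UOr A B | UMul A B | UImp A B => uvars A ++ uvars B
  end.

Definition single_variable (A : uformula) : bool := size (undup (uvars A)) <= 1.

Fixpoint xform (A : uformula) : xformula :=
  match A with
  | UAtom x => XAtom x
  | UZero => XZero
  | UOne => XOne
  | UAnd A B => XAnd (xform A) (xform B)
  | UOr A B => XOr (xform A) (xform B)
  | UMul A B => XMul (xform A) (xform B)
  | UImp A B => XImp (xform A) (xform B)
  end.

Fixpoint forget (A : xformula) : pformula :=
  match A with
  | XAtom x => PAtom x
  | XZero | XBot => PBot
  | XOne | XTop => PTop
  | XAnd A B | XMul A B => PAnd (forget A) (forget B)
  | XOr A B => POr (forget A) (forget B)
  | XImp A B => PImp (forget A) (forget B)
  | XBang A => forget A
  end.

(* Right-nested iteration [A1 op (A2 op (... op Am))]; [e] is used only for the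
   empty list. *)
Fixpoint nest {F : Type} (op : F -> F -> F) (e : F) (s : seq F) : F :=
  match s with
  | [::] => e
  | [:: A] => A
  | A :: s' => op A (nest op e s')
  end.

Definition bigfusion : seq uformula -> uformula := nest UMul UOne.
Definition ubigand : seq uformula -> uformula := nest UAnd UOne.
Definition ubigor : seq uformula -> uformula := nest UOr UZero.
Definition pbigand : seq pformula -> pformula := nest PAnd PTop.

(** * Sequents and proofs *)

(* Finite multisets are lists up to [perm_eq]: see [up_to_perm]. *)
Definition sequent (F : eqType) : Type := (seq F * seq F)%type.

Definition sequent_equiv {F : eqType} (s t : sequent F) : bool :=
  perm_eq s.1 t.1 && perm_eq s.2 t.2.

(* [rule ps s] reads: s follows from the premises ps by one inference
   (an axiom when ps is empty). *)
Definition up_to_perm {F : eqType} (rule : seq (sequent F) -> sequent F -> Prop)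
    (ps : seq (sequent F)) (s : sequent F) : Prop :=
  exists ps' s', [/\ rule ps' s', all2 sequent_equiv ps ps' & sequent_equiv s s'].

(* The sequent arrow counts as one symbol. *)
Definition sequent_size {F : eqType} (fsize : F -> nat) (s : sequent F) : nat :=
  (sumn (map fsize s.1) + sumn (map fsize s.2)).+1.

Inductive derivation (S : Type) : Type :=
| Infer of S & seq (derivation S).

Definition conclusion {S : Type} (d : derivation S) : S := let: Infer s _ := d in s.

Fixpoint tree_correct {S : Type} (rule : seq S -> S -> Prop) (d : derivation S) : Prop :=
  let: Infer s ds := d in
  rule (map conclusion ds) s /\
  foldr (fun d' P => tree_correct rule d' /\ P) True ds.

Fixpoint tree_size {S : Type} (ssize : S -> nat) (d : derivation S) : nat :=
  let: Infer s ds := d in ssize s + sumn (map (tree_size ssize) ds).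

Inductive dag_correct {S : eqType} (rule : seq S -> S -> Prop) : seq S -> Prop :=
| dag_nil : dag_correct rule [::]
| dag_rcons l ps s :
    dag_correct rule l -> {subset ps <= l} -> rule ps s -> dag_correct rule (rcons l s).

(* Proofs as trees, or as sequences of sequents whose lines may be reused as
   premises any number of times. *)
Inductive proof_shape : Type := TreeLike | DagLike.

Definition proof_of_size {F : eqType} (fsize : F -> nat) (shape : proof_shape)
    (rule : seq (sequent F) -> sequent F -> Prop) (s : sequent F) (k : nat) : Prop :=
  match shape with
  | TreeLike => exists d, [/\ tree_correct rule d, conclusion d = s
                            & tree_size (sequent_size fsize) d = k]
  | DagLike => exists l : seq (sequent F),
      dag_correct rule (rcons l s) /\ sumn (map (sequent_size fsize) (rcons l s)) = k
  end.

Definition provable {F : eqType} (rule : seq (sequent F) -> sequent F -> Prop)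
    (s : sequent F) : Prop :=
  exists d, tree_correct rule d /\ conclusion d = s.

(** * The calculi *)

(* Every sequent has at most one formula on the right. *)
Inductive FLe_rule : seq (sequent uformula) -> sequent uformula -> Prop :=
| FLe_ax A : FLe_rule [::] ([:: A], [:: A])
| FLe_oneR : FLe_rule [::] ([::], [:: UOne])
| FLe_zeroL : FLe_rule [::] ([:: UZero], [::])
| FLe_oneL Γ Δ : size Δ <= 1 -> FLe_rule [:: (Γ, Δ)] (UOne :: Γ, Δ)
| FLe_zeroR Γ : FLe_rule [:: (Γ, [::])] (Γ, [:: UZero])
| FLe_andL1 Γ Δ A B : size Δ <= 1 -> FLe_rule [:: (A :: Γ, Δ)] (UAnd A B :: Γ, Δ)
| FLe_andL2 Γ Δ A B : size Δ <= 1 -> FLe_rule [:: (B :: Γ, Δ)] (UAnd A B :: Γ, Δ)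
| FLe_andR Γ A B : FLe_rule [:: (Γ, [:: A]); (Γ, [:: B])] (Γ, [:: UAnd A B])
| FLe_orL Γ Δ A B : size Δ <= 1 ->
    FLe_rule [:: (A :: Γ, Δ); (B :: Γ, Δ)] (UOr A B :: Γ, Δ)
| FLe_orR1 Γ A B : FLe_rule [:: (Γ, [:: A])] (Γ, [:: UOr A B])
| FLe_orR2 Γ A B : FLe_rule [:: (Γ, [:: B])] (Γ, [:: UOr A B])
| FLe_mulL Γ Δ A B : size Δ <= 1 ->
    FLe_rule [:: (A :: B :: Γ, Δ)] (UMul A B :: Γ, Δ)
| FLe_mulR Γ Σ A B :
    FLe_rule [:: (Γ, [:: A]); (Σ, [:: B])] (Γ ++ Σ, [:: UMul A B])
| FLe_impL Γ Σ Λ A B : size Λ <= 1 ->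
    FLe_rule [:: (Γ, [:: A]); (B :: Σ, Λ)] (UImp A B :: Γ ++ Σ, Λ)
| FLe_impR Γ A B : FLe_rule [:: (A :: Γ, [:: B])] (Γ, [:: UImp A B])
| FLe_cut Γ Σ Λ A : size Λ <= 1 ->
    FLe_rule [:: (Γ, [:: A]); (A :: Σ, Λ)] (Γ ++ Σ, Λ).

Definition FLe := up_to_perm FLe_rule.

Inductive LKbang_cutfree_rule : seq (sequent xformula) -> sequent xformula -> Prop :=
| LKb_ax A : LKbang_cutfree_rule [::] ([:: A], [:: A])
| LKb_oneR : LKbang_cutfree_rule [::] ([::], [:: XOne])
| LKb_zeroL : LKbang_cutfree_rule [::] ([:: XZero], [::])
| LKb_topR Γ Δ : LKbang_cutfree_rule [::] (Γ, XTop :: Δ)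
| LKb_botL Γ Δ : LKbang_cutfree_rule [::] (XBot :: Γ, Δ)
| LKb_oneL Γ Δ : LKbang_cutfree_rule [:: (Γ, Δ)] (XOne :: Γ, Δ)
| LKb_zeroR Γ Δ : LKbang_cutfree_rule [:: (Γ, Δ)] (Γ, XZero :: Δ)
| LKb_andL1 Γ Δ A B : LKbang_cutfree_rule [:: (A :: Γ, Δ)] (XAnd A B :: Γ, Δ)
| LKb_andL2 Γ Δ A B : LKbang_cutfree_rule [:: (B :: Γ, Δ)] (XAnd A B :: Γ, Δ)
| LKb_andR Γ Δ A B :
    LKbang_cutfree_rule [:: (Γ, A :: Δ); (Γ, B :: Δ)] (Γ, XAnd A B :: Δ)
| LKb_orL Γ Δ A B :
    LKbang_cutfree_rule [:: (A :: Γ, Δ); (B :: Γ, Δ)] (XOr A B :: Γ, Δ)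
| LKb_orR1 Γ Δ A B : LKbang_cutfree_rule [:: (Γ, A :: Δ)] (Γ, XOr A B :: Δ)
| LKb_orR2 Γ Δ A B : LKbang_cutfree_rule [:: (Γ, B :: Δ)] (Γ, XOr A B :: Δ)
| LKb_mulL Γ Δ A B : LKbang_cutfree_rule [:: (A :: B :: Γ, Δ)] (XMul A B :: Γ, Δ)
| LKb_mulR Γ Δ Σ Λ A B :
    LKbang_cutfree_rule [:: (Γ, A :: Δ); (Σ, B :: Λ)] (Γ ++ Σ, XMul A B :: Δ ++ Λ)
| LKb_impL Γ Δ Σ Λ A B :
    LKbang_cutfree_rule [:: (Γ, A :: Δ); (B :: Σ, Λ)] (XImp A B :: Γ ++ Σ, Δ ++ Λ)
| LKb_impR Γ Δ A B : LKbang_cutfree_rule [:: (A :: Γ, B :: Δ)] (Γ, XImp A B :: Δ)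
| LKb_weakL Γ Δ A : LKbang_cutfree_rule [:: (Γ, Δ)] (A :: Γ, Δ)
| LKb_weakR Γ Δ A : LKbang_cutfree_rule [:: (Γ, Δ)] (Γ, A :: Δ)
| LKb_contrL Γ Δ A : LKbang_cutfree_rule [:: (A :: A :: Γ, Δ)] (A :: Γ, Δ)
| LKb_contrR Γ Δ A : LKbang_cutfree_rule [:: (Γ, A :: A :: Δ)] (Γ, A :: Δ)
| LKb_promotion Γ A :
    LKbang_cutfree_rule [:: (map XBang Γ, [:: A])] (map XBang Γ, [:: XBang A])
| LKb_dereliction Γ Δ A : LKbang_cutfree_rule [:: (A :: Γ, Δ)] (XBang A :: Γ, Δ)
| LKb_bang_weak Γ Δ A : LKbang_cutfree_rule [:: (Γ, Δ)] (XBang A :: Γ, Δ)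
| LKb_bang_contr Γ Δ A :
    LKbang_cutfree_rule [:: (XBang A :: XBang A :: Γ, Δ)] (XBang A :: Γ, Δ).

Definition LKbang_cutfree := up_to_perm LKbang_cutfree_rule.

Inductive LK_rule : seq (sequent pformula) -> sequent pformula -> Prop :=
| LK_ax A : LK_rule [::] ([:: A], [:: A])
| LK_topR : LK_rule [::] ([::], [:: PTop])
| LK_botL : LK_rule [::] ([:: PBot], [::])
| LK_andL1 Γ Δ A B : LK_rule [:: (A :: Γ, Δ)] (PAnd A B :: Γ, Δ)
| LK_andL2 Γ Δ A B : LK_rule [:: (B :: Γ, Δ)] (PAnd A B :: Γ, Δ)
| LK_andR Γ Δ A B : LK_rule [:: (Γ, A :: Δ); (Γ, B :: Δ)] (Γ, PAnd A B :: Δ)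
| LK_orL Γ Δ A B : LK_rule [:: (A :: Γ, Δ); (B :: Γ, Δ)] (POr A B :: Γ, Δ)
| LK_orR1 Γ Δ A B : LK_rule [:: (Γ, A :: Δ)] (Γ, POr A B :: Δ)
| LK_orR2 Γ Δ A B : LK_rule [:: (Γ, B :: Δ)] (Γ, POr A B :: Δ)
| LK_impL Γ Δ Σ Λ A B :
    LK_rule [:: (Γ, A :: Δ); (B :: Σ, Λ)] (PImp A B :: Γ ++ Σ, Δ ++ Λ)
| LK_impR Γ Δ A B : LK_rule [:: (A :: Γ, B :: Δ)] (Γ, PImp A B :: Δ)
| LK_weakL Γ Δ A : LK_rule [:: (Γ, Δ)] (A :: Γ, Δ)
| LK_weakR Γ Δ A : LK_rule [:: (Γ, Δ)] (Γ, A :: Δ)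
| LK_contrL Γ Δ A : LK_rule [:: (A :: A :: Γ, Δ)] (A :: Γ, Δ)
| LK_contrR Γ Δ A : LK_rule [:: (Γ, A :: A :: Δ)] (Γ, A :: Δ)
| LK_cut Γ Δ Σ Λ A : LK_rule [:: (Γ, A :: Δ); (A :: Σ, Λ)] (Γ ++ Σ, Δ ++ Λ).

Definition LK := up_to_perm LK_rule.

(** * Clique and Color *)

(* The Boolean is the sign of the literal. *)
Definition literal : Type := (bool * atom)%type.

Definition literal_formula (l : literal) : uformula :=
  if l.1 then UAtom l.2 else UNeg (UAtom l.2).

Definition complement (l : literal) : literal := (~~ l.1, l.2).

(* Lists of clauses, each clause being the list of its literals. *)
Definition cnf_formula (C : seq (seq literal)) : uformula :=
  ubigand [seq ubigor (map literal_formula c) | c <- C].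

Definition negated_cnf_formula (C : seq (seq literal)) : uformula :=
  ubigor [seq ubigand [seq literal_formula (complement l) | l <- c] | c <- C].

Definition distinct_pairs (n : nat) : seq (nat * nat) :=
  [seq ij <- allpairs pair (iota 0 n) (iota 0 n) | ij.1 != ij.2].

Definition increasing_pairs (n : nat) : seq (nat * nat) :=
  [seq ij <- allpairs pair (iota 0 n) (iota 0 n) | ij.1 < ij.2].

(* In the last family (u,v) is an ordered pair, so that i < j loses no
   instance. *)
Definition clique_clauses (n k : nat) : seq (seq literal) :=
  [seq [seq (true, Rvar u i) | i <- iota 0 n] | u <- iota 0 k]
  ++ [seq [:: (false, Rvar u ij.1); (false, Rvar u ij.2)]
       | u <- iota 0 k, ij <- distinct_pairs n]
  ++ [seq [:: (false, Rvar uv.1 i); (false, Rvar uv.2 i)]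
       | uv <- distinct_pairs k, i <- iota 0 n]
  ++ [seq [:: (false, Rvar uv.1 ij.1); (false, Rvar uv.2 ij.2); (true, Avar ij.1 ij.2)]
       | uv <- distinct_pairs k, ij <- increasing_pairs n].

Definition color_clauses (n m : nat) : seq (seq literal) :=
  [seq [seq (true, Svar i a) | a <- iota 0 m] | i <- iota 0 n]
  ++ [seq [:: (false, Svar i ab.1); (false, Svar i ab.2)]
       | i <- iota 0 n, ab <- distinct_pairs m]
  ++ [seq [:: (false, Svar ij.1 a); (false, Svar ij.2 a); (false, Avar ij.1 ij.2)]
       | a <- iota 0 m, ij <- increasing_pairs n].

Definition Clique (n : nat) : uformula :=
  cnf_formula (clique_clauses n (Nat.sqrt n).+1).

Definition ColorBar (n : nat) : uformula :=
  negated_cnf_formula (color_clauses n (Nat.sqrt n)).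

Definition in_ps (n : nat) (x : atom) : bool :=
  match x with
  | Avar i j => i < j < n
  | Rvar _ _ => false
  | Svar i a => (i < n) && (a < Nat.sqrt n)
  end.

Definition over_ps (n : nat) (A : uformula) : bool := all (in_ps n) (uvars A).

Definition ps_part (n : nat) (Σ : seq uformula) : seq uformula :=
  [seq A <- Σ | over_ps n A].

Definition ps_rest (n : nat) (Σ : seq uformula) : seq uformula :=
  [seq A <- Σ | ~~ over_ps n A].

Definition S_sequent (n : nat) (Σ : seq uformula) : sequent uformula :=
  (Clique n :: ps_rest n Σ, [:: UImp (bigfusion (ps_part n Σ)) (ColorBar n)]).

Definition xsequent (s : sequent uformula) : sequent xformula :=
  (map xform s.1, map xform s.2).

Definition pow2_pow (n : nat) (eps : R) : R := Rpower 2 (Rpower (INR n) eps).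

(* Main.v *)
Require Import Defs.
From Stdlib Require Import Reals Lra.
From HB Require Import structures.
From mathcomp Require Import all_boot zify.

(* Sigma_n consists of many copies of single-variable formulas granting excluded
   middle, explosion and weakening for each atom.  Since FL_e keeps cut, a
   classical refutation organised as a decision tree (each node splits on a
   formula, each leaf is a local clash) can be simulated without contraction, and
   Clique_n, Color_n have such a tree of polynomial size: the pigeonhole principle
   "the k-th vertex of the clique has colour a" is refuted by counting the occupied
   holes with carry-save adders, all local facts about O(log n) bits being checked
   by truth tables.

   For the lower bound, every formula of a cut-free proof of S_n is a subformula of
   S_n, so it cannot mention both r and s.  This yields, along the proof, monotone
   circuits in the edge atoms that separate (sqrt n + 1)-cliques from
   sqrt n-colourable graphs, and these are exponentially large by Razborov's
   method of approximations. *)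

Set Implicit Arguments.
Unset Strict Implicit.
Unset Printing Implicit Defensive.

(** * Monotone circuits: Razborov's lower bound *)

(** Copies of the axioms are needed because a used formula is gone. A cut on [φ] spends one copy of
    the axiom list per literal occurrence in [φ], but the two branches of the case distinction that
    follows share all remaining copies, so polynomially many suffice. Weakening is recovered by
    making every formula entail [1]. For the lower bound the obstacle is that Clique_n mixes p with
    r. Its edge atoms occur only positively, so an r-free formula released from it by a cut-free
    inference is a constant or a positive edge atom, and its truth value can be adjoined to the
    interpolant without leaving monotone circuits. The single-variable axioms never mix r with p or
    s, and those over p, s sit inside the succedent of S_n, which is therefore free of r. Exhaustive
    tables are affordable because the counters have O(log n) bits; adding without carry propagation
    keeps the growth of formulas constant per level of the counting tree. The approximation argument
    is run with sets of at most t vertices and sunflowers of t^3 petals, where t^20 <= n, and gives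
    circuit size 2^t. The final exponent is 1/40 instead of 1/20 so that rounding and constant
    factors are absorbed. *)

Lemma card_bigcup_le (I T : finType) (P : pred I) (B : I -> {set T}) :
  #|\bigcup_(i | P i) B i| <= \sum_(i | P i) #|B i|.
Proof.
elim/big_ind2: _ => [|a A b C leA leC|//]; first by rewrite cards0.
by apply: leq_trans (leq_card_setU _ _) (leq_add leA leC).
Qed.

Definition sunflower (T : finType) (Z : {set T}) (S : {set {set T}}) :=
  (forall A, A \in S -> Z \subset A)
  /\ (forall A B, A \in S -> B \in S -> A != B -> A :&: B = Z).

(** Erdős-Rado with a cruder count. A maximal disjoint subfamily with [p] members is a sunflower
    with empty core; with fewer members, its union has at most [(p-1) * l0] points and meets every
    nonempty set of [F], so one point lies in many sets and can be removed from them. Keeping [l0]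
    fixed while [l] decreases keeps the base of the power constant. *)
Lemma sunflower_lemma (T : finType) (p l0 l : nat) (F : {set {set T}}) :
  0 < p -> l <= l0 -> (forall A, A \in F -> #|A| <= l) -> (p * l0) ^ l < #|F| ->
  exists Z, exists S : {set {set T}}, [/\ S \subset F, p <= #|S| & sunflower Z S].
Proof.
move=> p_gt0; elim: l F => [|l IHl] F le_l leF ltF.
  suff: #|F| <= 1 by rewrite leqNgt ltF.
  rewrite -(cards1 (set0 : {set T})) subset_leq_card //; apply/subsetP=> A /leF.
  by rewrite leqn0 cards_eq0 inE.
(* Sizes are only bounded from above, so [set0] may belong to [F]; it costs the extra summand 1 in
   the count below. *)
pose F' := F :\ set0.
pose P (S : {set {set T}}) := (S \subset F') && trivIset S.
have P0 : P set0 by rewrite /P sub0set; apply/trivIsetP=> A B; rewrite inE.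
case: (arg_maxnP (fun S : {set {set T}} => #|S|) P0) => S /andP[sSF trS] maxS.
have sS : S \subset F by apply: subset_trans sSF (subsetDl _ _).
have [leS|ltS] := leqP p #|S|.
  exists set0, S; split=> //; split=> [A _|A B AS BS nAB]; first exact: sub0set.
  by apply/eqP; rewrite setI_eq0; apply: (trivIsetP trS).
pose U := cover S.
have leU : #|U| <= p.-1 * l0.
  rewrite -(eqP trS) -(prednK p_gt0) ltnS in ltS *.
  apply: (@leq_trans (\sum_(B in S) l0)); last by rewrite sum_nat_const leq_mul2r ltS orbT.
  by apply: leq_sum => B BS; apply: leq_trans le_l; apply: leF; apply: subsetP BS.
pose Fx x := [set A in F | x \in A].
have coverF : F' \subset \bigcup_(x in U) Fx x.
  apply/subsetP=> A; rewrite !inE => /andP[A0 AF].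
  have [x xA xU] : exists2 x, x \in A & x \in U.
    apply/exists_inP; apply: contraT; rewrite negb_exists_in => /forall_inP dAU.
    have dA B : B \in S -> [disjoint A & B].
      move=> BS; rewrite -setI_eq0; apply/eqP/setP=> y; rewrite !inE.
      by apply/negP=> /andP[/dAU/negP yA yB]; apply: yA; apply/bigcupP; exists B.
    have nAS : A \notin S.
      by apply/negP=> /dA; rewrite -setI_eq0 setIid; apply/negP.
    have /maxS : P (A |: S).
      rewrite /P subUset sub1set !inE A0 AF sSF /=; apply/trivIsetP=> B C.
      rewrite !inE => /orP[/eqP->|BS] /orP[/eqP->|CS] nBC.
      - by rewrite eqxx in nBC.
      - exact: dA.
      - by rewrite disjoint_sym dA.
      - exact: (trivIsetP trS).
    by rewrite cardsU1 nAS /=; lia.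
  by apply/bigcupP; exists x => //; rewrite inE AF.
have [x ltx] : exists x, (p * l0) ^ l < #|Fx x|.
  apply/existsP; apply: contraLR ltF; rewrite negb_exists -leqNgt => /forallP leFx.
  have: #|F'| <= #|U| * (p * l0) ^ l.
    apply: (leq_trans (subset_leq_card coverF)).
    apply: (leq_trans (card_bigcup_le _ _)).
    rewrite -sum_nat_const; apply: leq_sum => x _; rewrite leqNgt; exact: leFx.
  have := cardsD1 set0 F; rewrite -/F' => -> leF'.
  have := leq_mul leU (leqnn ((p * l0) ^ l)) => leU'.
  have Q_gt0 : 0 < (p * l0) ^ l by rewrite expn_gt0 muln_gt0 p_gt0; lia.
  have l0_gt0 : 0 < l0 by apply: leq_trans le_l.
  have lQ : 0 < l0 * (p * l0) ^ l by rewrite muln_gt0 l0_gt0.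
  rewrite expnS -{1}(prednK p_gt0) mulSn mulnDl; apply: leq_add; first exact: leq_trans (leq_b1 _) lQ.
  exact: leq_trans leF' leU'.
pose G := [set A :\ x | A in Fx x].
have [] := IHl G; rewrite ?(ltnW le_l) //.
- by move=> _ /imsetP[A + ->]; rewrite inE => /andP[/leF + xA]; rewrite (cardsD1 x A) xA.
- rewrite card_in_imset // => A B; rewrite !inE => /andP[_ xA] /andP[_ xB] eAB.
  by rewrite -(setD1K xA) -(setD1K xB) eAB.
move=> Z [S' [sS' leS' [ZS' S'I]]].
have S'x B : B \in S' -> x \notin B /\ x |: B \in F.
  move=> /(subsetP sS') /imsetP[A + ->]; rewrite !inE eqxx => /andP[AF xA].
  by rewrite setD1K.
exists (x |: Z), [set x |: B | B in S']; split.
- by apply/subsetP=> _ /imsetP[B /S'x [_ ?] ->].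
- rewrite card_in_imset // => B C /S'x[xB _] /S'x[xC _] eBC.
  by rewrite -(setU1K xB) -(setU1K xC) eBC.
- split=> [_ /imsetP[B BS ->]|_ _ /imsetP[B BS ->] /imsetP[C CS ->] nBC].
    by rewrite setUS // ZS'.
  rewrite -setUIr S'I //; apply: contraNneq nBC => ->; exact: eqxx.
Qed.

(** * Random colourings and the plucking of sunflowers *)

Section Approximation.

Variables (n m : nat).
Implicit Types (c : {ffun 'I_n -> 'I_m}) (X Y Z K : {set 'I_n}) (F S : {set {set 'I_n}}).

(** Equivalently, [X] is a clique in the complete multipartite graph of [c]. *)
Definition rainbow c X := [forall i in X, forall j in X, (c i == c j) ==> (i == j)].

Lemma rainbowP c X : reflect {in X &, injective c} (rainbow c X).
Proof.
apply: (iffP forall_inP) => [h i j iX jX /eqP e|h i iX].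
  by move/forall_inP: (h i iX) => /(_ j jX); rewrite e => /eqP.
by apply/forall_inP=> j jX; apply/implyP=> /eqP /h ->.
Qed.

Lemma rainbow_sub c X Y : X \subset Y -> rainbow c Y -> rainbow c X.
Proof.
by move=> sXY /rainbowP inj; apply/rainbowP=> i j /(subsetP sXY) iY /(subsetP sXY) jY; apply: inj.
Qed.

(* Recolouring [i] freely embeds [{c in X | c i = c j}] times the colours into [X]. *)
Lemma card_same_color (B : {set {ffun 'I_n -> 'I_m}}) i j :
  i != j ->
  (forall c a, c \in B -> [ffun x => if x == i then a else c x] \in B) ->
  #|[set c in B | c i == c j]| * m <= #|B|.
Proof.
move=> nij invB; set E := [set _ in _ | _].
rewrite -[X in _ * X]card_ord -cardsT -cardsX.
pose h (ca : {ffun 'I_n -> 'I_m} * 'I_m) : {ffun 'I_n -> 'I_m} :=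
  [ffun x => if x == i then ca.2 else ca.1 x].
rewrite -(card_in_imset (f := h)).
  apply: subset_leq_card; apply/subsetP=> _ /imsetP[[c a] + ->].
  by rewrite !inE => /andP[/andP[cB _] _]; apply: invB.
move=> [c a] [d b]; rewrite !inE !andbT /= => /andP[_ /eqP ec] /andP[_ /eqP ed] /ffunP eh.
have := eh i; rewrite !ffunE eqxx /= => <-; congr (_, _); apply/ffunP=> x.
have := eh x; rewrite !ffunE /=; case: eqP => // -> _.
have := eh j; rewrite !ffunE /= eq_sym (negPf nij) => ej.
by rewrite ec ed ej.
Qed.

(** For a uniformly random colouring, each petal halves the probability. Outside the core a petal is
    disjoint from all the others, so its vertices there can be recoloured freely without disturbing
    the condition already imposed by the core and the earlier petals. *)
Lemma card_not_rainbow_petals l Z S :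
  2 * l ^ 2 <= m -> 0 < m -> sunflower Z S -> (forall A, A \in S -> #|A| <= l) ->
  #|[set c | rainbow c Z & [forall A in S, ~~ rainbow c A]]| * 2 ^ #|S| <= m ^ n.
Proof.
move=> le_lm m_gt0 [ZS SI] leS.
suff H (s : seq {set 'I_n}) : uniq s -> {subset s <= S} ->
    #|[set c | rainbow c Z & all (fun A => ~~ rainbow c A) s]| * 2 ^ size s <= m ^ n.
  have := H (enum S) (enum_uniq _); rewrite -cardE.
  have -> : [set c | rainbow c Z & all (fun A => ~~ rainbow c A) (enum S)]
          = [set c | rainbow c Z & [forall A in S, ~~ rainbow c A]].
    apply/setP=> c; rewrite !inE; congr (_ && _); apply/allP/forall_inP => h A.
      by move=> AS; apply: h; rewrite mem_enum.
    by rewrite mem_enum; apply: h.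
  by apply=> A; rewrite mem_enum.
elim: s => [|A s IHs] /=.
  move=> _ _; rewrite muln1; apply: leq_trans (max_card _) _.
  by rewrite card_ffun !card_ord.
move=> /andP[nAs us] sub.
have AS : A \in S by apply: sub; rewrite mem_head.
have subs : {subset s <= S} by move=> B Bs; apply: sub; rewrite inE Bs orbT.
have {IHs} := IHs us subs.
set B := [set _ | _]; set B' := [set _ | _] => leB.
have le1 i j : i \in A :\: Z -> i != j -> #|[set c in B | c i == c j]| * m <= #|B|.
  rewrite inE => /andP[iZ iA] nij; apply: card_same_color => // c a.
  have eqr X : i \notin X -> rainbow [ffun x => if x == i then a else c x] X = rainbow c X.
    move=> iX; apply/rainbowP/rainbowP=> inj x y xX yX; have := inj x y xX yX;
    by rewrite !ffunE (negPf (memPn iX x xX)) (negPf (memPn iX y yX)).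
  rewrite !inE eqr // => /andP[-> /allP nr]; apply/allP=> C Cs; rewrite eqr ?nr //.
  have nAC : A != C by apply: contraNneq nAs => ->.
  apply: contraNN iZ => iC; by rewrite -(SI A C AS (subs C Cs) nAC) inE iA.
(* As the core is rainbow, a colour collision inside [A] has an endpoint outside the core. There are
   at most [l ^ 2] such pairs, each of conditional probability at most 1/m, and [2 * l ^ 2 <= m]. *)
have sB : B' \subset \bigcup_(ij in setX (A :\: Z) A | ij.1 != ij.2) [set c in B | c ij.1 == c ij.2].
  apply/subsetP=> c; rewrite !inE => /and3P[rZ rA rs].
  have [i [j [iA jA nij eij]]] : exists i j, [/\ i \in A, j \in A, i != j & c i == c j].
    move: rA; rewrite negb_forall_in => /exists_inP[i iA].
    rewrite negb_forall_in => /exists_inP[j jA]; rewrite negb_imply => /andP[e ne].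
    by exists i, j.
  have [iZ|iZ] := boolP (i \in Z); last first.
    by apply/bigcupP; exists (i, j); rewrite !inE /= ?iZ ?iA ?jA ?nij ?rZ ?rs.
  have [jZ|jZ] := boolP (j \in Z).
    by move/rainbowP: rZ nij => /(_ i j iZ jZ (eqP eij)) ->; rewrite eqxx.
  by apply/bigcupP; exists (j, i); rewrite !inE /= ?jZ ?iA ?jA 1?eq_sym ?nij ?rZ ?rs ?eij.
have leB' : #|B'| * m <= l ^ 2 * #|B|.
  apply: (@leq_trans (\sum_(ij in setX (A :\: Z) A | ij.1 != ij.2) #|B|)).
    apply: (@leq_trans ((\sum_(ij in setX (A :\: Z) A | ij.1 != ij.2)
        #|[set c in B | c ij.1 == c ij.2]|) * m)).
      rewrite leq_mul2r; apply/orP; right.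
      apply: leq_trans (subset_leq_card sB) _.
      exact: card_bigcup_le.
    rewrite big_distrl /=; apply: leq_sum => -[i j] /andP[].
    by rewrite inE /= => /andP[iAZ jA] nij; apply: le1.
  rewrite sum_nat_const leq_mul2r; apply/orP; right.
  apply: (@leq_trans #|setX (A :\: Z) A|).
    by apply: subset_leq_card; apply/subsetP=> x /andP[].
  rewrite cardsX; have := leS A AS; have := subset_leq_card (subsetDl A Z).
  by rewrite expnS expn1; nia.
suff h : #|B'| * 2 <= #|B| by rewrite expnS mulnA; apply: leq_trans leB; rewrite leq_mul2r h orbT.
by rewrite -(leq_pmul2r m_gt0); move: leB' le_lm; clear; nia.
Qed.

Section Families.

Variables (l p : nat).
Hypotheses (le_lm : 2 * l ^ 2 <= m) (m_gt0 : 0 < m) (p_gt1 : 1 < p).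

(** A family stands for the disjunction of the clique tests of its members; it is evaluated on the
    two kinds of test graphs, the clique on [K] and the multipartite graph of a colouring. *)
Definition accepts_clique F K := [exists X in F, X \subset K].
Definition accepts_coloring F c := [exists X in F, rainbow c X].
Definition bounded F := [forall X in F, #|X| <= l].

Lemma accepts_cliqueP F K :
  reflect (exists2 X, X \in F & X \subset K) (accepts_clique F K).
Proof. exact: exists_inP. Qed.

Lemma accepts_coloringP F c :
  reflect (exists2 X, X \in F & rainbow c X) (accepts_coloring F c).
Proof. exact: exists_inP. Qed.

(* Repeatedly replace a sunflower by its core. *)
Lemma pluck F : bounded F ->
  exists F', exists N : {set {ffun 'I_n -> 'I_m}},
    [/\ bounded F', #|F'| <= (p * l) ^ l, #|N| * 2 ^ p <= #|F| * m ^ n,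
        forall K, accepts_clique F K -> accepts_clique F' K
      & forall c, c \notin N -> accepts_coloring F' c -> accepts_coloring F c].
Proof.
elim: {F}_.+1 {-2}F (ltnSn #|F|) => // q IHq F; rewrite ltnS => leFq /forall_inP bF.
have [le|gt] := leqP #|F| ((p * l) ^ l).
  by exists F, set0; split=> //; [apply/forall_inP | rewrite cards0].
have [Z [S [sSF leS sun]]] := sunflower_lemma (ltnW p_gt1) (leqnn l) bF gt.
have [A0 A0S] : exists A, A \in S by apply/card_gt0P; lia.
pose F1 := Z |: (F :\: S).
have ltF1 : #|F1| < #|F|.
  rewrite /F1 cardsU1; have := cardsID S F; rewrite (setIidPr sSF).
  have := leq_b1 (Z \notin F :\: S); by move=> le1 <-; rewrite ltn_add2r (leq_ltn_trans le1) ?(leq_trans p_gt1).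
have bF1 : bounded F1.
  apply/forall_inP=> X; rewrite !inE => /orP[/eqP->|/andP[_ /bF //]].
  by apply: leq_trans (subset_leq_card (sun.1 _ A0S)) (bF _ (subsetP sSF _ A0S)).
have [F' [N [bF' leF' leN posF' negF']]] := IHq F1 (leq_trans ltF1 leFq) bF1.
(* Replacing the petals by the core loses no clique and errs only on colourings for which the core
   is rainbow and no petal is. Every round shrinks the family, so at most [#|F|] such error sets
   accumulate. *)
pose N1 := [set c | rainbow c Z & [forall A in S, ~~ rainbow c A]].
have leN1 : #|N1| * 2 ^ p <= m ^ n.
  apply: leq_trans (card_not_rainbow_petals le_lm m_gt0 sun _).
    by rewrite leq_mul2l leq_exp2l ?leS ?orbT.
  by move=> A /(subsetP sSF); apply: bF.
exists F', (N :|: N1); split=> //.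
- apply: (@leq_trans ((#|N| + #|N1|) * 2 ^ p)).
    by rewrite leq_mul2r leq_card_setU orbT.
  rewrite mulnDl; apply: leq_trans (leq_add leN leN1) _.
  by rewrite -mulSnr leq_mul2r ltF1 orbT.
- move=> K /accepts_cliqueP[X XF XK]; apply: posF'; apply/accepts_cliqueP.
  have [XS|nXS] := boolP (X \in S); last by exists X; rewrite // !inE nXS XF orbT.
  by exists Z; rewrite ?setU11 //; apply: subset_trans XK; apply: sun.1.
- move=> c; rewrite inE negb_or => /andP[cN cN1] /(negF' c cN) /accepts_coloringP[X].
  rewrite !inE => /orP[/eqP->|/andP[_ XF] cX]; last by apply/accepts_coloringP; exists X.
  move=> cZ; move: cN1; rewrite inE cZ negb_forall_in => /exists_inP[A AS].
  by rewrite negbK => cA; apply/accepts_coloringP; exists A => //; apply: subsetP sSF _ AS.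
Qed.

End Families.

End Approximation.

(** In cross-multiplied form: a random k-subset of an n-set contains [b] given points with
    probability at most (k/n)^b, because every factor (k-i)/(n-i) is at most k/n. *)
Lemma bin_ratio n k b : b <= k -> k <= n -> 'C(n - b, k - b) * n ^ b <= 'C(n, k) * k ^ b.
Proof.
elim: b => [|b IHb] ltbk lekn; first by rewrite !subn0.
have {IHb} := IHb (ltnW ltbk) lekn.
have := mul_bin_diag (n - b) (k - b.+1); rewrite -subnS.
have -> : (k - b.+1).+1 = k - b by lia.
set x := 'C(_, _); set y := 'C(n - b, _); set z := 'C(n, k); rewrite !expnS => e le.
have h : x * n <= y * k.
  have nb : 0 < n - b by lia.
  rewrite -(leq_pmul2l nb) mulnA e.
  have : (k - b) * n <= (n - b) * k by rewrite !mulnBl; nia.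
  by move=> h; rewrite -mulnA mulnCA [X in _ <= X]mulnCA leq_mul2l h orbT.
by apply: (@leq_trans (y * k * n ^ b)); [rewrite mulnA leq_mul2r h orbT | rewrite mulnAC mulnCA (mulnC _ k) leq_mul2l le orbT].
Qed.

Lemma card_supersets (T : finType) (B : {set T}) k :
  #|[set K : {set T} | #|K| == k & B \subset K]| <= 'C(#|T| - #|B|, k - #|B|).
Proof.
have -> : #|T| - #|B| = #|~: B| by rewrite -(cardsC B) addKn.
rewrite -cards_draws -(card_in_imset (f := fun K => K :\: B)).
  apply: subset_leq_card; apply/subsetP=> _ /imsetP[K + ->].
  rewrite !inE => /andP[/eqP <- sBK]; rewrite cardsD (setIidPr sBK) eqxx andbT.
  by rewrite setDE subsetIr.
move=> K K'; rewrite !inE => /andP[_ sK] /andP[_ sK'] e.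
by rewrite -(setID K B) -(setID K' B) e (setIidPr sK) (setIidPr sK').
Qed.

Lemma card_supersets_ratio (T : finType) (B : {set T}) k b :
  k <= #|T| -> b <= #|B| ->
  #|[set K : {set T} | #|K| == k & B \subset K]| * #|T| ^ b <= 'C(#|T|, k) * k ^ b.
Proof.
move=> lekT lebB; have [lt|le] := ltnP k #|B|.
  rewrite (_ : [set _ | _] = set0) ?cards0 //; apply/setP=> K; rewrite !inE.
  by apply/negP=> /andP[/eqP eK /subset_leq_card]; rewrite eK leqNgt lt.
have [T0|T0] := posnP #|T|.
  have -> : b = 0 by have := max_card (mem B); lia.
  rewrite !muln1; apply: leq_trans (card_supersets _ _) _.
  by rewrite T0 (_ : k = 0) //; lia.
have := bin_ratio le lekT; have := card_supersets B k.
set x := #|_|; set y := 'C(_ - _, _) => lexy ley.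
have h : x * #|T| ^ #|B| <= 'C(#|T|, k) * k ^ #|B|.
  by apply: leq_trans ley; rewrite leq_mul2r lexy orbT.
have d0 : 0 < #|T| ^ (#|B| - b) by rewrite expn_gt0 T0.
rewrite -(leq_pmul2r d0) -!mulnA -expnD subnKC //; apply: leq_trans h _.
rewrite leq_mul2l -{1}(subnKC lebB) expnD leq_mul2l.
by case: (#|B| - b) => [|d]; rewrite ?expn0 ?leqnn ?orbT // leq_exp2r // lekT !orbT.
Qed.

(** * Monotone circuits and their approximation gate by gate *)

Definition gate := (nat -> nat -> bool) -> bool.

(** A straight-line program, newest gate first. Gates are stored as the Boolean functions they
    compute, and membership is [List.In] because functions have no decidable equality. *)
Inductive mono_circuit : seq gate -> Prop :=
| circuit_nil : mono_circuit [::]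
| circuit_edge fs i j : mono_circuit fs -> mono_circuit ((fun g => g i j) :: fs)
| circuit_const fs b : mono_circuit fs -> mono_circuit ((fun=> b) :: fs)
| circuit_and fs f1 f2 : mono_circuit fs -> List.In f1 fs -> List.In f2 fs ->
    mono_circuit ((fun g => f1 g && f2 g) :: fs)
| circuit_or fs f1 f2 : mono_circuit fs -> List.In f1 fs -> List.In f2 fs ->
    mono_circuit ((fun g => f1 g || f2 g) :: fs).

Definition clique_graph (vs : seq nat) (i j : nat) : bool :=
  [&& i < j, i \in vs & j \in vs].

Definition coloring_graph (n : nat) (c : nat -> nat) (i j : nat) : bool :=
  [&& i < j, j < n & c i != c j].

Definition vertices n (K : {set 'I_n}) : seq nat := [seq val x | x <- enum K].

Definition color_of n m (c : {ffun 'I_n -> 'I_m}) (i : nat) : nat :=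
  if insub i is Some x then val (c x) else 0.

Section LowerBound.

Variables (n m k l p : nat).
Implicit Types (F : {set {set 'I_n}}) (P : {set {set 'I_n}}) (N : {set {ffun 'I_n -> 'I_m}}).
Hypotheses (le_lm : 2 * l ^ 2 <= m) (p_gt1 : 1 < p) (l_gt1 : 1 < l) (le_kn : k <= n).

Let m0 := (p * l) ^ l.

Let m_gt0 : 0 < m. Proof. by apply: leq_trans le_lm; rewrite muln_gt0 expn_gt0; lia. Qed.
Let m0_gt0 : 0 < m0. Proof. by rewrite expn_gt0 muln_gt0; lia. Qed.

(** Only one direction of error matters on each kind of test graph: [P] absorbs the k-cliques that
    the family loses, [N] the colourings that it wrongly gains. The same [P] and [N] serve all gates
    of a circuit, so they have to be allowed to grow. *)
Definition approximates F P N (f : gate) :=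
  [/\ bounded l F, #|F| <= m0,
      forall K : {set 'I_n}, #|K| = k -> K \notin P -> f (clique_graph (vertices K)) ->
        accepts_clique F K
    & forall c : {ffun 'I_n -> 'I_m}, c \notin N -> accepts_coloring F c -> f (coloring_graph n (color_of c))].

Lemma approximates_mono F P N f P' N' :
  P \subset P' -> N \subset N' -> approximates F P N f -> approximates F P' N' f.
Proof.
move=> /subsetP sP /subsetP sN [bF leF pos neg]; split=> // [K eK nK|c nc].
  by apply: pos => //; apply: contra nK; apply: sP.
by apply: neg; apply: contra nc; apply: sN.
Qed.

Lemma approx_const b : exists F, approximates F set0 set0 (fun=> b).
Proof.
case: b; last first.
  exists set0; split=> //; first by apply/forall_inP=> X; rewrite inE.
    by rewrite cards0.
  by move=> c _ /accepts_coloringP[X]; rewrite inE.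
exists [set set0]; split=> //; first by apply/forall_inP=> X; rewrite inE => /eqP->; rewrite cards0.
  by rewrite cards1.
by move=> K _ _ _; apply/accepts_cliqueP; exists set0; rewrite ?set11 ?sub0set.
Qed.

(** An edge is the clique test of its two endpoints, allowed because [1 < l]. A pair that violates
    [i < j < n] is an edge of no test graph, so the approximation of the constant false serves. *)
Lemma approx_edge i j : exists F, approximates F set0 set0 (fun g => g i j).
Proof.
have [/andP[ltij ltjn]|nij] := boolP (i < j < n); last first.
  have [F [bF leF _ neg]] := approx_const false; exists F; split=> // [K _ _|c].
    case/and3P=> ltij _ /mapP[x _ ej]; case/negP: nij.
    by rewrite ltij ej ltn_ord.
  by move=> /neg h /h.
pose x := Ordinal (ltn_trans ltij ltjn); pose y := Ordinal ltjn.
exists [set [set x; y]]; split.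
- apply/forall_inP=> X; rewrite inE => /eqP->; rewrite cards2; lia.
- by rewrite cards1.
- move=> K _ _ /and3P[_ /mapP[a aK ea] /mapP[b bK eb]].
  apply/accepts_cliqueP; exists [set x; y]; rewrite ?set11 // subUset !sub1set.
  have -> : x = a by apply: val_inj.
  have -> : y = b by apply: val_inj.
  by move: aK bK; rewrite !mem_enum => -> ->.
move=> c _ /accepts_coloringP[X]; rewrite inE => /eqP-> /rainbowP inj.
rewrite /coloring_graph ltij ltjn /color_of /= (insubT (fun i => i < n) ltjn).
rewrite (insubT (fun i => i < n) (ltn_trans ltij ltjn)) /=; apply/eqP=> /val_inj e.
have := inj x y; rewrite !inE !eqxx orbT => /(_ isT isT e) /(congr1 val) /= eij.
by move: (ltij); rewrite eij ltnn.
Qed.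

(** The union of the families represents the disjunction exactly; only plucking errs, and only on
    colourings. The bound is stated with [m0 ^ 2] to agree with the one for conjunctions. *)
Lemma approx_or F1 F2 P N f1 f2 : approximates F1 P N f1 -> approximates F2 P N f2 ->
  exists F N', #|N'| * 2 ^ p <= 2 * m0 ^ 2 * m ^ n
    /\ approximates F P (N :|: N') (fun g => f1 g || f2 g).
Proof.
move=> [bF1 leF1 pos1 neg1] [bF2 leF2 pos2 neg2].
have bF : bounded l (F1 :|: F2).
  by apply/forall_inP=> X /setUP[/(forall_inP bF1)|/(forall_inP bF2)].
have [F [N' [bF' leF leN pos neg]]] := pluck le_lm m_gt0 p_gt1 bF.
exists F, N'; split.
  apply: leq_trans leN _; rewrite leq_mul2r; apply/orP; right.
  apply: leq_trans (leq_card_setU _ _) _; move: leF1 leF2 m0_gt0; clear; nia.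
split=> //.
- move=> K eK nK /orP[/(pos1 K eK nK)|/(pos2 K eK nK)] /accepts_cliqueP[X XF XK];
  by apply: pos; apply/accepts_cliqueP; exists X; rewrite // inE XF ?orbT.
- move=> c; rewrite inE negb_or => /andP[cN cN'] /(neg c cN') /accepts_coloringP[X XF cX].
  case/setUP: XF => XF; apply/orP; [left; apply: neg1 | right; apply: neg2] => //;
  by apply/accepts_coloringP; exists X.
Qed.

(** Pairwise unions represent the conjunction exactly on cliques and never gain a colouring. Unions
    with more than [l] points are dropped; each loses only cliques that contain at least [l.+1]
    given points, which is a fraction of at most (k/n)^(l+1). *)
Lemma approx_and F1 F2 P N f1 f2 : approximates F1 P N f1 -> approximates F2 P N f2 ->
  exists F P' N', [/\ #|P'| * n ^ l.+1 <= 2 * m0 ^ 2 * ('C(n, k) * k ^ l.+1),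
      #|N'| * 2 ^ p <= 2 * m0 ^ 2 * m ^ n
    & approximates F (P :|: P') (N :|: N') (fun g => f1 g && f2 g)].
Proof.
move=> [bF1 leF1 pos1 neg1] [bF2 leF2 pos2 neg2].
pose F := [set XY.1 :|: XY.2 | XY in setX F1 F2] :&: [set X : {set 'I_n} | #|X| <= l].
have bF : bounded l F by apply/forall_inP=> X; rewrite !inE => /andP[].
have leFF : #|setX F1 F2| <= m0 ^ 2 by rewrite cardsX expnS expn1 leq_mul.
have [F' [N' [bF' leF' leN pos neg]]] := pluck le_lm m_gt0 p_gt1 bF.
pose P' := \bigcup_(XY in setX F1 F2 | l < #|XY.1 :|: XY.2|)
             [set K : {set 'I_n} | #|K| == k & XY.1 :|: XY.2 \subset K].
exists F', P', N'; split.
- apply: (@leq_trans (\sum_(XY in setX F1 F2 | l < #|XY.1 :|: XY.2|) ('C(n, k) * k ^ l.+1))).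
    apply: leq_trans (_ : _ <= (\sum_(XY in setX F1 F2 | l < #|XY.1 :|: XY.2|)
       #|[set K : {set 'I_n} | #|K| == k & XY.1 :|: XY.2 \subset K]|) * n ^ l.+1) _.
      by rewrite leq_mul2r card_bigcup_le orbT.
    rewrite big_distrl /=; apply: leq_sum => XY /andP[_ lt].
    have := @card_supersets_ratio _ (XY.1 :|: XY.2) k l.+1; rewrite card_ord; exact.
  rewrite sum_nat_const leq_mul2r; apply/orP; right.
  apply: (@leq_trans #|setX F1 F2|); last by move: leFF; lia.
  by apply: subset_leq_card; apply/subsetP=> x /andP[].
- apply: leq_trans leN _; rewrite leq_mul2r; apply/orP; right.
  apply: (@leq_trans #|setX F1 F2|); last by move: leFF; lia.
  by apply: leq_trans (subset_leq_card (subsetIl _ _)) (leq_imset_card _ _).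
split=> //.
- move=> K eK; rewrite inE negb_or => /andP[KP KP'] /andP[].
  move=> /(pos1 K eK KP) /accepts_cliqueP[X XF XK] /(pos2 K eK KP) /accepts_cliqueP[Y YF YK].
  apply: pos; apply/accepts_cliqueP; exists (X :|: Y); last by rewrite subUset XK.
  rewrite inE [_ \in [set X : {set 'I_n} | _]]inE; apply/andP; split.
    by apply/imsetP; exists (X, Y); rewrite // inE XF.
  rewrite leqNgt; apply: contra KP' => lt; apply/bigcupP; exists (X, Y).
    by rewrite inE XF YF.
  by rewrite inE eK eqxx subUset XK.
- move=> c; rewrite inE negb_or => /andP[cN cN'] /(neg c cN') /accepts_coloringP[Z].
  rewrite inE => /andP[/imsetP[[X Y] + ->] _]; rewrite inE /= => /andP[XF YF] cXY.
  apply/andP; split; [apply: neg1 | apply: neg2] => //; apply/accepts_coloringP.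
    by exists X => //; apply: rainbow_sub cXY; apply: subsetUl.
  by exists Y => //; apply: rainbow_sub cXY; apply: subsetUr.
Qed.

Lemma circuit_approximable fs : mono_circuit fs -> exists P N,
  [/\ #|P| * n ^ l.+1 <= size fs * (2 * m0 ^ 2 * ('C(n, k) * k ^ l.+1)),
      #|N| * 2 ^ p <= size fs * (2 * m0 ^ 2 * m ^ n)
    & forall f, List.In f fs -> exists F, approximates F P N f].
Proof.
elim=> [|{}fs i j _ [P [N [leP leN appr]]]|{}fs b _ [P [N [leP leN appr]]]
  |{}fs f1 f2 _ [P [N [leP leN appr]]] /appr[F1 a1] /appr[F2 a2]
  |{}fs f1 f2 _ [P [N [leP leN appr]]] /appr[F1 a1] /appr[F2 a2]] /=.
- by exists set0, set0; rewrite !cards0.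
- exists P, N; split; [by apply: leq_trans leP _; rewrite leq_mul2r leqnSn orbT
    | by apply: leq_trans leN _; rewrite leq_mul2r leqnSn orbT |].
  move=> f [<-|/appr //]; have [F h] := approx_edge i j; exists F.
  by apply: approximates_mono h; apply: sub0set.
- exists P, N; split; [by apply: leq_trans leP _; rewrite leq_mul2r leqnSn orbT
    | by apply: leq_trans leN _; rewrite leq_mul2r leqnSn orbT |].
  move=> f [<-|/appr //]; have [F h] := approx_const b; exists F.
  by apply: approximates_mono h; apply: sub0set.
- have [F [P' [N' [leP' leN' h]]]] := approx_and a1 a2.
  exists (P :|: P'), (N :|: N'); split.
  + apply: (@leq_trans ((#|P| + #|P'|) * n ^ l.+1)); first by rewrite leq_mul2r leq_card_setU orbT.
    by rewrite mulnDl mulSn addnC leq_add.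
  + apply: (@leq_trans ((#|N| + #|N'|) * 2 ^ p)); first by rewrite leq_mul2r leq_card_setU orbT.
    by rewrite mulnDl mulSn addnC leq_add.
  move=> f [<-|/appr [G a]]; first by exists F.
  by exists G; apply: approximates_mono a; apply: subsetUl.
- have [F [N' [leN' h]]] := approx_or a1 a2.
  exists P, (N :|: N'); split.
  + by apply: leq_trans leP _; rewrite leq_mul2r leqnSn orbT.
  + apply: (@leq_trans ((#|N| + #|N'|) * 2 ^ p)); first by rewrite leq_mul2r leq_card_setU orbT.
    by rewrite mulnDl mulSn addnC leq_add.
  move=> f [<-|/appr [G a]]; first by exists F.
  by exists G; apply: approximates_mono a => //; apply: subsetUl.
Qed.

(** The petal count for the sunflower with the single petal [X] and empty core. *)
Lemma card_not_rainbow (X : {set 'I_n}) : #|X| <= l ->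
  #|[set c : {ffun 'I_n -> 'I_m} | ~~ rainbow c X]| * 2 <= m ^ n.
Proof.
move=> leX.
have sun : sunflower set0 [set X].
  by split=> [A _|A B]; rewrite ?sub0set // !inE => /eqP-> /eqP->; rewrite eqxx.
have := card_not_rainbow_petals le_lm m_gt0 sun.
have leS A : A \in [set X] -> #|A| <= l by rewrite inE => /eqP->.
move=> /(_ leS).
rewrite cards1 expn1; set B := [set _ | _]; set B' := [set _ | _].
rewrite (_ : B = B') //; apply/setP=> c; rewrite !inE.
apply/andP/idP => [[_ /forall_inP] | h]; first by apply; apply: set11.
split; first by apply/rainbowP=> i; rewrite inE.
by apply/forall_inP=> A; rewrite inE => /eqP->.
Qed.

(** At the output gate an empty family errs on every k-clique, while a nonempty one accepts at least
    half of all colourings, each of them an error. So one of the two error budgets must be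
    exhausted. *)
Lemma clique_circuit_size fs f : mono_circuit fs -> List.In f fs ->
  (forall K : {set 'I_n}, #|K| = k -> f (clique_graph (vertices K))) ->
  (forall c : {ffun 'I_n -> 'I_m}, f (coloring_graph n (color_of c)) = false) ->
  n ^ l.+1 <= size fs * (2 * m0 ^ 2) * k ^ l.+1 \/ 2 ^ p <= size fs * (2 * m0 ^ 2) * 2.
Proof.
move=> /circuit_approximable[P [N [leP leN appr]]] /appr [F [bF leF pos neg]] fK fc.
have [F0|[X XF]] := set_0Vmem F; [left|right].
  have sP : [set K : {set 'I_n} | #|K| == k] \subset P.
    apply/subsetP=> K; rewrite inE => /eqP eK; apply: contraT => nK.
    by have /accepts_cliqueP[X] := pos K eK nK (fK K eK); rewrite F0 inE.
  have := subset_leq_card sP; rewrite card_draws card_ord => leC.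
  have C0 : 0 < 'C(n, k) by rewrite bin_gt0.
  rewrite -(leq_pmul2l C0).
  apply: (@leq_trans (#|P| * n ^ l.+1)); first by rewrite leq_mul2r leC orbT.
  apply: leq_trans leP _.
  by move: (size fs) (2 * m0 ^ 2) ('C(n, k)) (k ^ l.+1) => a b e d; lia.
have leX := forall_inP bF X XF.
have sN : ~: [set c : {ffun 'I_n -> 'I_m} | ~~ rainbow c X] \subset N.
  apply/subsetP=> c; rewrite !inE negbK => cX; apply: contraT => /neg h.
  by rewrite -(fc c); apply: h; apply/accepts_coloringP; exists X.
have := cardsC [set c : {ffun 'I_n -> 'I_m} | ~~ rainbow c X].
rewrite card_ffun !card_ord; have := card_not_rainbow leX.
have := subset_leq_card sN; set a := #|~: _|; set b := #|[set _ | _]| => leaN leb eab.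
have mn0 : 0 < m ^ n by rewrite expn_gt0 m_gt0.
rewrite -(leq_pmul2l mn0).
apply: (@leq_trans (2 * (#|N| * 2 ^ p))).
  rewrite mulnA leq_mul2r; apply/orP; right.
  by move: leaN leb eab; clearbody a b; move: #|N| (m ^ n) => x y; clear; lia.
move: leN; move: (size fs) (2 * m0 ^ 2) (m ^ n) (#|N| * 2 ^ p) => x y z w; lia.
Qed.

End LowerBound.

(** Parameters [l = t] and [p = t ^ 3], so [m0 = t ^ (4 * t)]. Since the square root [m] is at least
    [t ^ 10], the factor [t ^ (8 * t)] from [m0 ^ 2] is beaten by [m ^ t.+1] in the first
    alternative, and by [2 ^ (t ^ 3)] in the second, where [9 < t] gives [10 * t ^ 2 <= t ^ 3]. *)
Lemma clique_circuit_lower_bound n t fs f : 9 < t -> t ^ 20 <= n ->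
  mono_circuit fs -> List.In f fs ->
  (forall K : {set 'I_n}, #|K| = (Nat.sqrt n).+1 -> f (clique_graph (vertices K))) ->
  (forall c : {ffun 'I_n -> 'I_(Nat.sqrt n)}, f (coloring_graph n (color_of c)) = false) ->
  2 ^ t <= size fs.
Proof.
move=> t_gt9 le_tn circ ffs fK fc; set m := Nat.sqrt n in fK fc.
have [le_mn lt_nm] : m * m <= n /\ n < m.+1 * m.+1.
  by have := Nat.sqrt_spec n; rewrite -/m; lia.
have le_tm : t ^ 10 <= m.
  by rewrite leqNgt; apply/negP=> lt; move: le_tn; rewrite (expnD t 10 10); nia.
have t_gt0 : 0 < t by lia.
have t_le a : 0 < a -> 1 < t ^ a.
  by move=> a0; apply: (@leq_trans t); [lia | rewrite -[X in X <= _]expn1 leq_pexp2l].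
have t2 : 2 * t ^ 2 <= m.
  apply: leq_trans le_tm; rewrite (expnD t 8 2) leq_mul2r; apply/orP; right; exact: t_le.
have m_gt1 : 1 < m.
  by apply: leq_trans le_tm; apply: t_le.
have lekn : m.+1 <= n by apply: leq_trans le_mn; move: m_gt1; clear; nia.
have p_gt1 : 1 < t ^ 3 by apply: t_le.
have l_gt1 : 1 < t by lia.
have eM : (t ^ 3 * t) ^ t = t ^ (4 * t) by rewrite -expnSr -expnM.
have := clique_circuit_size t2 p_gt1 l_gt1 lekn circ ffs fK fc; rewrite eM -expnM.
set g := size fs.
have le_t2 : t <= 2 ^ t by apply/ltnW/ltn_expl.
case=> [le|le].
  (* From [m * m <= n] one gets [m.+1 * m <= 2 * n], that is, the ratio of [n] to the clique size
     [m.+1] is at least m/2. *)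
  have le1 : m.+1 ^ t.+1 * m ^ t.+1 <= 2 ^ t.+1 * (g * (2 * t ^ (4 * t * 2)) * m.+1 ^ t.+1).
    apply: leq_trans (_ : 2 ^ t.+1 * n ^ t.+1 <= _); last by rewrite leq_mul2l le orbT.
    rewrite -(expnMn m.+1 m) -(expnMn 2 n) leq_exp2r //.
    by move: le_mn m_gt1; clearbody m; clear; nia.
  have k0 : 0 < m.+1 ^ t.+1 by rewrite expn_gt0.
  have le2 : m ^ t.+1 <= 2 ^ t.+2 * g * t ^ (8 * t).
    rewrite -(leq_pmul2l k0); apply: leq_trans le1 _; rewrite (expnS 2 t.+1).
    have -> : 4 * t * 2 = 8 * t by lia.
    by move: (2 ^ t.+1) (m.+1 ^ t.+1) (t ^ (8 * t)) => a b c; lia.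
  have le3 : t ^ (10 * t.+1) <= 2 ^ t.+2 * g * t ^ (8 * t).
    by apply: leq_trans le2; rewrite expnM leq_exp2r.
  have e : 10 * t.+1 = (2 * t + 10) + 8 * t by lia.
  move: le3; rewrite e expnD leq_pmul2r ?expn_gt0 ?t_gt0 // => le3.
  have le4 : 2 ^ (2 * t + 10) <= t ^ (2 * t + 10) by rewrite leq_exp2r; [apply: leq_trans t_gt9 | rewrite addnC].
  have e2 : 2 * t + 10 = t.+2 + (t + 8) by lia.
  have a0 : 0 < 2 ^ t.+2 by rewrite expn_gt0.
  move: (leq_trans le4 le3); rewrite e2 (expnD 2 t.+2 (t + 8)) (leq_pmul2l a0).
  by apply: leq_trans; rewrite leq_exp2l //; lia.
have le1 : t ^ (4 * t * 2) <= 2 ^ (8 * t ^ 2).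
  have -> : 8 * t ^ 2 = t * (4 * t * 2) by rewrite expnS expn1; lia.
  by rewrite (expnM 2 t) leq_exp2r // !muln_gt0 t_gt0.
have le2 : 2 ^ (t ^ 3) <= g * 2 ^ (8 * t ^ 2 + 2).
  apply: leq_trans le _; rewrite (expnD 2 (8 * t ^ 2) 2); move: le1.
  by move: (t ^ (4 * t * 2)) (2 ^ (8 * t ^ 2)) => a b; rewrite (_ : 2 ^ 2 = 4) //; clear; nia.
have z0 : 0 < 2 ^ (8 * t ^ 2 + 2) by rewrite expn_gt0.
rewrite -(leq_pmul2r z0); apply: leq_trans le2.
rewrite -(expnD 2 t (8 * t ^ 2 + 2)) leq_exp2l // (expnS t 2).
have : t <= t ^ 2 by rewrite expnS expn1 leq_pmulr.
have : 10 * t ^ 2 <= t * t ^ 2 by rewrite leq_mul2r t_gt9 orbT.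
by move: (t ^ 2) t_gt9 => x; clear; lia.
Qed.

(** * Monotone interpolation for cut-free proofs *)

Fixpoint xeval (v : atom -> bool) (A : xformula) : bool :=
  match A with
  | XAtom x => v x
  | XZero | XBot => false
  | XOne | XTop => true
  | XAnd A B | XMul A B => xeval v A && xeval v B
  | XOr A B => xeval v A || xeval v B
  | XImp A B => xeval v A ==> xeval v B
  | XBang A => xeval v A
  end.

Fixpoint has_var (P : pred atom) (A : xformula) : bool :=
  match A with
  | XAtom x => P x
  | XZero | XBot | XOne | XTop => false
  | XAnd A B | XMul A B | XOr A B | XImp A B => has_var P A || has_var P B
  | XBang A => has_var P A
  end.

Definition is_Rvar (x : atom) : bool := if x is Rvar _ _ then true else false.

Notation has_r := (has_var is_Rvar).

Definition simple_guard (b : bool) (A : xformula) : bool :=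
  (b && if A is XAtom (Avar _ _) then true else false) || ~~ has_var predT A.

(* [b] is the side of the sequent on which [A] occurs ([true] = left).  The
   subformulas without [r] that a clique-side formula can release must be
   constants or positive edge atoms. *)
Fixpoint clique_side (b : bool) (A : xformula) : bool :=
  (has_r A || simple_guard b A) &&
  match A with
  | XAnd A B | XMul A B | XOr A B => clique_side b A && clique_side b B
  | XImp A B => clique_side (~~ b) A && clique_side b B
  | XBang A => clique_side b A
  | _ => true
  end.

Definition splittable (s : sequent xformula) : bool :=
  all (fun A => has_r A ==> clique_side true A) s.1 &&
  all (fun A => has_r A ==> clique_side false A) s.2.

Definition refutes (P : pred xformula) (v : atom -> bool) (s : sequent xformula) : bool :=
  all (fun A => P A ==> xeval v A) s.1 && all (fun A => P A ==> ~~ xeval v A) s.2.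

Definition edges (v : atom -> bool) (i j : nat) : bool := v (Avar i j).

(** A formula belongs to the clique side iff it contains an r, whatever its ancestry, so contraction
    needs no bookkeeping. The price is that an r-free subformula changes sides when it is released
    from a formula with r; the guards below compensate for this. *)
Definition interpolates (f : gate) (s : sequent xformula) : Prop :=
  splittable s -> forall v,
    (refutes (fun A => has_r A) v s -> f (edges v))
    /\ (refutes (fun A => ~~ has_r A) v s -> ~~ f (edges v)).

Lemma interpolates_equiv f s t : sequent_equiv s t -> interpolates f s -> interpolates f t.
Proof.
case/andP=> e1 e2; rewrite /interpolates /splittable /refutes.
move=> h sp v; rewrite -!(perm_all _ e1) -!(perm_all _ e2); apply: h.
by rewrite !(perm_all _ e1) !(perm_all _ e2).
Qed.

Lemma xeval_var_free v w A : ~~ has_var predT A -> xeval v A = xeval w A.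
Proof.
by elim: A => //= [A IHA B IHB|A IHA B IHB|A IHA B IHB|A IHA B IHB];
  rewrite negb_or => /andP[/IHA-> /IHB->].
Qed.

Definition extends (k : nat) (fs fs' : seq gate) : Prop :=
  [/\ mono_circuit fs', List.incl fs fs' & size fs' <= k + size fs].

Lemma extends_trans k1 k2 fs1 fs2 fs3 :
  extends k1 fs1 fs2 -> extends k2 fs2 fs3 -> extends (k2 + k1) fs1 fs3.
Proof.
move=> [_ s12 le12] [c3 s23 le23]; split=> // [f /s12/s23 //|].
by apply: leq_trans le23 _; rewrite -addnA leq_add2l.
Qed.

Lemma extend_const fs b : mono_circuit fs -> exists fs' f,
  [/\ extends 1 fs fs', List.In f fs' & forall g, f g = b].
Proof.
move=> c; exists ((fun=> b) :: fs), (fun=> b); split=> //; last by left.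
by split=> [||//]; [apply: circuit_const | move=> f; right].
Qed.

Lemma extend_and fs f1 f2 : mono_circuit fs -> List.In f1 fs -> List.In f2 fs ->
  exists fs' f, [/\ extends 1 fs fs', List.In f fs' & forall g, f g = f1 g && f2 g].
Proof.
move=> c i1 i2; eexists (_ :: fs), _; split; last by [].
  by split; [apply: (circuit_and c i1 i2) | move=> f; right | ].
by left.
Qed.

Lemma extend_or fs f1 f2 : mono_circuit fs -> List.In f1 fs -> List.In f2 fs ->
  exists fs' f, [/\ extends 1 fs fs', List.In f fs' & forall g, f g = f1 g || f2 g].
Proof.
move=> c i1 i2; eexists (_ :: fs), _; split; last by [].
  by split; [apply: (circuit_or c i1 i2) | move=> f; right | ].
by left.
Qed.

(** The gate is constantly true unless an r-free [A] is released from a [P] with r. In that case it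
    asserts that [A] has the truth value demanded by its side of the sequent, which by [clique_side]
    is a constant or one edge input, hence monotone. *)
Lemma extend_guard fs P b A : mono_circuit fs -> (has_r P -> clique_side b A) ->
  exists fs' f, [/\ extends 1 fs fs', List.In f fs'
    & forall v, f (edges v) = [|| ~~ has_r P, has_r A | xeval v A == b]].
Proof.
move=> c gA.
suff [[k ek]|[i [j eij]]] :
    (exists k : bool, forall v, [|| ~~ has_r P, has_r A | xeval v A == b] = k)
    \/ exists i j, forall v, [|| ~~ has_r P, has_r A | xeval v A == b] = v (Avar i j).
- have [fs' [f [e i ef]]] := extend_const k c.
  by exists fs', f; split=> // v; rewrite ef ek.
- exists ((fun g => g i j) :: fs), (fun g => g i j); split=> //; last by left.
  by split=> [||//]; [apply: circuit_edge | move=> f; right].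
have [rP|] := boolP (has_r P); last by left; exists true.
have [|rA] := boolP (has_r A); first by left; exists true.
have : has_r A || simple_guard b A by move: (gA rP); case: (A) => [x| | | | |B C|B C|B C|B C|B] /=; case/andP.
rewrite (negPf rA) /= => /orP[/andP[]|nv]; last first.
  by left; exists (xeval (fun=> true) A == b) => v; rewrite (xeval_var_free v (fun=> true) nv).
case: b gA => // _ _; case: A rA => //= -[] //= i j _ _.
by right; exists i, j => v; rewrite eqb_id.
Qed.

Definition has_interpolant (fs : seq gate) (s : sequent xformula) : Prop :=
  exists2 f, List.In f fs & interpolates f s.

(* A one-premise rule with principal formula [P] and active formulas [A1], [A2]
   (on sides [b1], [b2]). *)
Lemma interpolate_unary fs p s P b1 A1 b2 A2 :
  mono_circuit fs -> has_interpolant fs p ->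
  (splittable s -> has_r P -> clique_side b1 A1 /\ clique_side b2 A2) ->
  (splittable s -> splittable p) ->
  (forall v, refutes (fun A => has_r A) v s ->
     refutes (fun A => has_r A) v p
     /\ (has_r P -> (has_r A1 || (xeval v A1 == b1)) && (has_r A2 || (xeval v A2 == b2)))) ->
  (forall v, refutes (fun A => ~~ has_r A) v s ->
     (has_r P -> (has_r A1 || (xeval v A1 == b1)) && (has_r A2 || (xeval v A2 == b2))) ->
     refutes (fun A => ~~ has_r A) v p) ->
  exists2 fs', extends 5 fs fs' & has_interpolant fs' s.
Proof.
move=> c [f i h] cs sp hL hR.
have [ss|ns] := boolP (splittable s); last first.
  exists fs; first by split=> //; lia.
  by exists f => // ss; rewrite ss in ns.
have [fs1 [f1 [e1 i1 ef1]]] := extend_guard c (fun r => (cs ss r).1).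
have [fs2 [f2 [e2 i2 ef2]]] := extend_guard (let: And3 c1 _ _ := e1 in c1) (fun r => (cs ss r).2).
have [fs3 [f3 [e3 i3 ef3]]] := extend_and (let: And3 c1 _ _ := e2 in c1)
  (let: And3 _ s2 _ := e2 in s2 _ i1) i2.
have [fs4 [f4 [e4 i4 ef4]]] := extend_and (let: And3 c1 _ _ := e3 in c1)
  (let: And3 _ s3 _ := e3 in let: And3 _ s2 _ := e2 in let: And3 _ s1 _ := e1 in
   s3 _ (s2 _ (s1 _ i))) i3.
exists fs4.
  have [? ? le] := extends_trans (extends_trans (extends_trans e1 e2) e3) e4.
  by split=> //; apply: leq_trans le _; lia.
exists f4 => //.
move=> _ v; rewrite ef4 ef3 ef1 ef2; split=> [/hL [/(h (sp ss) v).1 -> g]|rs].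
  by case: (has_r P) g => //= /(_ isT) /andP[-> ->].
apply/negP=> /and3P[fv g1 g2]; move: fv; apply/negP; apply: (h (sp ss) v).2.
by apply: hR rs _ => r; move: g1 g2; rewrite r /= => -> ->.
Qed.

(** If the principal formula is r-free, the two interpolants are conjoined. If it contains r they
    are disjoined, each first conjoined with the guard of the formula that its premise has gained:
    two guards, two conjunctions and one disjunction make the 5 gates. *)
Lemma interpolate_binary fs p1 p2 s P b1 A1 b2 A2 :
  mono_circuit fs -> has_interpolant fs p1 -> has_interpolant fs p2 ->
  (splittable s -> has_r P -> clique_side b1 A1 /\ clique_side b2 A2) ->
  (splittable s -> splittable p1 /\ splittable p2) ->
  (forall v, refutes (fun A => has_r A) v s ->
     if has_r P then
       refutes (fun A => has_r A) v p1 && (has_r A1 || (xeval v A1 == b1))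
       || refutes (fun A => has_r A) v p2 && (has_r A2 || (xeval v A2 == b2))
     else refutes (fun A => has_r A) v p1 && refutes (fun A => has_r A) v p2) ->
  (forall v, refutes (fun A => ~~ has_r A) v s ->
     if has_r P then
       (has_r A1 || (xeval v A1 == b1) ==> refutes (fun A => ~~ has_r A) v p1)
       && (has_r A2 || (xeval v A2 == b2) ==> refutes (fun A => ~~ has_r A) v p2)
     else refutes (fun A => ~~ has_r A) v p1 || refutes (fun A => ~~ has_r A) v p2) ->
  exists2 fs', extends 5 fs fs' & has_interpolant fs' s.
Proof.
move=> c [f1 i1 h1] [f2 i2 h2] cs sp hL hR.
have [ss|ns] := boolP (splittable s); last first.
  exists fs; first by split=> //; lia.
  by exists f1 => // ss; rewrite ss in ns.
have [sp1 sp2] := sp ss; move/(_ sp1): h1 => h1; move/(_ sp2): h2 => h2.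
have [rP|rP] := boolP (has_r P); last first.
  have [fs' [f' [e' i' ef']]] := extend_and c i1 i2.
  exists fs'; first by case: e' => ? ? le; split=> //; apply: leq_trans le _; lia.
  exists f' => //.
  move=> _ v; rewrite ef'; split=> [/hL|/hR]; rewrite (negPf rP).
    by case/andP=> /(h1 v).1 -> /(h2 v).1 ->.
  by case/orP=> [/(h1 v).2|/(h2 v).2] /negPf->; rewrite ?andbF.
have [fs1 [g1 [e1 j1 eg1]]] := extend_guard c (fun r => (cs ss r).1).
have [fs2 [g2 [e2 j2 eg2]]] := extend_guard (let: And3 c1 _ _ := e1 in c1) (fun r => (cs ss r).2).
have [fs3 [g3 [e3 j3 eg3]]] := extend_and (let: And3 c1 _ _ := e2 in c1)
  (let: And3 _ s2 _ := e2 in let: And3 _ s1 _ := e1 in s2 _ (s1 _ i1))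
  (let: And3 _ s2 _ := e2 in s2 _ j1).
have [fs4 [g4 [e4 j4 eg4]]] := extend_and (let: And3 c1 _ _ := e3 in c1)
  (let: And3 _ s3 _ := e3 in let: And3 _ s2 _ := e2 in let: And3 _ s1 _ := e1 in
   s3 _ (s2 _ (s1 _ i2)))
  (let: And3 _ s3 _ := e3 in s3 _ j2).
have [fs5 [g5 [e5 j5 eg5]]] := extend_or (let: And3 c1 _ _ := e4 in c1)
  (let: And3 _ s4 _ := e4 in s4 _ j3) j4.
exists fs5.
  exact: (extends_trans (extends_trans (extends_trans (extends_trans e1 e2) e3) e4) e5).
exists g5 => //.
move=> _ v; rewrite eg5 eg4 eg3 eg1 eg2 rP /=; split=> [/hL|/hR]; rewrite rP.
  by case/orP=> /andP[]; [move=> /(h1 v).1 -> -> | move=> /(h2 v).1 -> ->; rewrite orbT].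
case/andP=> /implyP k1 /implyP k2; apply/negP=> /orP[]/andP[fv].
  by move=> /k1 /(h1 v).2; rewrite fv.
by move=> /k2 /(h2 v).2; rewrite fv.
Qed.

Ltac bool_cases :=
  repeat match goal with
  | |- context [all ?P ?l] => case: (all P l) => //=
  | |- context [has_var ?P ?A] => case: (has_var P A) => //=
  | |- context [xeval ?v ?A] => case: (xeval v A) => //=
  | |- context [clique_side ?b ?A] => case: (clique_side b A) => //=
  | |- context [simple_guard ?b ?A] => case: (simple_guard b A) => //=
  end; try done; try by [intuition].

Ltac solve_rule :=
  try match goal with |- forall v : atom -> bool, _ => move=> v end;
  rewrite /splittable /refutes /= ?all_cat; bool_cases.

Lemma interpolate_axiom fs s (b : bool) : mono_circuit fs ->
  (forall v, if b then ~~ refutes (fun A => ~~ has_r A) v s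
             else ~~ refutes (fun A => has_r A) v s) ->
  exists2 fs', extends 5 fs fs' & has_interpolant fs' s.
Proof.
move=> c h; have [fs' [f [e i ef]]] := extend_const b c.
exists fs'; first by case: e => ? ? le; split=> //; apply: leq_trans le _; lia.
exists f => // _ v; rewrite ef; move: (h v); case: b {h ef} => /negPf-> //.
Qed.

Lemma interpolate_rule fs ps s : mono_circuit fs -> LKbang_cutfree_rule ps s ->
  (forall p, p \in ps -> has_interpolant fs p) ->
  exists2 fs', extends 5 fs fs' & has_interpolant fs' s.
Proof.
move=> c r; case: r => {ps s}.
- move=> A _; apply: (@interpolate_axiom _ _ (~~ has_r A)) => // v.
  by rewrite /refutes /=; bool_cases.
- by move=> _; apply: (@interpolate_axiom _ _ true) => // v; solve_rule.
- by move=> _; apply: (@interpolate_axiom _ _ true) => // v; solve_rule.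
- by move=> Γ Δ _; apply: (@interpolate_axiom _ _ true) => // v; solve_rule.
- by move=> Γ Δ _; apply: (@interpolate_axiom _ _ true) => // v; solve_rule.
(* [XOne] is a dummy principal formula for rules that move nothing across the two sides: being
   r-free, it makes both guards constantly true. *)
- by move=> Γ Δ h; apply: (@interpolate_unary _ _ _ XOne true XOne true XOne c (h _ (mem_head _ _))); solve_rule.
- by move=> Γ Δ h; apply: (@interpolate_unary _ _ _ XOne true XOne true XOne c (h _ (mem_head _ _))); solve_rule.
- by move=> Γ Δ A B h; apply: (@interpolate_unary _ _ _ (XAnd A B) true A true A c (h _ (mem_head _ _))); solve_rule.
- by move=> Γ Δ A B h; apply: (@interpolate_unary _ _ _ (XAnd A B) true B true B c (h _ (mem_head _ _))); solve_rule.
- by move=> Γ Δ A B h; apply: (@interpolate_binary _ _ _ _ (XAnd A B) false A false B c (h _ (mem_head _ _)) (h _ (mem_last _ _))); solve_rule.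
- by move=> Γ Δ A B h; apply: (@interpolate_binary _ _ _ _ (XOr A B) true A true B c (h _ (mem_head _ _)) (h _ (mem_last _ _))); solve_rule.
- by move=> Γ Δ A B h; apply: (@interpolate_unary _ _ _ (XOr A B) false A false A c (h _ (mem_head _ _))); solve_rule.
- by move=> Γ Δ A B h; apply: (@interpolate_unary _ _ _ (XOr A B) false B false B c (h _ (mem_head _ _))); solve_rule.
- by move=> Γ Δ A B h; apply: (@interpolate_unary _ _ _ (XMul A B) true A true B c (h _ (mem_head _ _))); solve_rule.
- by move=> Γ Δ Σ Λ A B h; apply: (@interpolate_binary _ _ _ _ (XMul A B) false A false B c (h _ (mem_head _ _)) (h _ (mem_last _ _))); solve_rule.
- by move=> Γ Δ Σ Λ A B h; apply: (@interpolate_binary _ _ _ _ (XImp A B) false A true B c (h _ (mem_head _ _)) (h _ (mem_last _ _))); solve_rule.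
- by move=> Γ Δ A B h; apply: (@interpolate_unary _ _ _ (XImp A B) true A false B c (h _ (mem_head _ _))); solve_rule.
- by move=> Γ Δ A h; apply: (@interpolate_unary _ _ _ XOne true XOne true XOne c (h _ (mem_head _ _))); solve_rule.
- by move=> Γ Δ A h; apply: (@interpolate_unary _ _ _ XOne true XOne true XOne c (h _ (mem_head _ _))); solve_rule.
- by move=> Γ Δ A h; apply: (@interpolate_unary _ _ _ XOne true XOne true XOne c (h _ (mem_head _ _))); solve_rule.
- by move=> Γ Δ A h; apply: (@interpolate_unary _ _ _ XOne true XOne true XOne c (h _ (mem_head _ _))); solve_rule.
- by move=> Γ A h; apply: (@interpolate_unary _ _ _ (XBang A) false A false A c (h _ (mem_head _ _))); solve_rule.
- by move=> Γ Δ A h; apply: (@interpolate_unary _ _ _ (XBang A) true A true A c (h _ (mem_head _ _))); solve_rule.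
- by move=> Γ Δ A h; apply: (@interpolate_unary _ _ _ XOne true XOne true XOne c (h _ (mem_head _ _))); solve_rule.
- by move=> Γ Δ A h; apply: (@interpolate_unary _ _ _ XOne true XOne true XOne c (h _ (mem_head _ _))); solve_rule.
Qed.

Lemma dag_interpolants l : dag_correct LKbang_cutfree l ->
  exists fs, [/\ mono_circuit fs, size fs <= 5 * size l
    & forall s, s \in l -> has_interpolant fs s].
Proof.
elim=> [|{}l ps s _ [fs [c le h]] sub [ps' [s' [r eps es]]]].
  by exists [::]; split=> //; apply: circuit_nil.
have hps' p' : p' \in ps' -> has_interpolant fs p'.
  elim: ps ps' sub eps {r} => [|p ps IH] [|q ps'] //= sub /andP[epq eps].
  rewrite inE => /orP[/eqP->|]; last first.
    by apply: IH eps => x xps; apply: sub; rewrite inE xps orbT.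
  have [f i int] := h p (sub p (mem_head _ _)).
  by exists f => //; apply: interpolates_equiv int.
have [fs' [c' sub' le'] [f i int]] := interpolate_rule c r hps'.
exists fs'; split=> // [|t].
  by rewrite size_rcons mulnS; apply: leq_trans le' _; rewrite leq_add2l.
rewrite mem_rcons inE => /orP[/eqP->|/h [g j intg]]; last by exists g => //; apply: sub'.
exists f => //; apply: interpolates_equiv int.
by case/andP: es => e1 e2; apply/andP; rewrite ![perm_eq s'.1 _]perm_sym ![perm_eq s'.2 _]perm_sym.
Qed.

(** * Truth values and variables of the clique and colour formulas *)

Lemma xeval_nest_and v op e s : (op = UAnd /\ e = UOne) \/ (op = UMul /\ e = UOne) ->
  xeval v (xform (nest op e s)) = all (fun A => xeval v (xform A)) s.
Proof.
case=> -[-> ->]; elim: s => //= A [|B s] IHs; rewrite ?andbT // -[in RHS]IHs //.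
Qed.

Lemma xeval_bigor v s : xeval v (xform (ubigor s)) = has (fun A => xeval v (xform A)) s.
Proof. by elim: s => //= A [|B s] IHs; rewrite ?orbF // -[in RHS]IHs. Qed.

Definition literal_true (v : atom -> bool) (l : literal) : bool := v l.2 == l.1.

Lemma xeval_literal v l : xeval v (xform (literal_formula l)) = literal_true v l.
Proof. by case: l => -[] x; rewrite /literal_true /=; case: (v x). Qed.

Lemma xeval_cnf v C : xeval v (xform (cnf_formula C)) = all (has (literal_true v)) C.
Proof.
rewrite /cnf_formula /ubigand xeval_nest_and; last by left.
rewrite all_map; apply: eq_all => c /=; rewrite xeval_bigor has_map.
by apply: eq_has => l /=; rewrite xeval_literal.
Qed.

Lemma xeval_negated_cnf v C :
  xeval v (xform (negated_cnf_formula C)) = ~~ all (has (literal_true v)) C.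
Proof.
rewrite /negated_cnf_formula xeval_bigor has_map -has_predC; apply: eq_has => c /=.
rewrite /ubigand xeval_nest_and; last by left.
rewrite all_map -all_predC; apply: eq_all => -[b x] /=; rewrite xeval_literal /literal_true /=.
by case: b (v x) => -[].
Qed.

Lemma has_var_xform P A : has_var P (xform A) = has P (uvars A).
Proof. by elim: A => //= [x|A IHA B IHB|A IHA B IHB|A IHA B IHB|A IHA B IHB]; rewrite ?orbF // has_cat IHA IHB. Qed.

Lemma over_ps_has_r n A : over_ps n A -> has_r (xform A) = false.
Proof.
rewrite has_var_xform => /allP h; apply/hasP=> -[x /h].
by case: x.
Qed.

Lemma mem_distinct_pairs n i j : ((i, j) \in distinct_pairs n) = [&& i != j, i < n & j < n].
Proof.
rewrite mem_filter /=; congr (_ && _); apply/allpairsP/andP => [[[a b] /=]|[lti ltj]].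
  by rewrite !mem_iota => -[lta ltb [-> ->]].
by exists (i, j); rewrite !mem_iota.
Qed.

Lemma mem_increasing_pairs n i j : ((i, j) \in increasing_pairs n) = (i < j < n).
Proof.
rewrite mem_filter /=; have [lt|] := boolP (i < j) => //=.
apply/allpairsP/idP => [[[a b] /=]|ltj].
  by rewrite !mem_iota => -[lta ltb [_ ->]].
by exists (i, j); rewrite !mem_iota /= add0n ltj (ltn_trans lt ltj).
Qed.

Lemma clique_clausesP (P : seq literal -> Prop) n k :
  (forall u, u < k -> P [seq (true, Rvar u i) | i <- iota 0 n]) ->
  (forall u i j, u < k -> i != j -> i < n -> j < n -> P [:: (false, Rvar u i); (false, Rvar u j)]) ->
  (forall u v i, u != v -> u < k -> v < k -> i < n -> P [:: (false, Rvar u i); (false, Rvar v i)]) ->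
  (forall u v i j, u != v -> u < k -> v < k -> i < j < n ->
     P [:: (false, Rvar u i); (false, Rvar v j); (true, Avar i j)]) ->
  forall c, c \in clique_clauses n k -> P c.
Proof.
move=> h1 h2 h3 h4 c; rewrite !mem_cat => /or4P[].
- by case/mapP=> u; rewrite mem_iota => ltu ->; apply: h1.
- case/allpairsP=> -[u [i j]] /= []; rewrite mem_iota mem_distinct_pairs => ltu /and3P[? ? ?] ->.
  exact: h2.
- case/allpairsP=> -[[u v] i] /= []; rewrite mem_iota mem_distinct_pairs => /and3P[? ? ?] ? ->.
  exact: h3.
- case/allpairsP=> -[[u v] [i j]] /= []; rewrite mem_increasing_pairs mem_distinct_pairs.
  by move=> /and3P[? ? ?] ? ->; apply: h4.
Qed.

Lemma color_clausesP (P : seq literal -> Prop) n m :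
  (forall i, i < n -> P [seq (true, Svar i a) | a <- iota 0 m]) ->
  (forall i a b, i < n -> a != b -> a < m -> b < m -> P [:: (false, Svar i a); (false, Svar i b)]) ->
  (forall a i j, a < m -> i < j < n ->
     P [:: (false, Svar i a); (false, Svar j a); (false, Avar i j)]) ->
  forall c, c \in color_clauses n m -> P c.
Proof.
move=> h1 h2 h3 c; rewrite !mem_cat => /or3P[].
- by case/mapP=> u; rewrite mem_iota => ltu ->; apply: h1.
- case/allpairsP=> -[u [i j]] /= []; rewrite mem_iota mem_distinct_pairs => ltu /and3P[? ? ?] ->.
  exact: h2.
- case/allpairsP=> -[a [i j]] /= []; rewrite mem_iota mem_increasing_pairs => ? ? ->.
  exact: h3.
Qed.

(** The number [op] selects the connective, so that one induction serves for conjunctions and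
    disjunctions. *)
Lemma clique_side_nest b op e s : op \in [:: 0; 1] ->
  all (fun A => clique_side b (xform A) && has_r (xform A)) s -> s != [::] ->
  let f := if op == 0 then UAnd else UOr in
  clique_side b (xform (nest f e s)) && has_r (xform (nest f e s)).
Proof.
rewrite !inE => /orP[]/eqP-> /=; elim: s => // A [|B s] IHs; rewrite [all _ _]/= ?andbT //;
  by move=> /andP[/andP[cA rA] /IHs/(_ isT)/andP[cs rs]] _ /=; rewrite -/(nest _ _ (B :: s)) rA cA cs.
Qed.

(** This is the source of monotonicity: apart from the [0] of negations, the r-free subformulas of
    the clauses are edge atoms in positive position. The hypothesis keeps the clauses stating that
    [u] has a vertex from degenerating to the r-free [0]. *)
Lemma Clique_side n : 0 < n -> clique_side true (xform (Clique n)) && has_r (xform (Clique n)).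
Proof.
move=> n_gt0; apply: (@clique_side_nest true 0) => //.
rewrite all_map; apply/allP; apply: clique_clausesP => //= u ltu.
rewrite /ubigor; apply: (@clique_side_nest true 1) => //; last by case: (n) n_gt0.
by rewrite -map_comp all_map; apply/allP=> i _ /=.
Qed.

(** * The interpolant of S_n separates cliques from colourable graphs *)

Section Interpolation.

Variables (n : nat) (Σ : seq uformula).
Hypotheses (n_gt0 : 0 < n)
  (tautΣ : forall A v, A \in Σ -> xeval v (xform A))
  (sideΣ : forall A, A \in Σ -> has_r (xform A) -> clique_side true (xform A)).

Let m := Nat.sqrt n.
Let m_gt0 : 0 < m.
Proof. by rewrite /m; have := Nat.sqrt_spec n; case: (Nat.sqrt n) => //; lia. Qed.

(** Here the shape of S_n matters: packing the axioms over p, s with ColorBar into a single r-free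
    formula puts them on the colour side, while the clique formula and the axioms about r form the
    other side. *)
Lemma S_succedent_no_r :
  has_r (xform (UImp (bigfusion (ps_part n Σ)) (ColorBar n))) = false.
Proof.
change (has_r (xform (bigfusion (ps_part n Σ))) || has_r (xform (ColorBar n)) = false).
apply/orP=> -[]; rewrite has_var_xform.
  move/hasP=> [x + xr]; suff: ~~ has is_Rvar (uvars (bigfusion (ps_part n Σ))).
    by move=> /hasPn h /h; rewrite xr.
  have: all (over_ps n) (ps_part n Σ) by apply: filter_all.
  elim: (ps_part n Σ) => //= A [|B s] IHs /andP[/over_ps_has_r oA os].
    by rewrite -has_var_xform oA.
  by rewrite [uvars _]/= has_cat -has_var_xform oA; apply: IHs.
rewrite /ColorBar /negated_cnf_formula.
suff: ~~ has is_Rvar (uvars (ubigor [seq ubigand [seq literal_formula (complement l) | l <- c]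
    | c <- color_clauses n (Nat.sqrt n)])) by move/negP.
have: all (all (fun l : literal => ~~ is_Rvar l.2)) (color_clauses n (Nat.sqrt n)).
  apply/allP; apply: color_clausesP => //= i _; rewrite all_map; exact/allP.
elim: (color_clauses _ _) => //= c s IHs /andP[rc /IHs rs].
have h : ~~ has is_Rvar (uvars (ubigand [seq literal_formula (complement l) | l <- c])).
  elim: c rc {IHs rs} => //= l c IHc /andP[rl /IHc rc].
  have hl : ~~ has is_Rvar (uvars (literal_formula (complement l))).
    by case: l rl => -[] x /=; rewrite ?orbF.
  case: c rc {IHc} => // l' c rc; rewrite [uvars _]/= has_cat (negPf hl); exact: rc.
by case: s rs {IHs} => // c' s rs; rewrite [uvars _]/= has_cat (negPf h); exact: rs.
Qed.

Lemma all_S (P Q : pred xformula) :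
  all P (xsequent (S_sequent n Σ)).1 && all Q (xsequent (S_sequent n Σ)).2
  = [&& P (xform (Clique n)), all P (map xform (ps_rest n Σ))
      & Q (xform (UImp (bigfusion (ps_part n Σ)) (ColorBar n)))].
Proof.
rewrite -[LHS]/((P (xform (Clique n)) && all P (map xform (ps_rest n Σ)))
  && (Q (xform (UImp (bigfusion (ps_part n Σ)) (ColorBar n))) && true)).
by rewrite andbT andbA.
Qed.

Lemma S_splittable : splittable (xsequent (S_sequent n Σ)).
Proof.
have /andP[cC rC] := Clique_side n_gt0.
rewrite /splittable all_S cC implybT S_succedent_no_r andbT.
rewrite all_map; apply/allP=> A; rewrite mem_filter => /andP[_ AS].
by apply/implyP; apply: sideΣ.
Qed.

(** The assignment lets r_ui say that [i] is the [u]-th vertex in an enumeration of [K]; the axioms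
    hold under any assignment, so the value of s is immaterial. *)
Lemma S_refuted_left (K : {set 'I_n}) : #|K| = m.+1 ->
  exists2 v, refutes (fun A => has_r A) v (xsequent (S_sequent n Σ))
    & edges v = clique_graph (vertices K).
Proof.
move=> eK; set vs := vertices K.
have size_vs : size vs = m.+1 by rewrite size_map -cardE.
have uniq_vs : uniq vs by rewrite map_inj_uniq ?enum_uniq //; apply: val_inj.
have vs_mem u : u < m.+1 -> nth n vs u \in vs by move=> ltu; rewrite mem_nth ?size_vs.
have vs_lt u : u < m.+1 -> nth n vs u < n.
  by move=> /vs_mem /mapP[x _ ->]; apply: ltn_ord.
pose v x := match x with
  | Avar i j => clique_graph vs i j
  | Rvar u i => nth n vs u == i
  | Svar _ _ => false end.
exists v => //; rewrite /refutes all_S S_succedent_no_r andbT.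
apply/andP; split; [apply/implyP=> _ | apply/allP].
  rewrite xeval_cnf; apply/allP; apply: clique_clausesP => /=.
  - move=> u ltu; rewrite has_map; apply/hasP; exists (nth n vs u).
      by rewrite mem_iota vs_lt.
    by rewrite /literal_true /= eqxx.
  - move=> u i j _ nij _ _; rewrite /literal_true /= !eqbF_neg orbF -negb_and.
    by apply: contra nij => /andP[/eqP-> /eqP->].
  - move=> u w i nuw ltu ltw _; rewrite /literal_true /= !eqbF_neg orbF -negb_and.
    apply: contra nuw => /andP[/eqP eu /eqP ew].
    by rewrite -(nth_uniq n _ _ uniq_vs) ?size_vs // eu ew.
  - move=> u w i j _ ltu ltw /andP[ltij _]; rewrite /literal_true /= !eqbF_neg orbF.
    have [eu|//] := eqVneq (nth n vs u) i; have [ew|//] := eqVneq (nth n vs w) j.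
    by rewrite /clique_graph ltij -eu -ew !vs_mem.
move=> A /mapP[B]; rewrite mem_filter => /andP[_ BS] ->.
by rewrite tautΣ ?implybT.
Qed.

Lemma S_refuted_right (c : {ffun 'I_n -> 'I_m}) :
  exists2 v, refutes (fun A => ~~ has_r A) v (xsequent (S_sequent n Σ))
    & edges v = coloring_graph n (color_of c).
Proof.
pose v x := match x with
  | Avar i j => coloring_graph n (color_of c) i j
  | Rvar u i => false
  | Svar i a => color_of c i == a end.
have lt_c i : i < n -> color_of c i < m.
  by move=> lti; rewrite /color_of (insubT (fun i => i < n) lti) /=.
have /andP[cC rC] := Clique_side n_gt0.
exists v => //; rewrite /refutes all_S S_succedent_no_r rC; apply/and3P; split=> //.
  apply/allP=> A /mapP[B]; rewrite mem_filter => /andP[_ BS] ->.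
  by rewrite tautΣ ?implybT.
change (~~ (xeval v (xform (nest UMul UOne (ps_part n Σ))) ==> xeval v (xform (ColorBar n)))).
rewrite negb_imply xeval_nest_and; last by right.
apply/andP; split; first by apply/allP=> A; rewrite mem_filter => /andP[_ /tautΣ].
rewrite xeval_negated_cnf negbK; apply/allP; apply: color_clausesP => /=.
- move=> i lti; rewrite has_map; apply/hasP; exists (color_of c i).
    by rewrite mem_iota lt_c.
  by rewrite /literal_true /= eqxx.
- move=> i a b _ nab _ _; rewrite /literal_true /= !eqbF_neg orbF -negb_and.
  by apply: contra nab => /andP[/eqP-> /eqP->].
- move=> a i j _ /andP[ltij ltj]; rewrite /literal_true /= !eqbF_neg orbF.
  have [ei|//] := eqVneq (color_of c i) a; have [ej|//] := eqVneq (color_of c j) a.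
  by rewrite /coloring_graph ei ej eqxx !andbF.
Qed.

Lemma S_dag_lower_bound t l : 9 < t -> t ^ 20 <= n ->
  dag_correct LKbang_cutfree (rcons l (xsequent (S_sequent n Σ))) ->
  2 ^ t <= 5 * (size l).+1.
Proof.
move=> t_gt9 le_tn /dag_interpolants[fs [circ le h]].
have [|f ffs int] := h (xsequent (S_sequent n Σ)); first by rewrite mem_rcons mem_head.
rewrite size_rcons in le; apply: leq_trans le.
apply: (clique_circuit_lower_bound t_gt9 le_tn circ ffs) => [K eK|c].
  by have [v r <-] := S_refuted_left eK; apply: (int S_splittable v).1.
by have [v r <-] := S_refuted_right c; apply/negbTE; apply: (int S_splittable v).2.
Qed.

End Interpolation.

(** * Size-bounded FLe derivations *)

Lemma sequent_equiv_refl (F : eqType) : reflexive (@sequent_equiv F).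
Proof. by move=> s; rewrite /sequent_equiv !perm_refl. Qed.

Lemma sequent_equiv_trans (F : eqType) : transitive (@sequent_equiv F).
Proof.
move=> t s u /andP[e1 e2] /andP[f1 f2].
by rewrite /sequent_equiv (perm_trans e1 f1) (perm_trans e2 f2).
Qed.

Lemma up_to_perm_rule (F : eqType) (rule : seq (sequent F) -> sequent F -> Prop) ps s :
  rule ps s -> up_to_perm rule ps s.
Proof.
move=> r; exists ps, s; split=> //; last exact: sequent_equiv_refl.
by elim: ps {r} => //= p ps ->; rewrite sequent_equiv_refl.
Qed.

Definition gsize (Γ : seq uformula) : nat := sumn (map usize Γ).

Lemma gsize_cat Γ Σ : gsize (Γ ++ Σ) = gsize Γ + gsize Σ.
Proof. by rewrite /gsize map_cat sumn_cat. Qed.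

Lemma gsize_cons A Γ : gsize (A :: Γ) = usize A + gsize Γ.
Proof. by []. Qed.

Lemma gsize_nil : gsize [::] = 0.
Proof. by []. Qed.

Lemma gsize_perm Γ Σ : perm_eq Γ Σ -> gsize Γ = gsize Σ.
Proof. by move=> e; apply/perm_sumn/perm_map. Qed.

Lemma usize_gt0 A : 0 < usize A.
Proof. by case: A. Qed.

(* [prf L k Γ C]: a proof of [Γ => C] with at most [k] lines, each of size at most [L]. *)
Inductive prf (L : nat) : nat -> seq uformula -> uformula -> Prop :=
| prf_nullary k Γ C : FLe [::] (Γ, [:: C]) -> gsize Γ + usize C < L -> 0 < k -> prf L k Γ C
| prf_unary k k1 Γ C Γ1 C1 : FLe [:: (Γ1, [:: C1])] (Γ, [:: C]) -> gsize Γ + usize C < L ->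
    prf L k1 Γ1 C1 -> k1 < k -> prf L k Γ C
| prf_binary k k1 k2 Γ C Γ1 C1 Γ2 C2 :
    FLe [:: (Γ1, [:: C1]); (Γ2, [:: C2])] (Γ, [:: C]) -> gsize Γ + usize C < L ->
    prf L k1 Γ1 C1 -> prf L k2 Γ2 C2 -> k1 + k2 < k -> prf L k Γ C.

Lemma prf_tree L k Γ C : prf L k Γ C -> exists d : derivation (sequent uformula),
  [/\ tree_correct FLe d, conclusion d = (Γ, [:: C])
    & tree_size (sequent_size usize) d <= k * L].
Proof.
elim=> {k Γ C} [k Γ C r le k0|k k1 Γ C Γ1 C1 r le _ [d [dc de ds]] lt
  |k k1 k2 Γ C Γ1 C1 Γ2 C2 r le _ [d [dc de ds]] _ [d' [dc' de' ds']] lt].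
- exists (Infer (Γ, [:: C]) [::]); split=> //=.
  by rewrite /sequent_size /= !addn0; apply: leq_trans le _; rewrite leq_pmull.
- exists (Infer (Γ, [:: C]) [:: d]); split=> //=; first by rewrite de.
  rewrite /sequent_size /= !addn0; apply: (@leq_trans (k1.+1 * L)).
    by rewrite mulSn leq_add.
  by rewrite leq_mul2r lt orbT.
- exists (Infer (Γ, [:: C]) [:: d; d']); split=> //=; first by rewrite de de'.
  rewrite /sequent_size /= !addn0; apply: (@leq_trans ((k1 + k2).+1 * L)).
    by rewrite mulSn mulnDl leq_add ?leq_add.
  by rewrite leq_mul2r lt orbT.
Qed.

Lemma prf_perm L k Γ Γ' C : perm_eq Γ Γ' -> prf L k Γ C -> prf L k Γ' C.
Proof.
move=> e.
have eqv ps : FLe ps (Γ, [:: C]) -> FLe ps (Γ', [:: C]).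
  case=> ps' [s' [r eps es]]; exists ps', s'; split=> //.
  apply: sequent_equiv_trans es.
  by rewrite /sequent_equiv perm_refl perm_sym e.
move=> h; case: h eqv e => [? ? ? r le k0|? ? ? ? ? ? r le h lt|? ? ? ? ? ? ? ? ? r le h1 h2 lt] eqv e;
  rewrite (gsize_perm e) in le.
- exact: prf_nullary (eqv _ r) le k0.
- exact: prf_unary (eqv _ r) le h lt.
- exact: prf_binary (eqv _ r) le h1 h2 lt.
Qed.

Lemma prf_le L k k' Γ C : k <= k' -> prf L k Γ C -> prf L k' Γ C.
Proof.
move=> le h; case: h le => [? ? ? r sz k0|? ? ? ? ? ? r sz h lt|? ? ? ? ? ? ? ? ? r sz h1 h2 lt] le.
- exact: prf_nullary r sz (leq_trans k0 le).
- exact: prf_unary r sz h (leq_trans lt le).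
- exact: prf_binary r sz h1 h2 (leq_trans lt le).
Qed.

Lemma prf_size L k Γ C : prf L k Γ C -> gsize Γ + usize C < L.
Proof. by case. Qed.

Section Rules.

Variable L : nat.
Implicit Types (Γ : seq uformula) (A B C : uformula).

Lemma p_ax A : 2 * usize A < L -> prf L 1 [:: A] A.
Proof.
move=> le; apply: prf_nullary => //; first exact/up_to_perm_rule/FLe_ax.
by rewrite gsize_cons /gsize /=; lia.
Qed.

Lemma p_oneR : 1 < L -> prf L 1 [::] UOne.
Proof. by move=> le; apply: prf_nullary => //; apply/up_to_perm_rule/FLe_oneR. Qed.

Lemma p_oneL k Γ C : (gsize Γ + usize C).+1 < L -> prf L k Γ C -> prf L k.+1 (UOne :: Γ) C.
Proof.
by move=> le h; apply: prf_unary h _ => //; apply/up_to_perm_rule/FLe_oneL.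
Qed.

Lemma p_andL1 k Γ A B C : gsize (UAnd A B :: Γ) + usize C < L ->
  prf L k (A :: Γ) C -> prf L k.+1 (UAnd A B :: Γ) C.
Proof. by move=> le h; apply: prf_unary le h _ => //; apply/up_to_perm_rule/FLe_andL1. Qed.

Lemma p_andL2 k Γ A B C : gsize (UAnd A B :: Γ) + usize C < L ->
  prf L k (B :: Γ) C -> prf L k.+1 (UAnd A B :: Γ) C.
Proof. by move=> le h; apply: prf_unary le h _ => //; apply/up_to_perm_rule/FLe_andL2. Qed.

Lemma p_andR k1 k2 Γ A B : gsize Γ + usize (UAnd A B) < L ->
  prf L k1 Γ A -> prf L k2 Γ B -> prf L (k1 + k2).+1 Γ (UAnd A B).
Proof. by move=> le h1 h2; apply: prf_binary le h1 h2 _ => //; apply/up_to_perm_rule/FLe_andR. Qed.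

Lemma p_orL k1 k2 Γ A B C : gsize (UOr A B :: Γ) + usize C < L ->
  prf L k1 (A :: Γ) C -> prf L k2 (B :: Γ) C -> prf L (k1 + k2).+1 (UOr A B :: Γ) C.
Proof. by move=> le h1 h2; apply: prf_binary le h1 h2 _ => //; apply/up_to_perm_rule/FLe_orL. Qed.

Lemma p_orR1 k Γ A B : gsize Γ + usize (UOr A B) < L ->
  prf L k Γ A -> prf L k.+1 Γ (UOr A B).
Proof. by move=> le h; apply: prf_unary le h _ => //; apply/up_to_perm_rule/FLe_orR1. Qed.

Lemma p_orR2 k Γ A B : gsize Γ + usize (UOr A B) < L ->
  prf L k Γ B -> prf L k.+1 Γ (UOr A B).
Proof. by move=> le h; apply: prf_unary le h _ => //; apply/up_to_perm_rule/FLe_orR2. Qed.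

Lemma p_mulL k Γ A B C : gsize (UMul A B :: Γ) + usize C < L ->
  prf L k (A :: B :: Γ) C -> prf L k.+1 (UMul A B :: Γ) C.
Proof. by move=> le h; apply: prf_unary le h _ => //; apply/up_to_perm_rule/FLe_mulL. Qed.

Lemma p_mulR k1 k2 Γ Σ A B : gsize (Γ ++ Σ) + usize (UMul A B) < L ->
  prf L k1 Γ A -> prf L k2 Σ B -> prf L (k1 + k2).+1 (Γ ++ Σ) (UMul A B).
Proof. by move=> le h1 h2; apply: prf_binary le h1 h2 _ => //; apply/up_to_perm_rule/FLe_mulR. Qed.

Lemma p_impL k1 k2 Γ Σ A B C : gsize (UImp A B :: Γ ++ Σ) + usize C < L ->
  prf L k1 Γ A -> prf L k2 (B :: Σ) C -> prf L (k1 + k2).+1 (UImp A B :: Γ ++ Σ) C.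
Proof. by move=> le h1 h2; apply: prf_binary le h1 h2 _ => //; apply/up_to_perm_rule/FLe_impL. Qed.

Lemma p_impR k Γ A B : gsize Γ + usize (UImp A B) < L ->
  prf L k (A :: Γ) B -> prf L k.+1 Γ (UImp A B).
Proof. by move=> le h; apply: prf_unary le h _ => //; apply/up_to_perm_rule/FLe_impR. Qed.

Lemma p_cut k1 k2 Γ Σ A C : gsize (Γ ++ Σ) + usize C < L ->
  prf L k1 Γ A -> prf L k2 (A :: Σ) C -> prf L (k1 + k2).+1 (Γ ++ Σ) C.
Proof. by move=> le h1 h2; apply: prf_binary le h1 h2 _ => //; apply/up_to_perm_rule/FLe_cut. Qed.

Lemma p_weak_ctx k j Γ1 Γ C : gsize (Γ1 ++ Γ) + usize C < L -> 0 < gsize Γ1 ->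
  prf L j Γ1 UOne -> prf L k Γ C -> prf L (k + j).+2 (Γ1 ++ Γ) C.
Proof.
move=> le A0 h1 h2; apply: (@prf_le _ (j + k.+1).+1); first by lia.
apply: p_cut h1 _; first by [].
by apply: p_oneL h2; move: le; rewrite gsize_cat; lia.
Qed.

Lemma p_weak k j Γ A C : gsize (A :: Γ) + usize C < L ->
  prf L j [:: A] UOne -> prf L k Γ C -> prf L (k + j).+2 (A :: Γ) C.
Proof.
move=> le; apply: (@p_weak_ctx _ _ [:: A]) => //.
by rewrite gsize_cons; have := usize_gt0 A; lia.
Qed.

End Rules.

Ltac perm := apply/permP=> ?; rewrite /= ?count_cat /= ?count_cat /=; lia.
Arguments gsize : simpl never.

Ltac gsz :=
  repeat match goal with
  | H : is_true (_ < _) |- _ => revert H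
  | H : is_true (_ <= _) |- _ => revert H
  | H : is_true (_ <= _ <= _) |- _ => revert H
  end;
  rewrite /= ?(gsize_cat, gsize_cons, gsize_nil) /=; clear; lia.

(** * Boolean reasoning in FLe with excluded middle for atoms *)

Inductive nnf (V : Type) : Type :=
| NLit of bool & V
| NTop
| NBot
| NAnd of nnf V & nnf V
| NOr of nnf V & nnf V.
Arguments NTop {V}.
Arguments NBot {V}.

Lemma nnf_comparable (V : eqType) : comparable (nnf V).
Proof. by move=> φ ψ; rewrite /decidable; decide equality; apply: eq_comparable. Defined.
HB.instance Definition _ (V : eqType) := comparableMixin (@nnf_comparable V).

Fixpoint dual (V : Type) (φ : nnf V) : nnf V :=
  match φ with
  | NLit b x => NLit (~~ b) x
  | NTop => NBot
  | NBot => NTop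
  | NAnd a b => NOr (dual a) (dual b)
  | NOr a b => NAnd (dual a) (dual b)
  end.

Fixpoint nsize (V : Type) (φ : nnf V) : nat :=
  match φ with
  | NLit _ _ | NTop | NBot => 1
  | NAnd a b | NOr a b => (nsize a + nsize b).+1
  end.

Lemma dualK V : involutive (@dual V).
Proof. by elim=> //= [b x|a -> b ->|a -> b ->]; rewrite ?negbK. Qed.

Lemma nsize_dual V (φ : nnf V) : nsize (dual φ) = nsize φ.
Proof. by elim: φ => //= a -> b ->. Qed.

Lemma nsize_gt0 V (φ : nnf V) : 0 < nsize φ.
Proof. by case: φ. Qed.

(** By additive conjunction, one copy can be spent in any one of four ways: on excluded middle with
    disjuncts that entail [1], on [0 -> ¬x], on [x -> 1] to discard an atom, or on [1] to be
    discarded itself. *)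
Definition boolean_axiom (x : atom) : uformula :=
  UAnd (UAnd (UOr (UAnd (UAtom x) UOne) (UAnd (UNeg (UAtom x)) UOne))
             (UAnd (UImp UZero (UNeg (UAtom x))) (UImp (UAtom x) UOne)))
       UOne.

Section Embedding.

Variable Xs : seq atom.
Implicit Types φ ψ : nnf atom.

(* Every embedded formula implies 1, so it can be discarded.  Atoms outside [Xs]
   are read as false. *)
Fixpoint emb φ : uformula :=
  match φ with
  | NLit b x =>
      if x \in Xs then UAnd (if b then UAtom x else UNeg (UAtom x)) UOne
      else if b then UAnd UZero UOne else UOne
  | NTop => UOne
  | NBot => UAnd UZero UOne
  | NAnd a b => UMul (emb a) (emb b)
  | NOr a b => UOr (emb a) (emb b)
  end.

Lemma emb_size φ : nsize φ <= usize (emb φ) <= 5 * nsize φ.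
Proof. by elim: φ => [b x| | |a IHa b IHb|a IHa b IHb] /=; [case: ifP => _; case: b| | |lia|lia]. Qed.

Lemma emb_one L φ : usize (emb φ) + 3 < L -> prf L (3 * nsize φ) [:: emb φ] UOne.
Proof.
elim: φ => [b x| | |a IHa b IHb|a IHa b IHb] /= le.
- have le1 : 2 < L by lia.
  have h1 : prf L 1 [:: UOne] UOne by apply: p_ax.
  case: ifP le => _ le.
    by apply: (@prf_le _ 2) => //; apply: p_andL2 h1; gsz.
  case: b le => le; last by apply: (prf_le _ h1).
  by apply: (@prf_le _ 2) => //; apply: p_andL2 h1; gsz.
- by apply: (@prf_le _ 1) => //; apply: p_ax => /=; lia.
- by apply: (@prf_le _ 2) => //; apply: p_andL2; [gsz | apply: p_ax => /=; lia].
- have ha := IHa ltac:(lia); have hb := IHb ltac:(lia).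
  apply: (@prf_le _ (3 * nsize b + 3 * nsize a).+3); first by lia.
  by apply: p_mulL; [gsz | apply: p_weak ha hb; gsz].
- have ha := IHa ltac:(lia); have hb := IHb ltac:(lia).
  apply: (@prf_le _ (3 * nsize a + 3 * nsize b).+1); first by lia.
  by apply: p_orL ha hb; gsz.
Qed.

Lemma weak_emb L k φ Γ C : gsize (emb φ :: Γ) + usize C + 3 < L ->
  prf L k Γ C -> prf L (k + 5 * nsize φ) (emb φ :: Γ) C.
Proof.
move=> le h; have lee : usize (emb φ) + 3 < L by gsz.
have n0 := nsize_gt0 φ; apply: (@prf_le _ (k + 3 * nsize φ).+2); first by lia.
by apply: p_weak (emb_one lee) h; gsz.
Qed.

Lemma weak_embs L k s Γ C : gsize (map emb s ++ Γ) + usize C + 3 < L ->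
  prf L k Γ C -> prf L (k + 5 * gsize (map emb s)) (map emb s ++ Γ) C.
Proof.
move=> le h; elim: s le => [|φ s IHs] /= le; first by rewrite addn0.
have := emb_size φ; rewrite !gsize_cons in le * => sz.
apply: prf_le (weak_emb _ (IHs _)); gsz.
Qed.

Definition axioms_size := gsize (map boolean_axiom Xs).

Definition copies (N : nat) : seq uformula := flatten (nseq N (map boolean_axiom Xs)).

Lemma axioms_sizeE : axioms_size = 21 * size Xs.
Proof.
rewrite /axioms_size; elim: Xs => //= x s IHs.
by rewrite gsize_cons IHs /=; lia.
Qed.

Lemma copies_add N1 N2 : copies (N1 + N2) = copies N1 ++ copies N2.
Proof. by rewrite /copies nseqD flatten_cat. Qed.

Lemma gsize_copies N : gsize (copies N) = N * axioms_size.
Proof. by elim: N => //= N IHN; rewrite /copies /= gsize_cat -/(copies N) IHN mulSn. Qed.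

Lemma weak_axioms L k s Γ C : gsize (map boolean_axiom s ++ Γ) + usize C + 3 < L ->
  prf L k Γ C -> prf L (k + 5 * size s) (map boolean_axiom s ++ Γ) C.
Proof.
move=> le h; elim: s le => [|x s IHs] le; first by rewrite addn0.
rewrite [map _ _]/= cat_cons in le *; rewrite gsize_cons in le.
have h1 : prf L 3 [:: boolean_axiom x] UOne.
  by apply: (@prf_le _ 2) => //; apply: p_andL2; [gsz | apply: p_ax => /=; lia].
apply: prf_le (p_weak _ h1 (IHs _)); gsz.
Qed.

Lemma weak_copies L k N Γ C : gsize (copies N ++ Γ) + usize C + 3 < L ->
  prf L k Γ C -> prf L (k + 5 * size Xs * N) (copies N ++ Γ) C.
Proof.
move=> le h; elim: N le => [|N IHN] le; first by rewrite muln0 addn0.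
have e : copies N.+1 = map boolean_axiom Xs ++ copies N by [].
rewrite e -catA in le *; rewrite mulnS addnCA addnC.
by apply: weak_axioms => //; apply: IHN; move: le; gsz.
Qed.

Lemma p_orC L k Γ A B : 2 * (usize A + usize B).+1 < L ->
  prf L k Γ (UOr A B) -> prf L (k + 6) Γ (UOr B A).
Proof.
move=> le h; have le2 := prf_size h; rewrite -[Γ]cats0.
apply: (@prf_le _ (k + 5).+1); first by lia.
apply: p_cut h _; first by gsz.
apply: (@p_orL _ 2 2); first by gsz.
  by apply: p_orR2; [|apply: p_ax]; gsz.
by apply: p_orR1; [|apply: p_ax]; gsz.
Qed.

(** Both disjunctions are split. Three of the four cases leave a formula over, which is discarded
    through its derivation of [1]. *)
Lemma p_excluded_middle_mul L k1 k2 j Γ1 Γ2 A A' B B' :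
  gsize Γ1 + gsize Γ2 + 2 * (usize A + usize A' + usize B + usize B') + 10 < L ->
  (forall X, X \in [:: A; A'; B; B'] -> prf L j [:: X] UOne) ->
  prf L k1 Γ1 (UOr A A') -> prf L k2 Γ2 (UOr B B') ->
  prf L (k1 + k2 + 3 * j + 30) (Γ1 ++ Γ2) (UOr (UMul A B) (UOr A' B')).
Proof.
move=> le w hA hB; set G := UOr (UMul A B) (UOr A' B').
have wA : prf L j [:: A] UOne by apply: w; rewrite !inE eqxx.
have wA' : prf L j [:: A'] UOne by apply: w; rewrite !inE eqxx ?orbT.
have wB : prf L j [:: B] UOne by apply: w; rewrite !inE eqxx ?orbT.
apply: (@prf_le _ (k1 + (k2 + (3 * j + 25)).+1).+1); first by lia.
apply: p_cut hA _; first by gsz.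
apply: (@prf_perm _ _ (Γ2 ++ [:: UOr A A'])); first by perm.
apply: p_cut hB _; first by gsz.
apply: (@prf_le _ ((4 + (5 + j)).+1 + ((3 + j).+2 + (3 + j).+2).+1).+1); first by lia.
have gA' : prf L 3 [:: A'] G.
  by apply: p_orR2; [gsz | apply: p_orR1; [gsz | apply: p_ax; gsz]].
have gB' : prf L 3 [:: B'] G.
  by apply: p_orR2; [gsz | apply: p_orR2; [gsz | apply: p_ax; gsz]].
apply: p_orL; first by gsz.
  apply: (@prf_perm _ _ [:: UOr A A'; B]); first by perm.
  apply: p_orL; first by gsz.
    apply: p_orR1; first by gsz.
    apply: (@p_mulR _ 1 1 [:: A] [:: B]); first by gsz.
      by apply: p_ax; gsz.
    by apply: p_ax; gsz.
  apply: (@prf_perm _ _ [:: B; A']); first by perm.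
  by apply: prf_le (p_weak _ wB gA'); gsz.
apply: (@prf_perm _ _ [:: UOr A A'; B']); first by perm.
apply: p_orL; first by gsz.
  by apply: p_weak wA gB'; gsz.
by apply: p_weak wA' gB'; gsz.
Qed.

Fixpoint leaves (V : Type) (φ : nnf V) : nat :=
  match φ with
  | NLit _ _ => 1
  | NTop | NBot => 0
  | NAnd a b | NOr a b => leaves a + leaves b
  end.

Lemma leaves_le V (φ : nnf V) : leaves φ <= nsize φ.
Proof. by elim: φ => //= a IHa b IHb; lia. Qed.

(** Each literal occurrence consumes one copy of the axiom list, of which a single member is used
    and the rest is discarded. Fusion combines two instances because their contexts add up; the
    disjunction case is the conjunction case for the duals with the disjuncts exchanged. *)
Lemma excluded_middle L M φ : nsize φ <= M ->
  leaves φ * axioms_size + 20 * nsize φ + 30 < L ->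
  prf L (nsize φ * (5 * size Xs + 9 * M + 60)) (copies (leaves φ))
    (UOr (emb φ) (emb (dual φ))).
Proof.
elim: φ => [b x| | |a IHa b IHb|a IHa b IHb] /= leM leL.
- rewrite mul1n /copies /= cats0.
  case: ifP => [xX|_]; last first.
    rewrite -[map _ _]cats0; apply: (@prf_le _ (8 + 5 * size Xs)); first by lia.
    apply: weak_axioms; first by move: leL; rewrite mul1n /axioms_size; case: b => /=; gsz.
    case: b => /=; [apply: (@prf_le _ 2) => //; apply: p_orR2|apply: (@prf_le _ 2) => //; apply: p_orR1];
      by [gsz | apply: p_oneR; gsz].
  have e : perm_eq (map boolean_axiom (rem x Xs) ++ [:: boolean_axiom x]) (map boolean_axiom Xs).
    by rewrite perm_sym; apply: perm_trans (perm_map _ (perm_to_rem xX)) _; perm.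
  have := gsize_perm e; rewrite -/axioms_size gsize_cat => es.
  apply: (prf_perm e); apply: (@prf_le _ (9 + 5 * size (rem x Xs))).
    rewrite -addnA [9 + _]addnC; apply: leq_add; last by lia.
    by rewrite leq_mul2l size_rem // leq_pred.
  have sz : size Xs > 0 by case: (Xs) xX.
  apply: weak_axioms.
    by move: leL; rewrite -es gsize_cat mul1n; case: b => /=; gsz.
  have h : prf L 3 [:: boolean_axiom x] (UOr (UAnd (UAtom x) UOne) (UAnd (UNeg (UAtom x)) UOne)).
    by rewrite mul1n in leL; do 2 (apply: p_andL1; [gsz|]); apply: p_ax; gsz.
  case: b => /=; first by apply: prf_le h.
  by apply: (prf_le _ (p_orC _ h)) => //=; lia.
- by apply: (@prf_le _ 2); [lia | apply: p_orR1; [gsz | apply: p_oneR; gsz]].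
- by apply: (@prf_le _ 2); [lia | apply: p_orR2; [gsz | apply: p_oneR; gsz]].
all: have ha := IHa ltac:(lia) ltac:(lia); have hb := IHb ltac:(lia) ltac:(lia).
all: have sa := emb_size a; have sb := emb_size b.
all: have sa' := emb_size (dual a); have sb' := emb_size (dual b); rewrite !nsize_dual in sa' sb'.
all: have ma : nsize a * (5 * size Xs + 9 * M + 60) + nsize b * (5 * size Xs + 9 * M + 60)
       = (nsize a + nsize b) * (5 * size Xs + 9 * M + 60) by rewrite mulnDl.
all: rewrite copies_add mulSn.
all: have w φ : φ \in [:: a; dual a; b; dual b] -> prf L (3 * M) [:: emb φ] UOne.
1,3: rewrite !inE => /or4P[]/eqP->; (apply: prf_le (emb_one _); [rewrite ?nsize_dual|]; lia).
- apply: prf_le (p_excluded_middle_mul (j := 3 * M) _ _ ha hb).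
  + by rewrite -ma; lia.
  + by rewrite !gsize_copies; lia.
  + by move=> X; rewrite !inE => /or4P[]/eqP->; apply: w; rewrite !inE eqxx ?orbT.
- have ha' := p_orC _ ha; have hb' := p_orC _ hb.
  have h := p_excluded_middle_mul (j := 3 * M) _ _ (ha' _) (hb' _).
  apply: prf_le (p_orC _ (h _ _ _ _)).
  + by rewrite -ma; lia.
  + by rewrite /=; lia.
  + by rewrite !gsize_copies; lia.
  + by move=> X; rewrite !inE => /or4P[]/eqP->; apply: w; rewrite !inE eqxx ?orbT.
  + by lia.
  + by lia.
Qed.

(** No axiom is spent. Once the disjunction has been split, the fusion on the other side offers the
    matching factor, and the remaining factor is discarded. *)
Lemma noncontradiction L M φ : nsize φ <= M -> 20 * nsize φ + 30 < L ->
  prf L (nsize φ * (5 * M + 20)) [:: emb φ; emb (dual φ)] UZero.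
Proof.
elim: φ => [b x| | |a IHa b IHb|a IHa b IHb] /= leM leL.
- rewrite mul1n; case: ifP => _.
    have h A : usize A <= 1 -> prf L 5 [:: UAnd A UOne; UAnd (UNeg A) UOne] UZero.
      move=> A1; apply: p_andL1; first by gsz.
      apply: (@prf_perm _ _ [:: UAnd (UNeg A) UOne; A]); first by perm.
      apply: p_andL1; first by gsz.
      by apply: (@p_impL _ 1 1 [:: A] [::]); [gsz | apply: p_ax; gsz | apply: p_ax; gsz].
    case: b => /=; apply: (@prf_le _ 5); try lia; first exact: h.
    by apply: prf_perm (h _ _); [perm|].
  have h : prf L 3 [:: UAnd UZero UOne; UOne] UZero.
    by apply: p_andL1; [gsz | apply: (@prf_perm _ _ [:: UOne; UZero]);
      [perm | apply: p_oneL; [gsz | apply: p_ax; gsz]]].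
  by case: b => /=; apply: (@prf_le _ 3); try lia; apply: prf_perm h; perm.
1,2: have h : prf L 3 [:: UAnd UZero UOne; UOne] UZero by
    apply: p_andL1; [gsz | apply: (@prf_perm _ _ [:: UOne; UZero]);
      [perm | apply: p_oneL; [gsz | apply: p_ax; gsz]]].
1,2: by apply: (@prf_le _ 3); try lia; apply: prf_perm h; perm.
all: have ha := IHa ltac:(lia) ltac:(lia); have hb := IHb ltac:(lia) ltac:(lia).
all: have sa := emb_size a; have sb := emb_size b.
all: have sa' := emb_size (dual a); have sb' := emb_size (dual b); rewrite !nsize_dual in sa' sb'.
all: have ma : nsize a * (5 * M + 20) + nsize b * (5 * M + 20)
       = (nsize a + nsize b) * (5 * M + 20) by rewrite mulnDl.
all: rewrite mulSn.
- apply: (@prf_perm _ _ [:: UOr (emb (dual a)) (emb (dual b)); UMul (emb a) (emb b)]); first by perm.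
  apply: (@prf_le _ ((nsize a * (5 * M + 20) + 5 * nsize b).+1 +
                     (nsize b * (5 * M + 20) + 5 * nsize a).+1).+1); first by rewrite -ma; lia.
  apply: p_orL; first by gsz.
    apply: (@prf_perm _ _ [:: UMul (emb a) (emb b); emb (dual a)]); first by perm.
    apply: p_mulL; first by gsz.
    apply: (@prf_perm _ _ [:: emb b; emb a; emb (dual a)]); first by perm.
    by apply: weak_emb ha; gsz.
  apply: (@prf_perm _ _ [:: UMul (emb a) (emb b); emb (dual b)]); first by perm.
  apply: p_mulL; first by gsz.
  by apply: weak_emb hb; gsz.
- apply: (@prf_le _ ((nsize a * (5 * M + 20) + 5 * nsize b).+1 +
                     (nsize b * (5 * M + 20) + 5 * nsize a).+1).+1); first by rewrite -ma; lia.
  apply: p_orL; first by gsz.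
    apply: (@prf_perm _ _ [:: UMul (emb (dual a)) (emb (dual b)); emb a]); first by perm.
    apply: p_mulL; first by gsz.
    apply: (@prf_perm _ _ [:: emb (dual b); emb a; emb (dual a)]); first by perm.
    by rewrite -[in 5 * nsize b](nsize_dual b); apply: weak_emb ha; gsz.
  apply: (@prf_perm _ _ [:: UMul (emb (dual a)) (emb (dual b)); emb b]); first by perm.
  apply: p_mulL; first by gsz.
  apply: (@prf_perm _ _ [:: emb (dual a); emb b; emb (dual b)]); first by perm.
  by rewrite -[in 5 * nsize a](nsize_dual a); apply: weak_emb hb; gsz.
Qed.

End Embedding.

(* A refutation is a decision tree: each inner node asks for the truth value of a
   formula, and each leaf holds an immediate contradiction among the answers.  No
   answer is ever decomposed, so no contraction is needed to simulate it in FLe. *)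
Inductive clash (axs : seq (nnf atom)) : seq (nnf atom) -> Prop :=
| clash_pair φ : clash axs [:: φ; dual φ]
| clash_bot : clash axs [:: NBot]
| clash_and1 a b : clash axs [:: NAnd a b; dual a]
| clash_and2 a b : clash axs [:: NAnd a b; dual b]
| clash_or a b : clash axs [:: NOr a b; dual a; dual b]
| clash_axiom c : c \in axs -> clash axs [:: dual c].

Inductive refutation (axs : seq (nnf atom)) (M : nat) : nat -> seq (nnf atom) -> Prop :=
| ref_clash k Γ core rest : clash axs core -> perm_eq (core ++ rest) Γ -> 0 < k ->
    refutation axs M k Γ
| ref_cut k k1 k2 Γ φ : nsize φ <= M -> refutation axs M k1 (φ :: Γ) ->
    refutation axs M k2 (dual φ :: Γ) -> k1 + k2 < k -> refutation axs M k Γ.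

Section Simulation.

Variables (Xs : seq atom) (axs : seq (nnf atom)) (K G : uformula) (L M Nmax c : nat).

Hypotheses (K_one : prf L c (K :: copies Xs 1) UOne)
  (zero_G : prf L c (UZero :: copies Xs 1) G)
  (axs_G : forall φ, φ \in axs -> prf L c (K :: emb Xs (dual φ) :: copies Xs 1) G).

Let base := usize K + usize G + Nmax.+2 * axioms_size Xs + 40 * M + 50.

Let step := 2 * c + 10 * size Xs * Nmax.+1 + 10 * L + M * (5 * size Xs + 14 * M + 100) + 100.

Lemma gsize_emb_le s : all (fun φ => nsize φ <= M) s ->
  gsize (map (emb Xs) s) <= 5 * M * size s.
Proof.
elim: s => [|φ s IHs] //= /andP[leφ /IHs le]; rewrite gsize_cons mulnS.
by apply: leq_add => //; case/andP: (emb_size Xs φ) => _ le2; lia.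
Qed.

(** Two copies of the axioms suffice at a leaf. If the clash yields [0], one copy serves to discard
    [K] and the other to pass from [0] to [G]. If the clash is the negation of an axiom, one copy is
    used by [axs_G] and the other is discarded. *)
Lemma prf_clash core : clash axs core -> all (fun φ => nsize φ <= M) core ->
  base + 15 * M < L ->
  prf L (2 * c + 2 * M * (5 * M + 20) + 5 * size Xs + 40 * M + 40)
     (K :: copies Xs 2 ++ map (emb Xs) core) G.
Proof.
move=> cl small leL.
have le3 : size core <= 3 by case: cl.
have leC : gsize (map (emb Xs) core) <= 15 * M.
  by apply: leq_trans (gsize_emb_le small) _; rewrite mulnC; nia.
have bL : usize K + usize G + 2 * axioms_size Xs + 55 * M + 50 < L.
  by move: leL; rewrite /base !mulSn; lia.
have nc φ : nsize φ <= M ->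
    prf L (M * (5 * M + 20)) [:: emb Xs φ; emb Xs (dual φ)] UZero.
  move=> le; apply: prf_le (noncontradiction Xs le _); last by lia.
  by rewrite leq_mul2r le orbT.
suff [z|[φ [ax ecore]]] : prf L (2 * M * (5 * M + 20) + 20 * M + 20) (map (emb Xs) core) UZero
    \/ exists φ, φ \in axs /\ core = [:: dual φ].
- have h : prf L (2 * M * (5 * M + 20) + 20 * M + 20 + c).+1
      (map (emb Xs) core ++ copies Xs 1) G.
    by apply: p_cut z zero_G; rewrite gsize_cat gsize_copies mul1n; lia.
  apply: (@prf_le _ ((2 * M * (5 * M + 20) + 20 * M + 20 + c).+1 + c).+2); first by lia.
  apply: (@prf_perm _ _ ((K :: copies Xs 1) ++ (map (emb Xs) core ++ copies Xs 1))).
    by rewrite (copies_add Xs 1 1); perm.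
  apply: p_weak_ctx K_one h; last by rewrite gsize_cons; have := usize_gt0 K; lia.
  by rewrite !(gsize_cat, gsize_cons, gsize_copies); lia.
- rewrite ecore /=; apply: (@prf_le _ (c + 5 * size Xs * 1)); first by lia.
  apply: (@prf_perm _ _ (copies Xs 1 ++ (K :: emb Xs (dual φ) :: copies Xs 1))).
    by rewrite (copies_add Xs 1 1); perm.
  apply: weak_copies; last exact: axs_G.
  rewrite gsize_cat !gsize_cons !gsize_copies mul1n.
  by move: leC; rewrite ecore /= gsize_cons gsize_nil; lia.
have szC Γ C : gsize Γ <= 15 * M -> usize C <= 3 -> gsize Γ + usize C + 3 < L by lia.
have szD Γ C : gsize Γ <= 15 * M -> usize C <= 3 -> gsize Γ + usize C < L by lia.
have small_cons φ s : nsize φ <= M -> gsize (map (emb Xs) s) <= 10 * M ->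
    gsize (map (emb Xs) (φ :: s)) <= 15 * M.
  by move=> le1 le2; rewrite /= gsize_cons; have := emb_size Xs φ; lia.
have L0 : 10 < L by lia.
case: cl small leC {le3} => [φ||a b|a b|a b|φ ax] /= small leC.
- left; case/andP: small => le _; apply: prf_le (nc _ le); lia.
- by left; apply: (@prf_le _ 2); [lia | apply: p_andL1; [gsz | apply: p_ax; gsz]].
- left; case/andP: small => le _.
  apply: (@prf_le _ (M * (5 * M + 20) + 5 * nsize b).+1); first by lia.
  apply: p_mulL; first exact: (szD _ UZero leC isT).
  apply: (@prf_perm _ _ [:: emb Xs b; emb Xs a; emb Xs (dual a)]); first by perm.
  by apply: weak_emb (nc a _); [apply: szC => //; move: leC; gsz | lia].
- left; case/andP: small => le _.
  apply: (@prf_le _ (M * (5 * M + 20) + 5 * nsize a).+1); first by lia.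
  apply: p_mulL; first exact: (szD _ UZero leC isT).
  by apply: weak_emb (nc b _); [apply: szC => //; move: leC; gsz | lia].
- left; case/andP: small => le _.
  apply: (@prf_le _ ((M * (5 * M + 20) + 5 * nsize (dual b)) +
      (M * (5 * M + 20) + 5 * nsize (dual a))).+1); first by rewrite !nsize_dual; lia.
  apply: p_orL; first exact: (szD _ UZero leC isT).
    apply: (@prf_perm _ _ [:: emb Xs (dual b); emb Xs a; emb Xs (dual a)]); first by perm.
    by apply: weak_emb (nc a _); [apply: szC => //; move: leC; gsz | lia].
  apply: (@prf_perm _ _ [:: emb Xs (dual a); emb Xs b; emb Xs (dual b)]); first by perm.
  by apply: weak_emb (nc b _); [apply: szC => //; move: leC; gsz | lia].
- by right; exists φ.
Qed.

(** A cut on [φ] becomes a cut on its excluded middle followed by the left rule for disjunction. It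
    spends [leaves φ <= M] copies, and the rule hands the same remaining context to both premises.
    Hence [k * M] copies cover all cuts on a branch, and 2 are kept for its leaf. *)
Lemma prf_refutation k Γ : refutation axs M k Γ -> forall N, k * M + 2 <= N -> N <= Nmax ->
  all (fun φ => nsize φ <= M) Γ ->
  gsize (map (emb Xs) Γ) + 10 * M * k + base + 15 * M < L ->
  prf L (k * step) (K :: copies Xs N ++ map (emb Xs) Γ) G.
Proof.
elim=> {k Γ} [k Γ core rest cl e k0|k k1 k2 Γ φ leM _ IH1 _ IH2 lt] N ltN leN small leL.
- have small' : all (fun φ => nsize φ <= M) core.
    by move: small; rewrite -(perm_all _ e) all_cat => /andP[].
  have h := prf_clash cl small' ltac:(lia).
  have eN : copies Xs N = copies Xs N.-2 ++ copies Xs 2.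
    by rewrite -copies_add; congr copies; lia.
  have esz : gsize (map (emb Xs) core) + gsize (map (emb Xs) rest) = gsize (map (emb Xs) Γ).
    by rewrite -gsize_cat -map_cat; apply/gsize_perm/perm_map.
  have leNs : N.-2 * axioms_size Xs + 2 * axioms_size Xs <= Nmax.+2 * axioms_size Xs.
    by rewrite -mulnDl leq_mul2r; apply/orP; right; lia.
  have lb : base = usize K + usize G + Nmax.+2 * axioms_size Xs + 40 * M + 50 by [].
  apply: (@prf_perm _ _ (map (emb Xs) rest ++ (copies Xs N.-2 ++
      (K :: copies Xs 2 ++ map (emb Xs) core)))).
    have /permP e' := perm_map (emb Xs) e.
    by apply/permP=> a; have := e' a; rewrite eN map_cat /= !count_cat /= !count_cat /= => <-; lia.
  have szc : gsize (copies Xs N.-2 ++ K :: copies Xs 2 ++ map (emb Xs) core)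
     = N.-2 * axioms_size Xs + usize K + 2 * axioms_size Xs + gsize (map (emb Xs) core).
    by rewrite gsize_cat gsize_cons gsize_cat !gsize_copies; lia.
  have szN : gsize (copies Xs N.-2 ++ K :: copies Xs 2 ++ map (emb Xs) core) + usize G + 3 < L.
    by rewrite szc; lia.
  apply: prf_le (weak_embs _ (weak_copies szN h)); last by rewrite gsize_cat szc; lia.
  apply: (@leq_trans step); last by rewrite leq_pmull.
    have : 5 * size Xs * N.-2 + 5 * size Xs <= 10 * size Xs * Nmax.+1.
      rewrite -mulnSr -mulnA (mulnC 10) -mulnA; apply: leq_trans (_ : 5 * (size Xs * Nmax.+1) <= _).
        by rewrite !leq_mul2l; apply/orP; right; lia.
      by lia.
    have : gsize (map (emb Xs) rest) <= L by lia.
    rewrite /step; have -> : 2 * M * (5 * M + 20) = M * (10 * M + 40) by lia.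
    by rewrite !mulnDr; lia.
- have lf := leaves_le φ.
  have leNs : N * axioms_size Xs <= Nmax.+2 * axioms_size Xs by rewrite leq_mul2r; apply/orP; right; lia.
  have lb : base = usize K + usize G + Nmax.+2 * axioms_size Xs + 40 * M + 50 by [].
  have kM : k1 * M + k2 * M + M <= k * M by rewrite -mulnDl -mulSnr leq_mul2r lt orbT.
  have eN : leaves φ + (N - leaves φ) = N by lia.
  have e : copies Xs N = copies Xs (leaves φ) ++ copies Xs (N - leaves φ) by rewrite -copies_add eN.
  have eNs : leaves φ * axioms_size Xs + (N - leaves φ) * axioms_size Xs = N * axioms_size Xs.
    by rewrite -mulnDl eN.
  have em := @excluded_middle Xs L M φ leM ltac:(lia).
  have sφ := emb_size Xs φ; have sφ' := emb_size Xs (dual φ); rewrite nsize_dual in sφ'.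
  have leMk : 10 * M * k1 + 10 * M + 10 * M * k2 <= 10 * M * k.
    by rewrite addnAC -mulnDr -mulnSr leq_mul2l lt orbT.
  have ltN1 : k1 * M + 2 <= N - leaves φ by lia.
  have ltN2 : k2 * M + 2 <= N - leaves φ by lia.
  have leN' : N - leaves φ <= Nmax by lia.
  have h1 := IH1 _ ltN1 leN'; have h2 := IH2 _ ltN2 leN'.
  apply: (@prf_perm _ _ (copies Xs (leaves φ) ++ (K :: copies Xs (N - leaves φ) ++ map (emb Xs) Γ))).
    by rewrite e; perm.
  apply: (@prf_le _ (nsize φ * (5 * size Xs + 9 * M + 60) + (k1 * step + k2 * step).+1).+1).
    apply: (@leq_trans (step * (k1 + k2).+1)); last by rewrite mulnC leq_mul2r lt orbT.
    rewrite mulnS mulnDr ![step * _]mulnC; have : nsize φ * (5 * size Xs + 9 * M + 60) + 2 <= step.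
      rewrite /step; have : nsize φ * (5 * size Xs + 9 * M + 60) <= M * (5 * size Xs + 14 * M + 100).
        by apply: leq_mul => //; lia.
      by lia.
    by lia.
  apply: p_cut em _.
    by rewrite gsize_cat gsize_cons gsize_cat !gsize_copies; lia.
  apply: p_orL.
  + by rewrite !gsize_cons gsize_cat !gsize_copies /=; lia.
  + apply: (@prf_perm _ _ (K :: copies Xs (N - leaves φ) ++ map (emb Xs) (φ :: Γ))); first by perm.
    by apply: h1; rewrite /= ?leM // gsize_cons; lia.
  + apply: (@prf_perm _ _ (K :: copies Xs (N - leaves φ) ++ map (emb Xs) (dual φ :: Γ))); first by perm.
    by apply: h2; rewrite /= ?nsize_dual ?leM // gsize_cons; lia.
Qed.

End Simulation.

(** * Clauses of the clique and colour formulas inside FLe *)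

Lemma p_bigor_intro L k Γ s A : A \in s -> gsize Γ + usize (ubigor s) < L ->
  prf L k Γ A -> prf L (k + size s) Γ (ubigor s).
Proof.
move=> + + h; elim: s => // B [|B' s] IHs.
  by rewrite inE => /eqP<- _; apply: prf_le h; lia.
rewrite inE [ubigor _]/= [size _]/= => /orP[/eqP<-|As] le.
  by apply: (@prf_le _ k.+1); [lia | apply: p_orR1].
rewrite addnS; apply: p_orR2 => //; apply: IHs As _.
by move: le; rewrite /ubigor /=; lia.
Qed.

Lemma p_bigand_elim L k Γ s A C : A \in s -> gsize (ubigand s :: Γ) + usize C < L ->
  prf L k (A :: Γ) C -> prf L (k + size s) (ubigand s :: Γ) C.
Proof.
move=> + + h; elim: s => // B [|B' s] IHs.
  by rewrite inE => /eqP<- _; apply: prf_le h; lia.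
rewrite inE [ubigand _]/= [size _]/= !gsize_cons => /orP[/eqP<-|As] le.
  by apply: (@prf_le _ k.+1); [lia | apply: p_andL1].
rewrite addnS; apply: p_andL2 => //; apply: IHs As _.
by move: le; rewrite /ubigand /= !gsize_cons; lia.
Qed.

Lemma p_bigand_intro L k Γ s : s != [::] -> gsize Γ + usize (ubigand s) < L ->
  (forall A, A \in s -> prf L k Γ A) -> prf L (k.+1 * size s) Γ (ubigand s).
Proof.
elim: s => // B [|B' s] IHs _ le h; first by apply: prf_le (h _ (mem_head _ _)); rewrite muln1.
rewrite [size _]/= mulnS; apply: (@prf_le _ (k + k.+1 * (size s).+1).+1); first by rewrite -addSn.
apply: p_andR => //; first by apply: h; apply: mem_head.
apply: IHs => //; last by move=> A As; apply: h; rewrite inE As orbT.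
by move: le; rewrite /ubigand /=; lia.
Qed.

Lemma p_bigor_elim L k Γ s C : s != [::] -> gsize (ubigor s :: Γ) + usize C < L ->
  (forall A, A \in s -> prf L k (A :: Γ) C) -> prf L (k.+1 * size s) (ubigor s :: Γ) C.
Proof.
elim: s => // B [|B' s] IHs _ le h; first by apply: prf_le (h _ (mem_head _ _)); rewrite muln1.
rewrite [size _]/= mulnS; apply: (@prf_le _ (k + k.+1 * (size s).+1).+1); first by rewrite -addSn.
apply: p_orL => //; first by apply: h; apply: mem_head.
apply: IHs => //; last by move=> A As; apply: h; rewrite inE As orbT.
by move: le; rewrite /ubigor /= !gsize_cons /=; lia.
Qed.

Lemma usize_bigor_mem A s : A \in s -> usize A <= usize (ubigor s).
Proof.
elim: s => // B [|B' s] IHs; first by rewrite inE => /eqP->.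
by rewrite inE [ubigor _]/= => /orP[/eqP->|/IHs]; rewrite /ubigor /=; lia.
Qed.

Lemma usize_bigand_mem A s : A \in s -> usize A <= usize (ubigand s).
Proof.
elim: s => // B [|B' s] IHs; first by rewrite inE => /eqP->.
by rewrite inE [ubigand _]/= => /orP[/eqP->|/IHs]; rewrite /ubigand /=; lia.
Qed.

Definition clause_nnf (c : seq literal) : nnf atom :=
  foldr (fun l φ => NOr (NLit l.1 l.2) φ) NBot c.

Lemma nsize_clause c : nsize (clause_nnf c) = (2 * size c).+1.
Proof. by elim: c => //= l c ->; lia. Qed.

Definition atoms (n : nat) : seq atom :=
  [seq Avar ij.1 ij.2 | ij <- increasing_pairs n]
  ++ [seq Rvar u i | u <- iota 0 (Nat.sqrt n).+1, i <- iota 0 n]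
  ++ [seq Svar i a | i <- iota 0 n, a <- iota 0 (Nat.sqrt n)].

Lemma mem_atoms n x : x \in atoms n = match x with
  | Avar i j => i < j < n
  | Rvar u i => (u <= Nat.sqrt n) && (i < n)
  | Svar i a => (i < n) && (a < Nat.sqrt n) end.
Proof.
rewrite /atoms 2!mem_cat; apply/idP/idP => [/or3P[]|].
- by case/mapP=> -[i j]; rewrite mem_increasing_pairs => h ->.
- by case/allpairsP=> -[u i]; rewrite !mem_iota /= => -[h1 h2 ->]; rewrite h2 -ltnS h1.
- by case/allpairsP=> -[u i]; rewrite !mem_iota /= => -[h1 h2 ->]; rewrite h2 h1.
case: x => [i j|u i|i a] h; apply/or3P.
- by apply: Or31; apply/mapP; exists (i, j); rewrite // mem_increasing_pairs.
- apply: Or32; apply/allpairsP; exists (u, i); rewrite !mem_iota /=.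
  by case/andP: h => h1 h2; split.
- by apply: Or33; apply/allpairsP; exists (i, a); rewrite !mem_iota /=; case/andP: h.
Qed.

Section CliqueColor.

Variable n : nat.
Hypothesis n_gt0 : 0 < n.

Let m := Nat.sqrt n.
Let Xs := atoms n.
Let K := Clique n.
Let G := ColorBar n.

Definition php_axioms : seq (nnf atom) :=
  map clause_nnf (clique_clauses n m.+1 ++ color_clauses n m).

Let m_gt0 : 0 < m.
Proof. by rewrite /m; have := Nat.sqrt_spec n; case: (Nat.sqrt n) => //; lia. Qed.

Let le_mn : m <= n.
Proof. by rewrite /m; have := Nat.sqrt_le_lin n; lia. Qed.

Lemma clause_small (c : seq literal) : c \in clique_clauses n m.+1 ++ color_clauses n m ->
  (size c <= n + 3) && all (fun l : literal => l.2 \in Xs) c.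
Proof.
rewrite mem_cat => /orP[]; move: c.
  apply: clique_clausesP => [u ltu|u i j ltu _ lti ltj|u v i _ ltu ltv lti|u v i j _ ltu ltv ltij];
    rewrite /= ?mem_atoms ?ltij ?andbT ?ltnS ?lti ?ltj ?(ltnSE ltu) ?(ltnSE ltv) /=.
  - rewrite size_map size_iota leq_addr /= all_map; apply/allP=> i.
    by rewrite mem_iota /= mem_atoms (ltnSE ltu).
  - by lia.
  - by lia.
  - by case/andP: ltij => lt1 lt2; rewrite lt2 (ltn_trans lt1 lt2); lia.
apply: color_clausesP => [i lti|i a b lti _ lta ltb|a i j lta ltij];
  rewrite /= ?mem_atoms ?ltij ?andbT ?lti ?lta ?ltb /=.
- rewrite size_map size_iota; apply/andP; split; first by lia.
  by rewrite all_map; apply/allP=> a; rewrite mem_iota /= mem_atoms lti.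
- by lia.
- by case/andP: ltij => lt1 lt2; rewrite lt2 (ltn_trans lt1 lt2); lia.
Qed.

Variable L : nat.
Hypothesis leL : usize K + usize G + axioms_size Xs + 40 * n + 200 < L.

Let aX x : x \in Xs -> perm_eq (map boolean_axiom (rem x Xs) ++ [:: boolean_axiom x]) (copies Xs 1).
Proof.
move=> xX; rewrite /copies /= cats0 perm_sym.
by apply: perm_trans (perm_map _ (perm_to_rem xX)) _; perm.
Qed.

Lemma p_use_axiom k x Γ C : x \in Xs -> gsize (Γ ++ copies Xs 1) + usize C + 3 < L ->
  prf L k (boolean_axiom x :: Γ) C -> prf L (k + 5 * size Xs) (Γ ++ copies Xs 1) C.
Proof.
move=> xX le h; have e := aX xX.
apply: (@prf_perm _ _ (map boolean_axiom (rem x Xs) ++ (boolean_axiom x :: Γ))).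
  apply: (@perm_trans _ (Γ ++ (map boolean_axiom (rem x Xs) ++ [:: boolean_axiom x]))); first by perm.
  by rewrite perm_cat2l.
apply: (@prf_le _ (k + 5 * size (rem x Xs))).
  by rewrite leq_add2l leq_mul2l size_rem // leq_pred.
have := gsize_perm e; rewrite gsize_cat gsize_cons gsize_nil => es.
apply: weak_axioms => //; move: es le; move: (copies Xs 1) => Y es.
by rewrite !gsize_cat gsize_cons; lia.
Qed.

Lemma p_atom_one x : x \in Xs -> prf L (20 + 5 * size Xs) (UAtom x :: copies Xs 1) UOne.
Proof.
move=> xX; apply: (p_use_axiom (Γ := [:: UAtom x]) xX).
  by move: leL; rewrite gsize_cons gsize_copies mul1n; gsz.
apply: (@prf_le _ (1 + 1 + 1).+3) => //; do 1 (apply: p_andL1; first by gsz).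
do 2 (apply: p_andL2; first by gsz).
by apply: (@p_impL _ 1 1 [:: UAtom x] [::]); [gsz|apply: p_ax; gsz|apply: p_ax; gsz].
Qed.

Lemma p_zero_neg x : x \in Xs -> prf L (20 + 5 * size Xs) (UZero :: copies Xs 1) (UNeg (UAtom x)).
Proof.
move=> xX; apply: (p_use_axiom (Γ := [:: UZero]) xX).
  by move: leL; rewrite gsize_cons gsize_copies mul1n; gsz.
apply: (@prf_le _ (1 + 1).+4) => //; apply: p_andL1; first by gsz.
apply: p_andL2; first by gsz.
apply: p_andL1; first by gsz.
by apply: (@p_impL _ 1 1 [:: UZero] [::]); [gsz|apply: p_ax; gsz|apply: p_ax; gsz].
Qed.

Let N := size (clique_clauses n m.+1) + size (color_clauses n m).

Definition sim_cost := (5 * size Xs + 20 * n + 300) * (N + n + 10).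

Lemma p_ColorBar_intro k Γ (c : seq literal) : c \in color_clauses n m -> gsize Γ + usize G < L ->
  prf L k Γ (ubigand [seq literal_formula (complement l) | l <- c]) ->
  prf L (k + N) Γ G.
Proof.
move=> cC le h; apply: (@prf_le _ (k + size (color_clauses n m))).
  by rewrite leq_add2l leq_addl.
rewrite -(size_map (fun c => ubigand [seq literal_formula (complement l) | l <- c])).
by apply: p_bigor_intro h => //; apply/mapP; exists c.
Qed.

(** Without weakening on the right, [0] yields ColorBar only through one of its disjuncts. The one
    stating that vertex 0 has no colour consists of negated atoms, each obtained from an axiom
    [0 -> ¬x]. *)
Lemma zero_ColorBar : prf L sim_cost (UZero :: copies Xs 1) G.
Proof.
pose c0 : seq literal := [seq (true, Svar 0 a) | a <- iota 0 m].
have c0C : c0 \in color_clauses n m.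
  by rewrite mem_cat; apply/orP; left; apply/mapP; exists 0; rewrite // mem_iota.
have le0 : usize (ubigand [seq literal_formula (complement l) | l <- c0]) <= usize G.
  by apply: usize_bigor_mem; apply/mapP; exists c0.
apply: (@prf_le _ ((20 + 5 * size Xs).+1 * size c0 + N)); last first.
  apply: p_ColorBar_intro c0C _ _; first by move: leL; rewrite gsize_cons gsize_copies mul1n /=; lia.
  rewrite -(size_map (fun l => literal_formula (complement l))); apply: p_bigand_intro.
  - by rewrite /c0; case: (m) m_gt0.
  - by move: leL; rewrite gsize_cons gsize_copies mul1n /=; lia.
  - move=> A /mapP[l /mapP[a]]; rewrite mem_iota => lta -> ->; apply: p_zero_neg.
    by rewrite mem_atoms /= n_gt0.
rewrite size_map size_iota /sim_cost; have := le_mn; move: (N) (size Xs) => N0 X; nia.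
Qed.

Lemma emb_dual_clause_size (c : seq literal) : c \in clique_clauses n m.+1 ++ color_clauses n m ->
  usize (emb Xs (dual (clause_nnf c))) <= 10 * n + 40.
Proof.
move=> /clause_small/andP[le _]; have := emb_size Xs (dual (clause_nnf c)).
rewrite nsize_dual nsize_clause; lia.
Qed.

Lemma p_dual_clause_literal (c : seq literal) (l : literal) : c \in clique_clauses n m.+1 ++ color_clauses n m -> l \in c ->
  prf L (20 * n + 100) [:: emb Xs (dual (clause_nnf c))] (literal_formula (complement l)).
Proof.
move=> cC; have := emb_dual_clause_size cC; have /andP[lec allc] := clause_small cC.
have le2 : 40 * n + 200 < L by lia.
move=> szc lc.
suff : prf L (10 * size c + 3) [:: emb Xs (dual (clause_nnf c))] (literal_formula (complement l)).
  by apply: prf_le; lia.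
have szl : usize (literal_formula (complement l)) <= 3 by case: (l) => -[].
elim: c {cC lec} allc szc lc => // l' c IHc /= /andP[lX allc] szc.
rewrite inE => /orP[/eqP e|lc].
  rewrite e in szl *; apply: (@prf_le _ ((2 + 5 * nsize (dual (clause_nnf c))).+1)).
    by rewrite nsize_dual nsize_clause; lia.
  apply: p_mulL; first by gsz.
  apply: (@prf_perm _ _ [:: emb Xs (dual (clause_nnf c)); emb Xs (NLit (~~ l'.1) l'.2)]); first by perm.
  apply: weak_emb; first by move: szc; gsz.
  rewrite /= lX; apply: p_andL1; first by case: l' {e szc lX} szl => -[] x /=; gsz.
  by case: l' {e szc lX} szl => -[] x /= _; apply: p_ax; gsz.
apply: (@prf_le _ ((10 * size c + 3 + 5 * 1).+1)); first by lia.
apply: p_mulL; first by gsz.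
apply: (@weak_emb _ _ _ (NLit (~~ l'.1) l'.2)); first by move: szc; rewrite /= lX; gsz.
by apply: IHc => //; lia.
Qed.

(** Clique_n does not entail [1] by itself. Selecting the all-positive clause for [u = 0] leaves a
    disjunction of atoms, each discarded by an axiom [x -> 1]. *)
Lemma Clique_one : prf L sim_cost (K :: copies Xs 1) UOne.
Proof.
pose c0 : seq literal := [seq (true, Rvar 0 i) | i <- iota 0 n].
have c0C : c0 \in clique_clauses n m.+1.
  by rewrite mem_cat; apply/orP; left; apply/mapP; exists 0; rewrite // mem_iota.
have le0 : usize (ubigor (map literal_formula c0)) <= usize K.
  by apply: usize_bigand_mem; apply/mapP; exists c0.
apply: (@prf_le _ ((20 + 5 * size Xs).+1 * size c0 + size (clique_clauses n m.+1))); last first.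
  rewrite -(size_map (fun c => ubigor (map literal_formula c)) (clique_clauses n m.+1)).
  apply: (@p_bigand_elim _ _ _ _ (ubigor (map literal_formula c0))).
  - by apply/mapP; exists c0.
  - by rewrite gsize_cons gsize_copies mul1n -[ubigand _]/K /=; lia.
  rewrite -(size_map literal_formula c0); apply: p_bigor_elim.
  - by rewrite /c0; case: (n) n_gt0.
  - by move: leL; rewrite gsize_cons gsize_copies mul1n /=; lia.
  - move=> A /mapP[l /mapP[i]]; rewrite mem_iota => lti -> ->; apply: p_atom_one.
    by rewrite mem_atoms.
rewrite size_map size_iota /sim_cost.
have : size (clique_clauses n m.+1) <= N by apply: leq_addr.
move: (N) (size Xs) (size _) => N0 X y; nia.
Qed.

Lemma p_clause_contradiction (c : seq literal) :
  c != [::] -> c \in clique_clauses n m.+1 ++ color_clauses n m ->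
  usize (ubigor (map literal_formula c)) + 10 * n + 50 < L ->
  prf L ((20 * n + 110) * (n + 3))
    [:: ubigor (map literal_formula c); emb Xs (dual (clause_nnf c))] UZero.
Proof.
move=> c0 cC szK; have szc := emb_dual_clause_size cC; have /andP[lec _] := clause_small cC.
apply: (@prf_le _ ((20 * n + 109).+1 * size (map literal_formula c))).
  by rewrite size_map -addnS leq_mul2l lec orbT.
apply: p_bigor_elim; first by case: (c) c0.
  by rewrite !gsize_cons gsize_nil /=; lia.
move=> A /mapP[l lc ->].
have szl : usize (literal_formula l) <= usize (ubigor (map literal_formula c)).
  by apply: usize_bigor_mem; apply: map_f.
have h := p_dual_clause_literal cC lc.
apply: (@prf_perm _ _ ([:: emb Xs (dual (clause_nnf c))] ++ [:: literal_formula l])); first by perm.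
apply: (@prf_le _ (20 * n + 100 + 3).+1); first by lia.
apply: p_cut h _; first by rewrite gsize_cat !gsize_cons !gsize_nil /=; lia.
case: l {lc szl} => -[] x; rewrite /literal_formula /=.
  by apply: (@p_impL _ 1 1 [:: UAtom x] [::]); [gsz|apply: p_ax; gsz|apply: p_ax; gsz].
apply: (@prf_perm _ _ [:: UNeg (UAtom x); UAtom x]); first by perm.
by apply: (@p_impL _ 1 1 [:: UAtom x] [::]); [gsz|apply: p_ax; gsz|apply: p_ax; gsz].
Qed.

(** A negated clause of Clique_n contradicts [K] and gives [0], hence ColorBar. A negated clause of
    Color_n yields a disjunct of ColorBar outright, and [K] is discarded. *)
Lemma php_axioms_ColorBar φ : φ \in php_axioms ->
  prf L (sim_cost * 5) (K :: emb Xs (dual φ) :: copies Xs 1) G.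
Proof.
case/mapP=> c cC ->; have szc := emb_dual_clause_size cC.
have szcopies : gsize (copies Xs 1) = axioms_size Xs by rewrite gsize_copies mul1n.
have /andP[lec _] := clause_small cC.
have leN : (5 * size Xs + 20 * n + 300) * (N + n + 10) <= sim_cost by [].
move: (cC); rewrite mem_cat => /orP[cQ|cC'].
- have sz : usize (ubigor (map literal_formula c)) <= usize K.
    by apply: usize_bigand_mem; apply/mapP; exists c.
  have z : prf L ((20 * n + 110) * (n + 3)) [:: ubigor (map literal_formula c); emb Xs (dual (clause_nnf c))] UZero.
    apply: p_clause_contradiction => //; last by lia.
    apply: (clique_clausesP (P := fun c => c != [::])) cQ => // u _; by case: (n) n_gt0.
  have h : prf L ((20 * n + 110) * (n + 3) + size (clique_clauses n m.+1)) [:: K; emb Xs (dual (clause_nnf c))] UZero.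
    rewrite -(size_map (fun c => ubigor (map literal_formula c)) (clique_clauses n m.+1)).
    apply: p_bigand_elim z; first by apply/mapP; exists c.
    by rewrite !gsize_cons gsize_nil -[ubigand _]/K /=; lia.
  have leN1 : size (clique_clauses n m.+1) <= N by apply: leq_addr.
  apply: prf_le (p_cut _ h zero_ColorBar).
    by move: leN leN1; clear; move: sim_cost (size (clique_clauses _ _)) => s x; nia.
  by rewrite gsize_cat !gsize_cons gsize_nil szcopies; lia.
- have h : prf L ((20 * n + 101) * (n + 3)) [:: emb Xs (dual (clause_nnf c))]
      (ubigand [seq literal_formula (complement l) | l <- c]).
    apply: (@prf_le _ ((20 * n + 100).+1 * size (map (fun l => literal_formula (complement l)) c))).
      by rewrite size_map -addnS leq_mul2l lec orbT.
    have le0 : usize (ubigand [seq literal_formula (complement l) | l <- c]) <= usize G.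
      by apply: usize_bigor_mem; apply/mapP; exists c.
    apply: p_bigand_intro.
    + apply: (color_clausesP (P := fun c => map (fun l => literal_formula (complement l)) c != [::])) cC' => // i _.
      by case: (m) m_gt0.
    + by rewrite gsize_cons gsize_nil; lia.
    + by move=> A /mapP[l lc ->]; apply: p_dual_clause_literal.
  have h2 : prf L ((20 * n + 101) * (n + 3) + N) [:: emb Xs (dual (clause_nnf c))] G.
    by apply: p_ColorBar_intro cC' _ h; rewrite gsize_cons gsize_nil; lia.
  apply: (@prf_perm _ _ ((K :: copies Xs 1) ++ [:: emb Xs (dual (clause_nnf c))])); first by perm.
  apply: prf_le (p_weak_ctx _ _ Clique_one h2).
  + by move: leN; clear; move: sim_cost => s; nia.
  + by rewrite gsize_cat !gsize_cons gsize_nil szcopies; lia.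
  + by rewrite gsize_cons; have := usize_gt0 K; lia.
Qed.

End CliqueColor.

(** * Refutations *)

Fixpoint neval (V : Type) (v : V -> bool) (φ : nnf V) : bool :=
  match φ with
  | NLit b x => v x == b
  | NTop => true
  | NBot => false
  | NAnd a b => neval v a && neval v b
  | NOr a b => neval v a || neval v b
  end.

Fixpoint nsubst (V V' : Type) (σ : V -> nnf V') (φ : nnf V) : nnf V' :=
  match φ with
  | NLit b x => if b then σ x else dual (σ x)
  | NTop => NTop
  | NBot => NBot
  | NAnd a b => NAnd (nsubst σ a) (nsubst σ b)
  | NOr a b => NOr (nsubst σ a) (nsubst σ b)
  end.

Fixpoint vars_in (V : Type) (P : V -> Prop) (φ : nnf V) : Prop :=
  match φ with
  | NLit _ x => P x
  | NTop | NBot => True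
  | NAnd a b | NOr a b => vars_in P a /\ vars_in P b
  end.

Lemma neval_dual V (v : V -> bool) φ : neval v (dual φ) = ~~ neval v φ.
Proof.
by elim: φ => //= [b x|a -> b ->|a -> b ->]; [case: b (v x) => -[]|rewrite negb_and|rewrite negb_or].
Qed.

Lemma dual_neq (φ : nnf atom) : dual φ != φ.
Proof. by apply/eqP=> /(congr1 (neval (fun=> true))); rewrite neval_dual; case: neval. Qed.

Lemma nsubst_dual V V' (σ : V -> nnf V') φ : nsubst σ (dual φ) = dual (nsubst σ φ).
Proof. by elim: φ => //= [b x|a -> b ->|a -> b ->] //; case: b; rewrite //= dualK. Qed.

Lemma neval_subst V V' (σ : V -> nnf V') v φ :
  neval v (nsubst σ φ) = neval (fun x => neval v (σ x)) φ.
Proof.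
by elim: φ => //= [b x|a -> b ->|a -> b ->] //; case: b; rewrite ?neval_dual; case: neval.
Qed.

Lemma nsubst_comp V V' V'' (τ : V' -> nnf V'') (σ : V -> nnf V') φ :
  nsubst τ (nsubst σ φ) = nsubst (fun x => nsubst τ (σ x)) φ.
Proof.
by elim: φ => //= [b x|a -> b ->|a -> b ->] //; case: b; rewrite ?nsubst_dual.
Qed.

Lemma nsubst_ext V V' (σ σ' : V -> nnf V') φ : vars_in (fun x => σ x = σ' x) φ ->
  nsubst σ φ = nsubst σ' φ.
Proof. by elim: φ => //= [b x ->|a IHa b IHb [/IHa-> /IHb->]|a IHa b IHb [/IHa-> /IHb->]]. Qed.

Lemma vars_in_impl V (P Q : V -> Prop) φ : (forall x, P x -> Q x) -> vars_in P φ -> vars_in Q φ.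
Proof.
by move=> PQ; elim: φ => //= a IHa b IHb [/IHa ? /IHb ?].
Qed.

Lemma vars_in_dual V (P : V -> Prop) φ : vars_in P φ -> vars_in P (dual φ).
Proof. by elim: φ => //= a IHa b IHb [/IHa ? /IHb ?]. Qed.

Lemma vars_in_subst V V' (P : V' -> Prop) (σ : V -> nnf V') φ :
  vars_in (fun x => vars_in P (σ x)) φ -> vars_in P (nsubst σ φ).
Proof.
elim: φ => //= [b x h|a IHa b IHb [/IHa ? /IHb ?]|a IHa b IHb [/IHa ? /IHb ?]] //.
by case: b => //; apply: vars_in_dual.
Qed.

Lemma nsize_subst V V' (σ : V -> nnf V') B φ : 0 < B -> vars_in (fun x => nsize (σ x) <= B) φ ->
  nsize (nsubst σ φ) <= nsize φ * B.
Proof.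
move=> B0; elim: φ => [b x h||| a IHa b IHb|a IHa b IHb] /=; rewrite ?mul1n //.
- by case: (b); rewrite ?nsize_dual.
- by case=> /IHa ha /IHb hb; rewrite mulSn mulnDl -add1n; apply: leq_add => //; apply: leq_add.
- by case=> /IHa ha /IHb hb; rewrite mulSn mulnDl -add1n; apply: leq_add => //; apply: leq_add.
Qed.

Section Refutations.

Variables (axs : seq (nnf atom)) (M : nat).
Notation R := (refutation axs M).
Implicit Types (Γ : seq (nnf atom)) (φ ψ a b : nnf atom).

Lemma ref_le k k' Γ : k <= k' -> R k Γ -> R k' Γ.
Proof.
move=> le h; case: h le => {k Γ} [k Γ core rest cl e k0|k k1 k2 Γ φ leM h1 h2 lt] le.
  exact: ref_clash cl e (leq_trans k0 le).
exact: ref_cut leM h1 h2 (leq_trans lt le).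
Qed.

(** Weakening costs nothing, as a leaf ignores everything outside its core. *)
Lemma ref_weak_perm k Γ Γ' Δ : R k Γ -> perm_eq (Γ ++ Δ) Γ' -> R k Γ'.
Proof.
move=> h; elim: h Γ' => {k Γ} [k Γ core rest cl e k0|k k1 k2 Γ φ leM _ IH1 _ IH2 lt] Γ' e'.
  apply: (@ref_clash _ _ _ _ _ (rest ++ Δ) cl) => //; apply: perm_trans e'.
  by rewrite catA perm_cat2r; exact: e.
by apply: ref_cut leM (IH1 _ _) (IH2 _ _) lt; rewrite /= perm_cons.
Qed.

Lemma ref_weak2 k Γ φ ψ : R k (φ :: Γ) -> R k (φ :: ψ :: Γ).
Proof. by move/ref_weak_perm; apply; apply: (perm_trans (y := [:: ψ] ++ φ :: Γ)); [rewrite perm_catC | rewrite -cat1s -[φ :: Γ]cat1s -[ψ :: Γ]cat1s perm_catCA]. Qed.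

Lemma ref_pair Γ φ : φ \in Γ -> dual φ \in Γ -> R 1 Γ.
Proof.
move=> h h'; have e := perm_to_rem h.
have h2 : dual φ \in rem φ Γ.
  by move: h'; rewrite (perm_mem e) inE (negPf (dual_neq φ)).
apply: (@ref_clash _ _ _ _ _ (rem (dual φ) (rem φ Γ)) (clash_pair _ φ)) => //.
rewrite perm_sym (perm_trans e) //= perm_cons; exact: perm_to_rem.
Qed.

Lemma ref_bot Γ : NBot \in Γ -> R 1 Γ.
Proof.
move=> h; apply: (@ref_clash _ _ _ _ _ (rem NBot Γ) (clash_bot _)) => //.
by rewrite perm_sym; apply: perm_to_rem.
Qed.

Lemma ref_or k1 k2 Γ a b : NOr a b \in Γ -> nsize (NOr a b) <= M ->
  R k1 (a :: Γ) -> R k2 (b :: Γ) -> R (k1 + k2 + 3) Γ.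
Proof.
move=> h /= leM h1 h2.
apply: (@ref_cut _ _ _ k1 (k2 + 2) _ a); [lia | exact: h1 | | lia].
apply: (@ref_cut _ _ _ k2 1 _ b); [lia | exact: ref_weak2 | | lia].
apply: (@ref_clash _ _ _ _ _ (rem (NOr a b) Γ) (clash_or _ a b)) => //.
have /permP e := perm_to_rem h; apply/permP=> x; rewrite /= e /=; lia.
Qed.

Lemma ref_and k Γ a b : NAnd a b \in Γ -> nsize (NAnd a b) <= M ->
  R k (a :: b :: Γ) -> R (k + 4) Γ.
Proof.
move=> h /= leM h1; have /permP e := perm_to_rem h.
apply: (@ref_cut _ _ _ (k + 2) 1 _ b); [lia | | | lia].
  apply: (@ref_cut _ _ _ k 1 _ a); [lia | exact: h1 | | lia].
  apply: (@ref_clash _ _ _ _ _ (b :: rem (NAnd a b) Γ) (clash_and1 _ a b)) => //.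
  by apply/permP=> x; rewrite /= e /=; lia.
apply: (@ref_clash _ _ _ _ _ (rem (NAnd a b) Γ) (clash_and2 _ a b)) => //.
by apply/permP=> x; rewrite /= e /=; lia.
Qed.

Lemma ref_axiom k Γ φ : φ \in axs -> nsize φ <= M -> R k (φ :: Γ) -> R (k + 2) Γ.
Proof.
move=> ax leM h; apply: (@ref_cut _ _ _ k 1 _ φ) => //; last by lia.
by apply: (@ref_clash _ _ _ _ _ Γ (clash_axiom ax)).
Qed.

Lemma ref_ors k Γ s : foldr (@NOr atom) NBot s \in Γ -> nsize (foldr (@NOr atom) NBot s) <= M ->
  (forall φ, φ \in s -> R k (φ :: Γ)) -> R ((k + 3) * size s + 1) Γ.
Proof.
elim: s Γ => [|φ s IHs] Γ h leM hs; first by apply: ref_le (ref_bot h); lia.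
apply: (@ref_le (k + ((k + 3) * size s + 1) + 3)); first by rewrite /=; lia.
apply: (ref_or h leM); first by apply: hs; apply: mem_head.
apply: IHs; first exact: mem_head.
  by move: leM => /=; lia.
by move=> ψ ψs; apply: ref_weak2; apply: hs; rewrite inE ψs orbT.
Qed.

Lemma ref_ands k Γ s φ : foldr (@NAnd atom) NTop s \in Γ ->
  nsize (foldr (@NAnd atom) NTop s) <= M -> φ \in s -> R k (φ :: Γ) -> R (k + 4 * size s) Γ.
Proof.
elim: s Γ => // ψ s IHs Γ h leM; rewrite inE => /orP[/eqP e|φs] hφ.
  rewrite e in hφ.
  apply: (@ref_le (k + 4)); first by rewrite /=; lia.
  by apply: (ref_and h leM); apply: ref_weak2.
apply: (@ref_le (k + 4 * size s + 4)); first by rewrite /=; lia.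
apply: (ref_and h leM); apply: (@ref_weak_perm _ (foldr (@NAnd atom) NTop s :: Γ) _ [:: ψ]).
  apply: IHs => //; first exact: mem_head.
    by move: leM => /=; lia.
  exact: ref_weak2.
by rewrite perm_catC.
Qed.

Lemma ref_false (V : eqType) (σ : V -> nnf atom) (v : V -> bool) Γ (ψ : nnf V) :
  nsubst σ ψ \in Γ -> nsize (nsubst σ ψ) <= M -> neval v ψ = false ->
  vars_in (fun x => (if v x then σ x else dual (σ x)) \in Γ) ψ ->
  R (4 * nsize ψ) Γ.
Proof.
elim: ψ Γ => [b x||| a IHa b IHb|a IHa b IHb] Γ /= h leM.
- move=> e h'; apply: (@ref_le 1) => //.
  move: h h' e {leM}; case: b; case: (v x) => //= h h' _; first exact: ref_pair h h'.
  exact: ref_pair h' h.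
- by [].
- by move=> _ _; apply: ref_le (ref_bot h).
- move=> e [va vb]; have leMa : nsize (nsubst σ a) <= M by lia.
  have leMb : nsize (nsubst σ b) <= M by lia.
  have sub c Δ : vars_in (fun x => (if v x then σ x else dual (σ x)) \in Γ) c ->
      vars_in (fun x => (if v x then σ x else dual (σ x)) \in Δ ++ Γ) c.
    by apply: vars_in_impl => x; rewrite mem_cat => ->; rewrite orbT.
  have [ea|ea] := boolP (neval v a); rewrite ?ea /= in e.
    apply: (@ref_le (4 * nsize b + 4)); first by lia.
    apply: (ref_and h); first by [].
    by apply: (IHb (_ :: _ :: Γ)); rewrite ?inE ?eqxx ?orbT //; apply: (sub b [:: _; _]).
  apply: (@ref_le (4 * nsize a + 4)); first by lia.
  apply: (ref_and h); first by [].
  by apply: (IHa (_ :: _ :: Γ)); rewrite ?inE ?eqxx ?orbT ?(negbTE ea) //; apply: (sub a [:: _; _]).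
- move=> /negbT; rewrite negb_or => /andP[/negbTE ea /negbTE eb] [va vb].
  have leMa : nsize (nsubst σ a) <= M by lia.
  have leMb : nsize (nsubst σ b) <= M by lia.
  have sub c φ : vars_in (fun x => (if v x then σ x else dual (σ x)) \in Γ) c ->
      vars_in (fun x => (if v x then σ x else dual (σ x)) \in φ :: Γ) c.
    by apply: vars_in_impl => x; rewrite inE => ->; rewrite orbT.
  apply: (@ref_le (4 * nsize a + 4 * nsize b + 3)); first by lia.
  apply: (ref_or h); first by [].
    by apply: IHa; rewrite ?mem_head //; apply: sub.
  by apply: IHb; rewrite ?mem_head //; apply: sub.
Qed.

(** The cuts are on the formulas [σ x], not on atoms: the cost is exponential only in the number of
    abstract variables, however large the formulas substituted for them. After all answers are
    given, some [ψ] is false and is taken apart down to a clash. *)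
Lemma ref_truth_table (V : eqType) (σ : V -> nnf atom) (vs : seq V) (ψs : seq (nnf V)) B Γ :
  0 < B ->
  (forall ψ : nnf V, ψ \in ψs -> [/\ nsubst σ ψ \in Γ, nsize (nsubst σ ψ) <= M, 4 * nsize ψ <= B
     & vars_in (fun x => x \in vs) ψ]) ->
  (forall x, x \in vs -> nsize (σ x) <= M) ->
  (forall v, has (fun ψ : nnf V => ~~ neval v ψ) ψs) ->
  R (2 ^ size vs * (B + 1)) Γ.
Proof.
move=> B0 hψ hσ unsat.
(* [ds] holds the variables already decided according to [v], [rs] those still to be decided; the
   [+ 1] in the bound pays for the cut at each node. *)
suff H (rs ds : seq V) (v : V -> bool) Δ : (forall x, x \in vs -> (x \in rs) || (x \in ds)) ->
    {subset rs <= vs} -> {subset Γ <= Δ} ->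
    (forall x, x \in ds -> (if v x then σ x else dual (σ x)) \in Δ) ->
    exists2 k, k + 1 <= 2 ^ size rs * (B + 1) & R k Δ.
  have [||||k lek h] // := H vs [::] (fun=> false) Γ; first by move=> x ->.
  by apply: ref_le h; lia.
elim: rs ds v Δ => [|x rs IHrs] ds v Δ cover srs sΓ hds.
  have /hasP[ψ ψs' e] := unsat v; have [h leM leB hv] := hψ ψ ψs'.
  exists B; first by rewrite expn0; lia.
  apply: ref_le leB _; apply: ref_false (sΓ _ h) leM (negbTE e) _.
  by apply: vars_in_impl hv => y /cover /=; apply: hds.
have upd (b : bool) : exists2 k, k + 1 <= 2 ^ size rs * (B + 1) & R k ((if b then σ x else dual (σ x)) :: Δ).
  apply: (IHrs (x :: ds) (fun y => if y == x then b else v y)).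
  - by move=> y /cover; rewrite !inE orbCA orbA.
  - by move=> y yrs; apply: srs; rewrite inE yrs orbT.
  - by move=> φ /sΓ φΔ; rewrite inE φΔ orbT.
  - move=> y; rewrite !inE; case: eqP => [->|_] /=; first by rewrite eqxx.
    by move=> /hds ->; rewrite orbT.
have [k1 le1 h1] := upd true; have [k2 le2 h2] := upd false.
exists (k1 + k2 + 1); first by rewrite /= expnS -mulnA; lia.
by apply: ref_cut (hσ x (srs x (mem_head _ _))) h1 h2 _; lia.
Qed.

End Refutations.

(** * Counting formulas *)

Lemma vars_inT V (P : V -> Prop) φ : (forall x, P x) -> vars_in P φ.
Proof. by move=> h; elim: φ => /=. Qed.

(** Shannon expansion of an arbitrary Boolean function of the variables [vs]; [acc] records the
    answers given so far and fixes the variables outside [vs]. *)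
Fixpoint decision (V : eqType) (vs : seq V) (f : (V -> bool) -> bool) (acc : V -> bool) : nnf V :=
  if vs is x :: vs' then
    NOr (NAnd (NLit true x) (decision vs' f (fun y => if y == x then true else acc y)))
        (NAnd (NLit false x) (decision vs' f (fun y => if y == x then false else acc y)))
  else if f acc then NTop else NBot.

Lemma neval_decision (V : eqType) (vs : seq V) f acc w :
  (forall v v', v =1 v' -> f v = f v') ->
  neval w (decision vs f acc) = f (fun y => if y \in vs then w y else acc y).
Proof.
move=> ext; elim: vs acc => [|x vs IHvs] acc /=; first by rewrite [in RHS](ext _ acc) //; case: (f acc).
rewrite !IHvs; case wx: (w x) => /=; rewrite ?orbF; apply: ext => y;
  by rewrite inE; case: eqP => [->|//]; rewrite wx; case: ifP.
Qed.

Lemma nsize_decision (V : eqType) (vs : seq V) f acc :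
  nsize (decision vs f acc) + 5 = 6 * 2 ^ size vs.
Proof.
elim: vs acc => [|x vs IHvs] acc /=; first by case: (f acc).
have := IHvs (fun y => if y == x then true else acc y).
by have := IHvs (fun y => if y == x then false else acc y); rewrite expnS; lia.
Qed.

Lemma vars_in_decision (V : eqType) (vs : seq V) f acc :
  vars_in (fun x => x \in vs) (decision vs f acc).
Proof.
elim: vs acc => [|x vs IHvs] acc /=; first by case: (f acc).
rewrite mem_head; do 2 split=> //; apply: vars_in_impl (IHvs _) => y; by rewrite inE => ->; rewrite orbT.
Qed.

Definition vec (V : Type) : Type := ((nat -> nnf V) * (nat -> nnf V))%type.

Definition nxor3 (V : Type) (x y z : nnf V) : nnf V :=
  NOr (NAnd x (NOr (NAnd y z) (NAnd (dual y) (dual z))))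
      (NAnd (dual x) (NOr (NAnd y (dual z)) (NAnd (dual y) z))).

Definition nmaj (V : Type) (x y z : nnf V) : nnf V :=
  NOr (NAnd x (NOr y z)) (NAnd y z).

(* Three numbers in binary are replaced by two with the same sum; the number
   represented by a [vec] is the sum of its two components. *)
Definition carry_save (V : Type) (a b c : nat -> nnf V) : vec V :=
  (fun i => nxor3 (a i) (b i) (c i),
   fun i => if i is j.+1 then nmaj (a j) (b j) (c j) else NBot).

Definition vec_add (V : Type) (p q : vec V) : vec V :=
  let st := carry_save p.1 p.2 q.1 in carry_save st.1 st.2 q.2.

(** The number of true formulas among [x o], ..., [x (o + 2 ^ d - 1)], summed along a balanced tree.
    [vec_add] is two carry-save layers without carry propagation, so formula sizes grow by a
    constant factor per level and remain polynomial at logarithmic depth. *)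
Fixpoint count_vec (V : Type) (d o : nat) (x : nat -> nnf V) : vec V :=
  if d is d'.+1 then vec_add (count_vec d' o x) (count_vec d' (o + 2 ^ d') x)
  else (fun i => if i is 0 then x o else NBot, fun=> NBot).

Definition vec_map (V V' : Type) (τ : V -> nnf V') (p : vec V) : vec V' :=
  (fun i => nsubst τ (p.1 i), fun i => nsubst τ (p.2 i)).

Definition vec_eq (V : Type) (p q : vec V) : Prop := p.1 =1 q.1 /\ p.2 =1 q.2.

Lemma carry_save_subst V V' (τ : V -> nnf V') a b c a' b' c' :
  (forall i, nsubst τ (a i) = a' i) -> (forall i, nsubst τ (b i) = b' i) ->
  (forall i, nsubst τ (c i) = c' i) ->
  vec_eq (vec_map τ (carry_save a b c)) (carry_save a' b' c').
Proof.
move=> ea eb ec; split=> -[|i] //=; rewrite /nxor3 /nmaj /= ?nsubst_dual ?ea ?eb ?ec //.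
Qed.

Lemma vec_add_subst V V' (τ : V -> nnf V') p q p' q' :
  vec_eq (vec_map τ p) p' -> vec_eq (vec_map τ q) q' ->
  vec_eq (vec_map τ (vec_add p q)) (vec_add p' q').
Proof.
move=> [p1 p2] [q1 q2]; have [s1 s2] := carry_save_subst p1 p2 q1.
exact: carry_save_subst s1 s2 q2.
Qed.

(** * Numbers of W bits, modulo 2^W *)

Section Width.

Variable W : nat.

Definition vec_val (a : nat -> bool) : nat := \sum_(i < W) a i * 2 ^ i.

Definition vec_eval (V : Type) (v : V -> bool) (p : vec V) : nat :=
  (vec_val (fun i => neval v (p.1 i)) + vec_val (fun i => neval v (p.2 i))) %% 2 ^ W.

Lemma carry_save_eval V (v : V -> bool) a b c :
  vec_eval v (carry_save a b c)
  = (vec_val (fun i => neval v (a i)) + vec_val (fun i => neval v (b i))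
     + vec_val (fun i => neval v (c i))) %% 2 ^ W.
Proof.
rewrite /vec_eval /vec_val.
(* With one more bit for the carries the identity is exact; dropping bit [W] then changes the sum by
   a multiple of [2 ^ W]. *)
have h N : \sum_(i < N) neval v ((carry_save a b c).1 i) * 2 ^ i
    + \sum_(i < N.+1) neval v ((carry_save a b c).2 i) * 2 ^ i
    = \sum_(i < N) neval v (a i) * 2 ^ i + \sum_(i < N) neval v (b i) * 2 ^ i
      + \sum_(i < N) neval v (c i) * 2 ^ i.
  elim: N => [|N IHN]; first by rewrite !big_ord0 big_ord_recr big_ord0.
  rewrite [\sum_(i < N.+2) _]big_ord_recr; move: IHN.
  set T := \sum_(i < N.+1) neval v ((carry_save a b c).2 i) * 2 ^ i.
  rewrite !big_ord_recr [nat_of_ord _]/= [nat_of_ord _]/= => IHN.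
  have e : neval v ((carry_save a b c).1 N) * 2 ^ N + neval v ((carry_save a b c).2 N.+1) * 2 ^ N.+1
     = neval v (a N) * 2 ^ N + neval v (b N) * 2 ^ N + neval v (c N) * 2 ^ N.
    rewrite expnS /= !neval_dual.
    by case: (neval v (a N)); case: (neval v (b N)); case: (neval v (c N)) => /=; lia.
  by move: IHN e; rewrite /=; lia.
by rewrite -(h W) big_ord_recr /= addnA [in RHS]addnC modnMDl.
Qed.

Lemma vec_add_eval V (v : V -> bool) p q :
  vec_eval v (vec_add p q) = (vec_eval v p + vec_eval v q) %% 2 ^ W.
Proof.
rewrite carry_save_eval -modnDml -/(vec_eval v (carry_save p.1 p.2 q.1)) carry_save_eval.
by rewrite modnDml -addnA modnDm.
Qed.

(* Variable [(k, i)] stands for bit [i] of number [k]. *)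
Definition bit_vars (k : nat) : seq (nat * nat) := [seq (q, i) | q <- iota 0 k, i <- iota 0 W].

Lemma mem_bit_vars k q i : ((q, i) \in bit_vars k) = (q < k) && (i < W).
Proof.
apply/allpairsP/andP => [[[a b] /=]|[ltq lti]].
  by rewrite !mem_iota => -[lta ltb [-> ->]].
by exists (q, i); rewrite !mem_iota.
Qed.

Lemma size_bit_vars k : size (bit_vars k) = k * W.
Proof. by rewrite size_allpairs !size_iota. Qed.

Definition bits_val (v : nat * nat -> bool) (q : nat) : nat :=
  (vec_val (fun i => v (q, i)) + vec_val (fun i => v (q.+1, i))) %% 2 ^ W.

(** Any relation whatever between two counters is expressible by brute force over their bits. A
    counter is a sum of two vectors, so there are [4 * W] bits: variables 0 and 1 for the first
    counter, 2 and 3 for the second. *)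
Definition rel_pattern (r : nat -> nat -> bool) : nnf (nat * nat) :=
  decision (bit_vars 4) (fun v => r (bits_val v 0) (bits_val v 2)) (fun=> false).

Lemma vec_val_ext a b : (forall i, i < W -> a i = b i) -> vec_val a = vec_val b.
Proof. by move=> e; apply: eq_bigr => i _; rewrite e. Qed.

Definition pair_bits (V : Type) (p p' : vec V) (x : nat * nat) : nnf V :=
  match x.1 with 0 => p.1 x.2 | 1 => p.2 x.2 | 2 => p'.1 x.2 | _ => p'.2 x.2 end.

Definition rel_formula (V : Type) (r : nat -> nat -> bool) (p p' : vec V) : nnf V :=
  nsubst (pair_bits p p') (rel_pattern r).

Lemma rel_formula_eval V r (p p' : vec V) v :
  neval v (rel_formula r p p') = r (vec_eval v p) (vec_eval v p').
Proof.
rewrite /rel_formula neval_subst /rel_pattern neval_decision; last first.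
  by move=> u u' e; rewrite /bits_val; congr (r (_ %% _) (_ %% _)); congr (_ + _);
    apply: vec_val_ext => i _; rewrite e.
by rewrite /bits_val /vec_eval; congr (r (_ %% _) (_ %% _)); congr (_ + _);
   apply: vec_val_ext => i lti; rewrite mem_bit_vars lti.
Qed.

Lemma rel_formula_subst V V' (τ : V -> nnf V') r p p' q q' :
  vec_eq (vec_map τ p) q -> vec_eq (vec_map τ p') q' ->
  nsubst τ (rel_formula r p p') = rel_formula r q q'.
Proof.
move=> [e1 e2] [e1' e2']; rewrite /rel_formula nsubst_comp; apply: nsubst_ext.
apply: vars_inT => -[k i]; rewrite /pair_bits /=.
by case: k => [|[|[|k]]]; [exact: e1|exact: e2|exact: e1'|exact: e2'].
Qed.

Definition vec_all (V : Type) (P : nnf V -> Prop) (p : vec V) : Prop :=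
  forall i, i < W -> P (p.1 i) /\ P (p.2 i).

Lemma rel_formula_vars V (P : V -> Prop) r p p' :
  vec_all (vars_in P) p -> vec_all (vars_in P) p' -> vars_in P (rel_formula r p p').
Proof.
move=> hp hp'; apply: vars_in_subst; apply: vars_in_impl (vars_in_decision _ _ _) => -[k i].
rewrite mem_bit_vars /pair_bits /= => /andP[_ lti].
by have [? ?] := hp i lti; have [? ?] := hp' i lti; case: k => [|[|[|k]]].
Qed.

Lemma rel_formula_size V B r (p p' : vec V) : 0 < B ->
  vec_all (fun φ => nsize φ <= B) p -> vec_all (fun φ => nsize φ <= B) p' ->
  nsize (rel_formula r p p') <= 6 * 2 ^ (4 * W) * B.
Proof.
move=> B0 hp hp'; apply: (@leq_trans (nsize (rel_pattern r) * B)); last first.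
  have := nsize_decision (bit_vars 4) (fun v => r (bits_val v 0) (bits_val v 2)) (fun=> false).
  by rewrite size_bit_vars => <-; rewrite leq_mul2r leq_addr orbT.
apply: nsize_subst => //; apply: vars_in_impl (vars_in_decision _ _ _) => -[k i].
rewrite mem_bit_vars /pair_bits /= => /andP[_ lti].
by have [? ?] := hp i lti; have [? ?] := hp' i lti; case: k => [|[|[|k]]].
Qed.

Lemma carry_save_vars V (P : V -> Prop) a b c :
  (forall i, i < W -> vars_in P (a i)) -> (forall i, i < W -> vars_in P (b i)) ->
  (forall i, i < W -> vars_in P (c i)) -> vec_all (vars_in P) (carry_save a b c).
Proof.
move=> ha hb hc i lti; split=> /=.
  by have := ha i lti; have := hb i lti; have := hc i lti; do ?split; do ?apply: vars_in_dual.
case: i lti => // j lt; have ltj := ltnW lt.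
by have := ha j ltj; have := hb j ltj; have := hc j ltj; do ?split.
Qed.

Lemma vec_add_vars V (P : V -> Prop) p q :
  vec_all (vars_in P) p -> vec_all (vars_in P) q -> vec_all (vars_in P) (vec_add p q).
Proof.
move=> hp hq; have h := carry_save_vars (fun i lti => (hp i lti).1) (fun i lti => (hp i lti).2)
  (fun i lti => (hq i lti).1).
exact: carry_save_vars (fun i lti => (h i lti).1) (fun i lti => (h i lti).2) (fun i lti => (hq i lti).2).
Qed.

Lemma carry_save_size V B (a b c : nat -> nnf V) : 0 < B ->
  (forall i, i < W -> nsize (a i) <= B) -> (forall i, i < W -> nsize (b i) <= B) ->
  (forall i, i < W -> nsize (c i) <= B) -> vec_all (fun φ => nsize φ <= 19 * B) (carry_save a b c).
Proof.
move=> B0 ha hb hc i lti; split=> /=.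
  by have := ha i lti; have := hb i lti; have := hc i lti; rewrite !nsize_dual; lia.
case: i lti => [|j] lt /=; first by lia.
by have ltj := ltnW lt; have := ha j ltj; have := hb j ltj; have := hc j ltj; lia.
Qed.

(** Each carry-save layer multiplies sizes by at most 19; the square 361 is rounded up to 512, a
    power of two. *)
Lemma vec_add_size V B (p q : vec V) : 0 < B ->
  vec_all (fun φ => nsize φ <= B) p -> vec_all (fun φ => nsize φ <= B) q ->
  vec_all (fun φ => nsize φ <= 512 * B) (vec_add p q).
Proof.
move=> B0 hp hq; have h := carry_save_size B0 (fun i lti => (hp i lti).1) (fun i lti => (hp i lti).2)
  (fun i lti => (hq i lti).1).
have B1 : 0 < 19 * B by lia.
have hq2 i : i < W -> nsize (q.2 i) <= 19 * B by move=> /hq[_ ?]; lia.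
have h' := carry_save_size B1 (fun i lti => (h i lti).1) (fun i lti => (h i lti).2) hq2.
by move=> i lti; have [h1 h2] := h' i lti; split; [apply: leq_trans h1 _ | apply: leq_trans h2 _]; lia.
Qed.

Lemma count_vec_size V B d o (x : nat -> nnf V) : 0 < B -> (forall i, nsize (x i) <= B) ->
  vec_all (fun φ => nsize φ <= 512 ^ d * B) (count_vec d o x).
Proof.
move=> B0 hx; elim: d o => [|d IHd] o.
  by move=> i _; rewrite mul1n /=; split=> //; case: i => /=.
by rewrite expnS -mulnA; apply: vec_add_size; rewrite ?muln_gt0 ?expn_gt0.
Qed.

End Width.

Lemma mem_map_In (T : Type) (U : eqType) (f : T -> U) s y :
  y \in map f s -> exists2 x, List.In x s & y = f x.
Proof.
elim: s => //= x s IHs; rewrite inE => /orP[/eqP->|/IHs[z]]; first by exists x; [left|].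
by exists z; [right|].
Qed.

Lemma In_mem_map (T : Type) (U : eqType) (f : T -> U) s x : List.In x s -> f x \in map f s.
Proof. by elim: s => //= y s IHs [->|/IHs]; rewrite inE ?eqxx // => ->; rewrite orbT. Qed.

(** * Local refutations about counters *)

Section Counting.

Variables (axs : seq (nnf atom)) (M W B : nat).
Hypotheses (B_gt0 : 0 < B) (W_gt0 : 0 < W).
Notation R := (refutation axs M).

(** The largest table ranges over four counters of two [W]-bit vectors each, hence [8 * W]
    variables. The second factor is the cost of refuting one false relation whose bits have size at
    most 512, as after one addition of single literals. *)
Definition table_cost := 2 ^ (8 * W) * (4 * (6 * 2 ^ (4 * W) * 512) + 1).

Definition bits (q : nat) : nat -> nnf (nat * nat) := fun i => NLit true (q, i).

Lemma bits_vars k q q' : q < k -> q' < k ->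
  vec_all W (vars_in (fun x => x \in bit_vars W k)) (bits q, bits q').
Proof. by move=> ltq ltq' i lti; rewrite /= !mem_bit_vars ltq ltq' lti. Qed.

(** One node of the counting tree: relations between the counters of the two subtrees imply the
    relation between their sums. The bits of the four summands are abstracted to variables by [τ],
    so the table is independent of how deep the formulas are. *)
Lemma ref_sum (r rL rR : nat -> nat -> bool) (p q p' q' : vec atom) Γ :
  6 * 2 ^ (4 * W) * (512 * B) <= M ->
  vec_all W (fun φ => nsize φ <= B) p -> vec_all W (fun φ => nsize φ <= B) q ->
  vec_all W (fun φ => nsize φ <= B) p' -> vec_all W (fun φ => nsize φ <= B) q' ->
  (forall a a' b b', rL a a' -> rR b b' -> r ((a + b) %% 2 ^ W) ((a' + b') %% 2 ^ W)) ->
  rel_formula W rL p p' \in Γ -> rel_formula W rR q q' \in Γ ->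
  dual (rel_formula W r (vec_add p q) (vec_add p' q')) \in Γ ->
  R table_cost Γ.
Proof.
move=> leM sp sq sp' sq' add hL hR h.
pose τ (x : nat * nat) : nnf atom := match x.1 with
  | 0 => p.1 x.2 | 1 => p.2 x.2 | 2 => q.1 x.2 | 3 => q.2 x.2
  | 4 => p'.1 x.2 | 5 => p'.2 x.2 | 6 => q'.1 x.2 | _ => q'.2 x.2 end.
pose y0 := (bits 0, bits 1); pose y2 := (bits 2, bits 3).
pose y4 := (bits 4, bits 5); pose y6 := (bits 6, bits 7).
have e0 : vec_eq (vec_map τ y0) p by [].
have e2 : vec_eq (vec_map τ y2) q by [].
have e4 : vec_eq (vec_map τ y4) p' by [].
have e6 : vec_eq (vec_map τ y6) q' by [].
have X0 : 0 < 6 * 2 ^ (4 * W) by rewrite muln_gt0 expn_gt0.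
have v0 : vec_all W (vars_in (fun x => x \in bit_vars W 8)) y0 by apply: bits_vars.
have v2 : vec_all W (vars_in (fun x => x \in bit_vars W 8)) y2 by apply: bits_vars.
have v4 : vec_all W (vars_in (fun x => x \in bit_vars W 8)) y4 by apply: bits_vars.
have v6 : vec_all W (vars_in (fun x => x \in bit_vars W 8)) y6 by apply: bits_vars.
have leM' : 6 * 2 ^ (4 * W) * B <= M.
  by apply: leq_trans leM; rewrite leq_mul2l leq_pmull ?orbT.
rewrite /table_cost -(size_bit_vars W 8).
pose ψs := [:: rel_formula W rL y0 y4; rel_formula W rR y2 y6;
    dual (rel_formula W r (vec_add y0 y2) (vec_add y4 y6))].
apply: (@ref_truth_table axs M _ τ (bit_vars W 8) ψs).
- by rewrite muln_gt0 muln_gt0 X0.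
- move=> ψ; rewrite !inE => /or3P[]/eqP->.
  + rewrite (rel_formula_subst _ _ e0 e4); split=> //.
    * by apply: leq_trans leM'; apply: rel_formula_size.
    * by rewrite leq_mul2l; apply: leq_trans (rel_formula_size _ (isT : 0 < 512) _ _) _.
    * exact: rel_formula_vars.
  + rewrite (rel_formula_subst _ _ e2 e6); split=> //.
    * by apply: leq_trans leM'; apply: rel_formula_size.
    * by rewrite leq_mul2l; apply: leq_trans (rel_formula_size _ (isT : 0 < 512) _ _) _.
    * exact: rel_formula_vars.
  + rewrite nsubst_dual (rel_formula_subst _ _ (vec_add_subst e0 e2) (vec_add_subst e4 e6)).
    rewrite !nsize_dual; split=> //.
    * apply: leq_trans leM; apply: rel_formula_size; first by rewrite muln_gt0.
        exact: vec_add_size.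
      exact: vec_add_size.
    * rewrite leq_mul2l; apply: rel_formula_size => //; rewrite -[512]muln1; exact: vec_add_size.
    * by apply: vars_in_dual; apply: rel_formula_vars; apply: vec_add_vars.
- move=> -[k i]; rewrite mem_bit_vars => /andP[_ lti]; apply: (@leq_trans B).
    have [? ?] := sp i lti; have [? ?] := sq i lti; have [? ?] := sp' i lti; have [? ?] := sq' i lti.
    by rewrite /τ /=; case: k => [|[|[|[|[|[|[|k]]]]]]].
  by apply: leq_trans leM'; rewrite leq_pmull.
- move=> v; rewrite /= neval_dual !rel_formula_eval !vec_add_eval negbK orbF.
  have [aL|//] := boolP (rL _ _); have [aR|//] := boolP (rR _ _).
  exact: add.
Qed.

(* An item [(b, i, i', r)] asserts (or denies) the relation [r] between two of
   the numbers [p], [q]. *)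
Definition item_formula (V : Type) (p q : vec V) (it : bool * (bool * bool) * (nat -> nat -> bool)) : nnf V :=
  let pick (i : bool) := if i then q else p in
  let φ := rel_formula W it.2 (pick it.1.2.1) (pick it.1.2.2) in
  if it.1.1 then φ else dual φ.

Lemma ref_items (p q : vec atom) items Γ :
  6 * 2 ^ (4 * W) * B <= M ->
  vec_all W (fun φ => nsize φ <= B) p -> vec_all W (fun φ => nsize φ <= B) q ->
  (forall c c' : nat, has (fun it : bool * (bool * bool) * (nat -> nat -> bool) =>
     it.2 (if it.1.2.1 then c' else c) (if it.1.2.2 then c' else c) != it.1.1) items) ->
  {subset [seq item_formula p q it | it <- items] <= Γ} -> R table_cost Γ.
Proof.
move=> leM sp sq unsat sub.
pose y0 := (bits 0, bits 1); pose y2 := (bits 2, bits 3).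
have e0 : vec_eq (vec_map (pair_bits p q) y0) p by [].
have e2 : vec_eq (vec_map (pair_bits p q) y2) q by [].
have X0 : 0 < 6 * 2 ^ (4 * W) by rewrite muln_gt0 expn_gt0.
have v0 : vec_all W (vars_in (fun x => x \in bit_vars W 4)) y0 by apply: bits_vars.
have v2 : vec_all W (vars_in (fun x => x \in bit_vars W 4)) y2 by apply: bits_vars.
apply: (@ref_le _ _ (2 ^ size (bit_vars W 4) * (4 * (6 * 2 ^ (4 * W) * 512) + 1))).
  by rewrite /table_cost size_bit_vars leq_mul2r leq_exp2l // leq_mul2r orbT orbT.
apply: (@ref_truth_table axs M _ (pair_bits p q) (bit_vars W 4) (map (item_formula y0 y2) items)).
- by rewrite muln_gt0 muln_gt0 X0.
- move=> ψ /mem_map_In[[[b [i i']] r] it ->].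
  have e : nsubst (pair_bits p q) (item_formula y0 y2 (b, (i, i'), r)) = item_formula p q (b, (i, i'), r).
    rewrite /item_formula /=; case: b {it}; rewrite ?nsubst_dual;
    [|congr dual]; by case: i; case: i'; apply: rel_formula_subst.
  rewrite e; split.
  + by apply: sub; apply: In_mem_map.
  + rewrite /item_formula /=; case: (b); rewrite ?nsize_dual; apply: leq_trans leM;
    by apply: rel_formula_size => //; [case: (i)|case: (i')].
  + rewrite leq_mul2l /= /item_formula /=; case: (b); rewrite ?nsize_dual;
    by apply: rel_formula_size => //; [case: (i)|case: (i')].
  + rewrite /item_formula /=; case: (b); [|apply: vars_in_dual];
    by apply: rel_formula_vars; [case: (i)|case: (i')].
- move=> -[k i]; rewrite mem_bit_vars => /andP[_ lti]; apply: (@leq_trans B).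
    have [? ?] := sp i lti; have [? ?] := sq i lti.
    by rewrite /pair_bits /=; case: k => [|[|[|k]]].
  by apply: leq_trans leM; rewrite leq_pmull.
- move=> v; rewrite has_map; have := unsat (vec_eval W v y0) (vec_eval W v y2).
  apply: sub_has => -[[b [i i']] r] /=; rewrite /item_formula /=.
  by case: b; rewrite ?neval_dual rel_formula_eval; case: i; case: i'; case: (r _ _).
Qed.

Definition leaf_vec (V : Type) (φ : nnf V) : vec V :=
  (fun i => if i is 0 then φ else NBot, fun=> NBot).

Lemma leaf_vec_eval V (v : V -> bool) φ : vec_eval W v (leaf_vec φ) = neval v φ.
Proof.
rewrite /vec_eval /vec_val; case: W W_gt0 => // w _; rewrite big_ord_recl big1; last by move=> i _.
rewrite big1; last by move=> i _.
by rewrite /= muln1 !addn0 modn_small //; case: (neval v φ); rewrite ?expn_gt0 // expnS; have := expn_gt0 2 w; lia.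
Qed.

(** The counterpart of [ref_sum] at a leaf of the counting tree, where the compared bits [φ] and
    [φ'] are built from two formulas [σ true] and [σ false] and the side facts [ψs] fix the values
    of these. *)
Lemma ref_leaf (σ : bool -> nnf atom) (r : nat -> nat -> bool) (φ φ' : nnf bool) ψs Γ :
  6 * 2 ^ (4 * W) * B <= M -> (forall b, 3 * nsize (σ b) <= B) ->
  nsize φ <= 3 -> nsize φ' <= 3 -> all (fun ψ => nsize ψ <= 1) ψs ->
  (forall v, all (neval v) ψs -> r (neval v φ) (neval v φ')) ->
  dual (rel_formula W r (leaf_vec (nsubst σ φ)) (leaf_vec (nsubst σ φ'))) \in Γ ->
  {subset map (nsubst σ) ψs <= Γ} -> R table_cost Γ.
Proof.
move=> leM sσ lφ lφ' lψ unsat h sub.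
have X0 : 0 < 6 * 2 ^ (4 * W) by rewrite muln_gt0 expn_gt0.
have leBM : B <= M by apply: leq_trans leM; rewrite leq_pmull.
apply: (@ref_le _ _ (2 ^ size [:: true; false] * (4 * (6 * 2 ^ (4 * W) * 512) + 1))).
  by rewrite /table_cost leq_mul2r leq_exp2l //=; apply/orP; right; lia.
have eleaf χ : vec_eq (vec_map σ (leaf_vec χ)) (leaf_vec (nsubst σ χ)).
  by split=> // -[|i].
have szs χ : nsize χ <= 3 -> nsize (nsubst σ χ) <= B.
  move=> le; have b0 : 0 < maxn (nsize (σ true)) (nsize (σ false)).
    by rewrite leq_max nsize_gt0.
  apply: leq_trans (nsize_subst b0 _) _.
    by apply: vars_inT => -[]; rewrite leq_max leqnn ?orbT.
  apply: (@leq_trans (3 * maxn (nsize (σ true)) (nsize (σ false)))); first by rewrite leq_mul2r le orbT.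
  by rewrite /maxn; case: ifP => _; apply: sσ.
have szl χ : nsize χ <= 3 -> vec_all W (fun φ => nsize φ <= B) (leaf_vec (nsubst σ χ)).
  by move=> le [|i] _ /=; split=> //; apply: szs.
have szl3 (χ : nnf bool) : nsize χ <= 3 -> vec_all W (fun φ => nsize φ <= 512) (leaf_vec χ).
  by move=> le [|i] _ /=; split=> //; apply: leq_trans le _.
have vT (ψ : nnf bool) : vars_in (fun x => x \in [:: true; false]) ψ.
  by apply: vars_inT => -[].
apply: (@ref_truth_table axs M _ σ [:: true; false]
   (dual (rel_formula W r (leaf_vec φ) (leaf_vec φ')) :: ψs)).
- by rewrite muln_gt0 muln_gt0 X0.
- move=> ψ; rewrite inE => /orP[/eqP->|ψψs].
    rewrite nsubst_dual (rel_formula_subst _ _ (eleaf φ) (eleaf φ')) !nsize_dual; split=> //.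
      by apply: leq_trans leM; apply: rel_formula_size => //; apply: szl.
    by rewrite leq_mul2l; apply: rel_formula_size => //; apply: szl3.
  have l1 : nsize ψ <= 1 by apply: (allP lψ).
  split=> //.
  + by apply: sub; apply: map_f.
  + by apply: leq_trans leBM; apply: szs; apply: leq_trans l1 _.
  + by rewrite leq_mul2l /=; apply: leq_trans l1 _; rewrite muln_gt0 X0.
- by move=> b _; have := sσ b; have := nsize_gt0 (σ b); lia.
- move=> v; rewrite /= neval_dual negbK rel_formula_eval !leaf_vec_eval.
  rewrite has_predC; have [/unsat ->//|_] := boolP (all (neval v) ψs); exact: orbT.
Qed.

(** Induction over the counting tree with a relation [r d o] for the subtree of height [d] at offset
    [o]. If [r] is additive along the tree and its failure is refutable at every leaf, its failure
    is refutable at the root: cut on the two subtrees and close with [ref_sum]. *)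
Lemma ref_count (r : nat -> nat -> nat -> nat -> bool) (x x' : nat -> nnf atom) X k Γ D :
  0 < X -> 512 ^ D * X <= B -> 6 * 2 ^ (4 * W) * (512 * B) <= M ->
  (forall i, nsize (x i) <= X) -> (forall i, nsize (x' i) <= X) ->
  (forall d o a a' b b', r d o a a' -> r d (o + 2 ^ d) b b' ->
     r d.+1 o ((a + b) %% 2 ^ W) ((a' + b') %% 2 ^ W)) ->
  (forall o, o < 2 ^ D ->
     R k (dual (rel_formula W (r 0 o) (leaf_vec (x o)) (leaf_vec (x' o))) :: Γ)) ->
  R (2 ^ D * (k + table_cost + 4))
    (dual (rel_formula W (r D 0) (count_vec D 0 x) (count_vec D 0 x')) :: Γ).
Proof.
move=> X0 leB leM sx sx' add leaf.
suff H d o : d <= D -> o + 2 ^ d <= 2 ^ D -> exists2 k',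
    k' + (table_cost + 4) <= 2 ^ d * (k + table_cost + 4)
    & R k' (dual (rel_formula W (r d o) (count_vec d o x) (count_vec d o x')) :: Γ).
  by have [//|//|k' le h] := H D 0; apply: ref_le h; lia.
elim: d o => [|d IHd] o led leo.
  by exists k; [lia | apply: leaf; move: leo; rewrite expn0; lia].
rewrite expnS in leo; have le1 : o + 2 ^ d <= 2 ^ D by lia.
have le2 : o + 2 ^ d + 2 ^ d <= 2 ^ D by lia.
have [k1 lek1 h1] := IHd o (ltnW led) le1.
have [k2 lek2 h2] := IHd (o + 2 ^ d) (ltnW led) le2.
have sB (z : nat -> nnf atom) o' : (forall i, nsize (z i) <= X) ->
    vec_all W (fun φ => nsize φ <= B) (count_vec d o' z).
  move=> sz i lti; have [s1 s2] := @count_vec_size W _ X d o' z X0 sz i lti.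
  have leX : 512 ^ d * X <= B.
    by apply: leq_trans leB; rewrite leq_mul2r leq_exp2l // (ltnW led) orbT.
  by split; [apply: leq_trans s1 _ | apply: leq_trans s2 _].
have leM1 : 6 * 2 ^ (4 * W) * B <= M.
  by apply: leq_trans leM; rewrite leq_mul2l leq_pmull ?orbT.
set φ := rel_formula W (r d.+1 o) _ _.
set φ1 := rel_formula W (r d o) (count_vec d o x) (count_vec d o x') in h1.
set φ2 := rel_formula W (r d (o + 2 ^ d)) (count_vec d (o + 2 ^ d) x) (count_vec d (o + 2 ^ d) x') in h2.
exists (k1 + k2 + table_cost + 4); first by rewrite expnS -mulnA; lia.
apply: (@ref_cut _ _ _ (k2 + table_cost + 1) k1 _ φ1); last by lia.
- by apply: leq_trans leM1; apply: rel_formula_size => //; apply: sB.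
- apply: (@ref_cut _ _ _ table_cost k2 _ φ2); last by lia.
  + by apply: leq_trans leM1; apply: rel_formula_size => //; apply: sB.
  + apply: (@ref_sum (r d.+1 o) (r d o) (r d (o + 2 ^ d)) (count_vec d o x) (count_vec d (o + 2 ^ d) x)
      (count_vec d o x') (count_vec d (o + 2 ^ d) x')) => //; try exact: sB.
    * exact: add.
    * by rewrite !inE eqxx orbT.
    * by rewrite !inE eqxx.
    * by rewrite !inE eqxx !orbT.
  + by apply: ref_weak2; apply: ref_weak2.
- exact: ref_weak2.
Qed.

End Counting.

(** * The pigeonhole principle *)

Section Pigeonhole.

Variables (n D W : nat).
Let m := Nat.sqrt n.
Hypotheses (n_gt0 : 0 < n) (le_mD : m <= 2 ^ D) (lt_mW : m.+1 < 2 ^ W).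

(** The three constants bound one [occupied] formula, one counter bit after [D] levels (the factor 3
    is the slack demanded by [ref_leaf]), and a relation between two sums of counters, the largest
    formula occurring. *)
Definition hole_size := (m + 1) * (4 * n + 2) + 1.
Definition bit_size := 512 ^ D * (3 * hole_size).
Definition max_size := 6 * 2 ^ (4 * W) * (512 * bit_size).

Notation R := (refutation (php_axioms n) max_size).
Implicit Types (Γ : seq (nnf atom)) (u i a : nat).

Let le_mn : m <= n.
Proof. by rewrite /m; have := Nat.sqrt_le_lin n; lia. Qed.

Let W_gt0 : 0 < W.
Proof. by case: W lt_mW => //; rewrite expn0. Qed.

Let hole_bit : 3 * hole_size <= bit_size.
Proof. by rewrite /bit_size leq_pmull // expn_gt0. Qed.

Let bit_max : 6 * 2 ^ (4 * W) * bit_size <= max_size.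
Proof. by rewrite /max_size leq_mul2l leq_pmull ?orbT. Qed.

Let bit_gt0 : 0 < bit_size.
Proof. by apply: leq_trans hole_bit; rewrite /hole_size; lia. Qed.

Let hole_max : 3 * hole_size <= max_size.
Proof.
apply: leq_trans hole_bit _; apply: leq_trans bit_max.
by rewrite leq_pmull // muln_gt0 expn_gt0.
Qed.

(* Pigeon [u] is in hole [a]: the [u]-th vertex of the clique has colour [a]. *)
Definition in_hole u a : nnf atom :=
  if a < m then
    foldr (@NOr atom) NBot [seq NAnd (NLit true (Rvar u i)) (NLit true (Svar i a)) | i <- iota 0 n]
  else NBot.

Fixpoint occupied j a : nnf atom :=
  if j is j'.+1 then NOr (occupied j' a) (in_hole j' a) else NBot.

Lemma in_hole_size u a : nsize (in_hole u a) <= 4 * n + 1.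
Proof.
rewrite /in_hole; case: ifP => _; last by rewrite addn1.
rewrite -[X in 4 * X](size_iota 0 n); elim: (iota 0 n) => //= i s IHs.
by rewrite mulnS !addSn !ltnS.
Qed.

Lemma occupied_size j a : j <= m.+1 -> nsize (occupied j a) <= hole_size.
Proof.
move=> lej; have H : nsize (occupied j a) <= j * (4 * n + 2) + 1.
  by elim: j {lej} => //= j IHj; have := in_hole_size j a; rewrite (mulSn j); lia.
apply: leq_trans H _; rewrite /hole_size leq_add2r leq_mul2r addn1 lej orbT //.
Qed.

Let in_hole_max u a : nsize (in_hole u a) <= max_size.
Proof.
by apply: leq_trans (in_hole_size u a) _; apply: leq_trans hole_max; rewrite /hole_size; nia.
Qed.

Let small_max k : k <= 2 * n + 7 -> k <= max_size.
Proof. by move=> le; apply: leq_trans le _; apply: leq_trans hole_max; rewrite /hole_size; nia. Qed.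

Lemma clause_nnfE c : clause_nnf c = foldr (@NOr atom) NBot [seq NLit l.1 l.2 | l <- c].
Proof. by elim: c => //= l c ->. Qed.

Lemma clause_max (c : seq literal) :
  c \in clique_clauses n m.+1 ++ color_clauses n m -> nsize (clause_nnf c) <= max_size.
Proof.
by move=> /(clause_small n_gt0)/andP[le _]; apply: small_max; rewrite nsize_clause; lia.
Qed.

Lemma ref_clause (c : seq literal) k Γ : c \in clique_clauses n m.+1 ++ color_clauses n m ->
  (forall l, l \in c -> R k (NLit l.1 l.2 :: clause_nnf c :: Γ)) ->
  R ((k + 3) * size c + 3) Γ.
Proof.
move=> cC h; apply: (@ref_le _ _ ((k + 3) * size c + 1 + 2)); first by lia.
apply: (@ref_axiom _ _ _ _ (clause_nnf c)); [exact: map_f | exact: clause_max |].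
rewrite -(size_map (fun l => NLit l.1 l.2)); apply: ref_ors.
- by rewrite -clause_nnfE mem_head.
- by rewrite -clause_nnfE; apply: clause_max.
by move=> φ /mapP[l lc ->]; apply: h.
Qed.

Lemma ref_falsified_clause (c : seq literal) Γ : c \in clique_clauses n m.+1 ++ color_clauses n m ->
  all (fun l : literal => NLit (~~ l.1) l.2 \in Γ) c -> R (4 * size c + 3) Γ.
Proof.
move=> cC h; apply: (@ref_clause c 1) => // l lc.
apply: (@ref_pair _ _ _ (NLit l.1 l.2)); first exact: mem_head.
by rewrite !inE (allP h l lc) !orbT.
Qed.

Lemma clique_clause_functional u i j : u <= m -> i != j -> i < n -> j < n ->
  [:: (false, Rvar u i); (false, Rvar u j)] \in clique_clauses n m.+1.
Proof.
move=> leu nij lti ltj; rewrite mem_cat [X in _ || X]mem_cat; apply/orP; right; apply/orP; left.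
by apply/allpairsP; exists (u, (i, j)); rewrite mem_iota mem_distinct_pairs /= nij lti ltj.
Qed.

Lemma clique_clause_injective u v i : u != v -> u <= m -> v <= m -> i < n ->
  [:: (false, Rvar u i); (false, Rvar v i)] \in clique_clauses n m.+1.
Proof.
move=> nuv leu lev lti; rewrite mem_cat [X in _ || X]mem_cat [X in _ || (_ || X)]mem_cat.
apply/orP; right; apply/orP; right; apply/orP; left.
by apply/allpairsP; exists ((u, v), i); rewrite mem_iota mem_distinct_pairs /= nuv !ltnS leu lev.
Qed.

Lemma clique_clause_edge u v i j : u != v -> u <= m -> v <= m -> i < j < n ->
  [:: (false, Rvar u i); (false, Rvar v j); (true, Avar i j)] \in clique_clauses n m.+1.
Proof.
move=> nuv leu lev ltij; rewrite mem_cat [X in _ || X]mem_cat [X in _ || (_ || X)]mem_cat.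
apply/orP; right; apply/orP; right; apply/orP; right.
apply/allpairsP; exists ((u, v), (i, j)).
by rewrite mem_increasing_pairs mem_distinct_pairs /= nuv !ltnS leu lev.
Qed.

Lemma color_clause_functional i a b : i < n -> a != b -> a < m -> b < m ->
  [:: (false, Svar i a); (false, Svar i b)] \in color_clauses n m.
Proof.
move=> lti nab lta ltb; rewrite mem_cat [X in _ || X]mem_cat; apply/orP; right; apply/orP; left.
by apply/allpairsP; exists (i, (a, b)); rewrite mem_iota mem_distinct_pairs /= nab lta ltb.
Qed.

Lemma color_clause_edge a i j : a < m -> i < j < n ->
  [:: (false, Svar i a); (false, Svar j a); (false, Avar i j)] \in color_clauses n m.
Proof.
move=> lta ltij; rewrite mem_cat [X in _ || X]mem_cat; apply/orP; right; apply/orP; right.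
by apply/allpairsP; exists (a, (i, j)); rewrite mem_iota mem_increasing_pairs.
Qed.

(** After a cut on the edge atom, its presence violates a clause of Color_n and its absence a clause
    of Clique_n. *)
Lemma ref_same_color u v i j a Γ : u != v -> u <= m -> v <= m -> i < j < n -> a < m ->
  NLit true (Rvar u i) \in Γ -> NLit true (Svar i a) \in Γ ->
  NLit true (Rvar v j) \in Γ -> NLit true (Svar j a) \in Γ -> R 31 Γ.
Proof.
move=> nuv leu lev ltij lta ru si rv sj.
apply: (@ref_cut _ _ _ 15 15 _ (NLit true (Avar i j))) => //; first by apply: small_max => /=; lia.
  apply: (@ref_falsified_clause [:: (false, Svar i a); (false, Svar j a); (false, Avar i j)]).
    by rewrite mem_cat color_clause_edge ?orbT.
  by rewrite /= !inE si sj eqxx !orbT.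
apply: (@ref_falsified_clause [:: (false, Rvar u i); (false, Rvar v j); (true, Avar i j)]).
  by rewrite mem_cat clique_clause_edge.
by rewrite /= !inE ru rv eqxx !orbT.
Qed.

Definition hole_cost := 50 * (n + 1) ^ 2.

Lemma ref_two_holes u v a b Γ :
  (forall i j Δ, i < n -> j < n -> a < m -> b < m ->
    NLit true (Rvar u i) \in Δ -> NLit true (Svar i a) \in Δ ->
    NLit true (Rvar v j) \in Δ -> NLit true (Svar j b) \in Δ -> R 31 Δ) ->
  in_hole u a \in Γ -> in_hole v b \in Γ -> R hole_cost Γ.
Proof.
move=> h ha hb; have c0 : 1 <= hole_cost by rewrite muln_gt0 expn_gt0 addn1.
have [lta|lea] := ltnP a m; last first.
  by apply: ref_le c0 (ref_bot _ _ _); move: ha; rewrite /in_hole ltnNge lea.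
have [ltb|leb] := ltnP b m; last first.
  by apply: ref_le c0 (ref_bot _ _ _); move: hb; rewrite /in_hole ltnNge leb.
have ma := in_hole_max u a; have mb := in_hole_max v b.
rewrite /in_hole lta in ha ma; rewrite /in_hole ltb in hb mb.
apply: (@ref_le _ _ (((38 * n + 1 + 4) + 3)
    * size [seq NAnd (NLit true (Rvar u i)) (NLit true (Svar i a)) | i <- iota 0 n] + 1)).
  by rewrite size_map size_iota /hole_cost expnS expn1; nia.
apply: ref_ors => // φ /mapP[i]; rewrite mem_iota /= add0n => lti ->.
apply: ref_and; [exact: mem_head | by apply: small_max => /=; lia |].
apply: (@ref_le _ _ ((31 + 4 + 3)
    * size [seq NAnd (NLit true (Rvar v j)) (NLit true (Svar j b)) | j <- iota 0 n] + 1)).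
  by rewrite size_map size_iota.
apply: ref_ors => //; first by rewrite !inE hb !orbT.
move=> φ' /mapP[j]; rewrite mem_iota /= add0n => ltj ->.
apply: ref_and; [exact: mem_head | by apply: small_max => /=; lia |].
by apply: (h i j) => //; rewrite !inE eqxx ?orbT.
Qed.

(** Two clique indices at one vertex violate Clique_n; at two vertices of the same colour, the edge
    between them decides. *)
Lemma ref_injective u v a Γ : u != v -> u <= m -> v <= m ->
  in_hole u a \in Γ -> in_hole v a \in Γ -> R hole_cost Γ.
Proof.
move=> nuv leu lev; apply: ref_two_holes => i j Δ lti ltj lta _ ru si rv sj.
have [ltij|ltji|eij] := ltngtP i j.
- by apply: (ref_same_color nuv leu lev _ lta ru si rv sj); rewrite ltij.
- by apply: (@ref_same_color v u j i a) => //; [rewrite eq_sym | rewrite ltji].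
apply: (@ref_le _ _ 11) => //.
apply: (@ref_falsified_clause [:: (false, Rvar u i); (false, Rvar v i)]).
  by rewrite mem_cat clique_clause_injective.
by rewrite /= ru {1}eij rv.
Qed.

(** Both formulas contribute: a vertex with two colours violates Color_n, a clique index with two
    vertices violates Clique_n. *)
Lemma ref_functional u a b Γ : a != b -> u <= m ->
  in_hole u a \in Γ -> in_hole u b \in Γ -> R hole_cost Γ.
Proof.
move=> nab leu; apply: ref_two_holes => i j Δ lti ltj lta ltb ru si rv sj.
apply: (@ref_le _ _ 11) => //; have [eij|nij] := eqVneq i j.
  apply: (@ref_falsified_clause [:: (false, Svar i a); (false, Svar i b)]).
    by rewrite mem_cat color_clause_functional ?orbT.
  by rewrite /= si {1}eij sj.
apply: (@ref_falsified_clause [:: (false, Rvar u i); (false, Rvar u j)]).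
  by rewrite mem_cat clique_clause_functional.
by rewrite /= ru rv.
Qed.

Lemma dual_ors (s : seq (nnf atom)) :
  dual (foldr (@NOr atom) NBot s) = foldr (@NAnd atom) NTop (map (@dual atom) s).
Proof. by elim: s => //= φ s ->. Qed.

(** Branch first on the vertex with index [u], then on the colour of that vertex; the vertex is a
    witness for [in_hole u a]. *)
Lemma ref_total u k Γ : u <= m -> (forall a, a < m -> R k (in_hole u a :: Γ)) ->
  R ((k + 4 * n + 20) * (m + 1) * (n + 1)) Γ.
Proof.
move=> leu h.
pose c1 := [seq (true, Rvar u i) | i <- iota 0 n].
have c1C : c1 \in clique_clauses n m.+1 ++ color_clauses n m.
  by rewrite !mem_cat; apply/orP; left; apply/orP; left; apply/mapP; exists u; rewrite // mem_iota.
apply: (@ref_le _ _ (((k + 4 * n + 6 + 3) * m + 3 + 3) * size c1 + 3)).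
  by rewrite size_map size_iota; nia.
apply: ref_clause => // l /mapP[i]; rewrite mem_iota /= => lti ->.
pose c2 := [seq (true, Svar i a) | a <- iota 0 m].
have c2C : c2 \in clique_clauses n m.+1 ++ color_clauses n m.
  rewrite !mem_cat; apply/orP; right; apply/orP; left; apply/mapP; exists i; rewrite // mem_iota //.
have e2 : m = size c2 by rewrite size_map size_iota.
apply: (@ref_le _ _ ((k + 4 * n + 6 + 3) * size c2 + 3)); first by rewrite -e2.
apply: ref_clause => // l' /mapP[a]; rewrite mem_iota /= => lta ->.
apply: (@ref_cut _ _ _ k (5 + 4 * n) _ (in_hole u a)) => //; last by lia.
  apply: (@ref_weak_perm _ _ _ (in_hole u a :: Γ) _ [:: NLit true (Svar i a); clause_nnf c2; NLit true (Rvar u i); clause_nnf c1]).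
    exact: h.
  by rewrite /= perm_cons perm_catC.
have := in_hole_max u a; rewrite -nsize_dual /in_hole lta dual_ors => leM.
set s := map _ _ in leM *.
apply: (@ref_le _ _ (5 + 4 * size s)); first by rewrite !size_map size_iota.
apply: (@ref_ands _ _ _ _ _ (NOr (NLit false (Rvar u i)) (NLit false (Svar i a)))) => //.
- exact: mem_head.
- apply/mapP; exists (NAnd (NLit true (Rvar u i)) (NLit true (Svar i a))) => //.
  by apply/mapP; exists i; rewrite // mem_iota.
apply: (@ref_or _ _ 1 1); [exact: mem_head | by apply: small_max => /=; lia | |].
- by apply: (@ref_pair _ _ _ (NLit true (Rvar u i))); rewrite !inE eqxx ?orbT.
- by apply: (@ref_pair _ _ _ (NLit true (Svar i a))); rewrite !inE eqxx ?orbT.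
Qed.

Notation T := (table_cost W).

Definition count_state j : vec atom := count_vec D 0 (occupied j).

(** A statement about a single counter, cast as a binary relation that ignores its second argument
    so that the machinery for two counters applies. *)
Definition has_count j : nnf atom :=
  rel_formula W (fun c _ => c == j) (count_state j) (count_state j).

Let hole_gt0 : 0 < hole_size.
Proof. by rewrite /hole_size addn1. Qed.

Let hole_le_bit : 512 ^ D * hole_size <= bit_size.
Proof. by rewrite /bit_size leq_mul2l leq_pmull ?orbT. Qed.

Lemma count_state_size j : j <= m.+1 -> vec_all W (fun φ => nsize φ <= bit_size) (count_state j).
Proof.
move=> lej i lti; have sx a := occupied_size a lej.
have [s1 s2] := @count_vec_size W _ hole_size D 0 (occupied j) hole_gt0 sx i lti.
by split; [apply: leq_trans s1 _ | apply: leq_trans s2 _].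
Qed.

Let occupied_max j a : j <= m.+1 -> nsize (occupied j a) <= max_size.
Proof.
by move=> /occupied_size h; apply: leq_trans (h a) _; apply: leq_trans hole_max; rewrite leq_pmull.
Qed.

Lemma ref_occupied j j' a Γ : j <= m -> j' <= j ->
  occupied j' a \in Γ -> in_hole j a \in Γ -> R (j' * (hole_cost + 3) + 1) Γ.
Proof.
move=> lej; elim: j' Γ => [|j' IHj] Γ lej' h h2; first by apply: ref_le (ref_bot _ _ h); lia.
apply: (@ref_le _ _ ((j' * (hole_cost + 3) + 1) + hole_cost + 3)); first by rewrite (mulSn j'); lia.
apply: (ref_or h); first by apply: (occupied_max (j := j'.+1)); apply: leq_trans lej' (leqW lej).
  by apply: IHj; rewrite ?mem_head ?(ltnW lej') // inE h2 orbT.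
apply: (@ref_injective j j' a) => //; rewrite ?mem_head ?inE ?h2 ?orbT //.
  by rewrite neq_ltn lej' orbT.
by apply: leq_trans (ltnW lej') lej.
Qed.

(** The holes from [m] up to [2 ^ D] are padding that completes the counting tree; no pigeon is ever
    in them. *)
Lemma ref_outside j a Γ : m <= a -> j <= m.+1 -> occupied j a \in Γ -> R (4 * j + 1) Γ.
Proof.
move=> lea; elim: j Γ => [|j IHj] Γ lej h; first exact: ref_bot.
apply: (@ref_le _ _ ((4 * j + 1) + 1 + 3)); first by lia.
apply: (ref_or h); first exact: (occupied_max (j := j.+1)).
  by apply: IHj; rewrite ?mem_head ?(ltnW lej).
by apply: ref_bot; rewrite /in_hole ltnNge lea mem_head.
Qed.

Definition leaf_cost := (m + 2) * (hole_cost + 4) + T + 5.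

(** When pigeon [j] enters hole [a], the counter of a subtree grows by 1 if the subtree contains
    leaf [a] and stays unchanged otherwise; this relation is additive because the two halves of an
    interval are disjoint. At leaf [a] injectivity shows that the hole was empty, at other leaves
    functionality shows that pigeon [j] is absent. *)
Lemma ref_increment j a Γ : j <= m -> in_hole j a \in Γ ->
  R (2 ^ D * (leaf_cost + T + 4))
    (dual (rel_formula W (fun c c' => c' == (c + (0 <= a < 0 + 2 ^ D)) %% 2 ^ W)
       (count_state j) (count_state j.+1)) :: Γ).
Proof.
move=> lej h.
pose r d o c c' := c' == (c + (o <= a < o + 2 ^ d)) %% 2 ^ W.
have W1 : 1 < 2 ^ W by apply: leq_ltn_trans lt_mW.
have sm b : (b : bool) %% 2 ^ W = b by rewrite modn_small //; case: b => //; apply: ltnW.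
apply: (@ref_count _ _ W bit_size bit_gt0 W_gt0 r _ _ hole_size) => //.
- by move=> i; apply: occupied_size; apply: leqW.
- by move=> i; apply: occupied_size.
- move=> d o c c' e e' /eqP-> /eqP->; rewrite /r modnDm modnDml; apply/eqP; congr (_ %% _).
  have -> : (o <= a < o + 2 ^ d.+1) = (o <= a < o + 2 ^ d) + (o + 2 ^ d <= a < o + 2 ^ d + 2 ^ d) :> nat.
    rewrite expnS mul2n -addnn addnA.
    by case: (leqP o a) => h1; case: (leqP (o + 2 ^ d) a) => h2; case: ltnP => h3 /=; lia.
  by lia.
(* The leaf for pigeons up to [j] is the disjunction of these two formulas by the definition of
   [occupied], so old and new bit are [σ true] and [σ true] or [σ false]. *)
move=> o lto; pose σ (b : bool) := if b then occupied j o else in_hole j o.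
have sσ b : 3 * nsize (σ b) <= bit_size.
  apply: leq_trans hole_bit; rewrite leq_mul2l /=; case: b; first by apply: occupied_size; apply: leqW.
  by apply: leq_trans (in_hole_size j o) _; rewrite /hole_size; nia.
have leM : 6 * 2 ^ (4 * W) * bit_size <= max_size by [].
have leaf := @ref_leaf (php_axioms n) max_size W bit_size bit_gt0 W_gt0 σ (r 0 o)
  (NLit true true) (NOr (NLit true true) (NLit true false)).
have [eoa|noa] := eqVneq o a.
  apply: (@ref_cut _ _ _ (j * (hole_cost + 3) + 1) T _ (occupied j o)).
  - by apply: occupied_max; apply: leqW.
  - by apply: (@ref_occupied j j a) => //; rewrite ?inE ?h ?orbT // -eoa eqxx.
  - apply: (leaf [:: NLit false true; NLit true false]) => //.
    + move=> v /= /and3P[/eqP-> /eqP-> _]; rewrite /r expn0 eoa leqnn addn1 ltnSn /=.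
      by rewrite modn_small.
    + by rewrite !inE eqxx orbT.
    + move=> φ; rewrite !inE => /orP[]/eqP->; rewrite /σ ?eqxx // eoa h !orbT //.
  - rewrite /leaf_cost; have : j * (hole_cost + 3) <= (m + 2) * (hole_cost + 4) by apply: leq_mul; lia.
    by lia.
apply: (@ref_cut _ _ _ hole_cost T _ (in_hole j o)) => //.
- by apply: (@ref_functional j a o) => //; rewrite 1?eq_sym ?inE ?h ?eqxx ?orbT.
- apply: (leaf [:: NLit false false]) => //.
  + move=> v /= /andP[/eqP-> _]; rewrite orbF /r expn0.
    have -> : (o <= a < o + 1) = false by rewrite addn1 ltnS -eqn_leq (negPf noa).
    by rewrite addn0 sm eqb_id eqxx.
  + by rewrite !inE eqxx orbT.
  + by move=> φ; rewrite !inE => /eqP->; rewrite /σ eqxx.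
rewrite /leaf_cost; have : 1 * hole_cost <= (m + 2) * (hole_cost + 4) by apply: leq_mul; lia.
by lia.
Qed.

Definition step_cost := (2 ^ D * (leaf_cost + T + 4) + T + 1 + 4 * n + 20) * (m + 1) * (n + 1).

Lemma ref_step j Γ : j <= m -> R step_cost (has_count j :: dual (has_count j.+1) :: Γ).
Proof.
move=> lej; apply: (@ref_total j) => // a lta.
have sj := count_state_size (leqW lej); have sj1 := @count_state_size j.+1 lej.
pose r c c' := c' == (c + (0 <= a < 0 + 2 ^ D)) %% 2 ^ W.
apply: (@ref_cut _ _ _ T (2 ^ D * (leaf_cost + T + 4)) _
  (rel_formula W r (count_state j) (count_state j.+1))); last by lia.
- by apply: leq_trans bit_max; apply: rel_formula_size.
- apply: (@ref_items _ _ W bit_size bit_gt0 (count_state j) (count_state j.+1)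
    [:: (true, (false, false), fun c _ => c == j); (false, (true, true), fun c _ => c == j.+1);
        (true, (false, true), r)]) => //.
  + move=> c c'; rewrite /= orbF; case: (c =P j) => // -> /=; rewrite /r.
    have -> : 0 <= a < 0 + 2 ^ D by rewrite add0n (leq_trans lta).
    rewrite addn1 modn_small; last by apply: leq_ltn_trans lt_mW.
    by case: (c' == j.+1).
  + by move=> φ; rewrite !inE => /or3P[]/eqP->; rewrite eqxx ?orbT.
- by apply: ref_increment => //; rewrite mem_head.
Qed.

Lemma ref_start Γ : R (2 ^ D * (T + T + 4)) (dual (has_count 0) :: Γ).
Proof.
apply: (@ref_count _ _ W bit_size bit_gt0 W_gt0 (fun _ _ c _ => c == 0) _ _ hole_size) => //.
- by move=> d o c c' e e' /eqP-> /eqP->; rewrite mod0n.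
move=> o _; apply: (@ref_leaf (php_axioms n) max_size W bit_size bit_gt0 W_gt0 (fun=> NBot)
    (fun c _ => c == 0) NBot NBot [::]) => //.
- by move=> _; apply: leq_trans hole_bit; rewrite leq_mul2l.
- by rewrite mem_head.
Qed.

Definition end_cost := 2 ^ D * ((4 * (m + 1) + 1 + T + 1) + T + 4) + T + 1.

(** A subtree counts at most as many occupied holes as it has genuine ones, the truncated difference
    in [r]; at the root this bound is [m], against the asserted count [m.+1]. *)
Lemma ref_end Γ : R end_cost (has_count m.+1 :: Γ).
Proof.
pose r d o (c _ : nat) := c <= minn m (o + 2 ^ d) - minn m o.
have sm := @count_state_size m.+1 (leqnn _).
apply: (@ref_cut _ _ _ T (2 ^ D * ((4 * (m + 1) + 1 + T + 1) + T + 4)) _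
  (rel_formula W (r D 0) (count_state m.+1) (count_state m.+1))).
- by apply: leq_trans bit_max; apply: rel_formula_size.
- apply: (@ref_items _ _ W bit_size bit_gt0 (count_state m.+1) (count_state m.+1)
    [:: (true, (false, false), fun c _ => c == m.+1); (true, (false, false), r D 0)]) => //.
  + move=> c c'; rewrite /= orbF; have [->|//] := eqVneq c m.+1.
    by rewrite /r add0n minn0 subn0 (minn_idPl le_mD) ltnn.
  + by move=> φ; rewrite !inE => /orP[]/eqP->; rewrite eqxx ?orbT.
- apply: (@ref_count _ _ W bit_size bit_gt0 W_gt0 r _ _ hole_size) => //.
  + by move=> i; apply: occupied_size.
  + by move=> i; apply: occupied_size.
  + move=> d o c c' e e' h1 h2; apply: leq_trans (leq_mod _ _) _.
    move: h1 h2; rewrite /r expnS; move: (2 ^ d) => x; lia.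
  move=> o lto; have leM : 6 * 2 ^ (4 * W) * bit_size <= max_size by [].
  have sσ (b : bool) : 3 * nsize (occupied m.+1 o) <= bit_size.
    by apply: leq_trans hole_bit; rewrite leq_mul2l occupied_size ?orbT.
  have leaf := @ref_leaf (php_axioms n) max_size W bit_size bit_gt0 W_gt0 (fun=> occupied m.+1 o)
    (r 0 o) (NLit true true) (NLit true true).
  have [ltom|leom] := ltnP o m.
    apply: (@ref_le _ _ T); first by lia.
    apply: (leaf [::]) => //; last by rewrite mem_head.
    by move=> v _; rewrite /r expn0 /=; case: (v true) => /=; lia.
  apply: (@ref_cut _ _ _ (4 * m.+1 + 1) T _ (occupied m.+1 o)).
  + exact: occupied_max.
  + by apply: (@ref_outside m.+1 o) => //; rewrite mem_head.
  + apply: (leaf [:: NLit false true]) => //.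
    * by move=> v /= /andP[/eqP-> _].
    * by rewrite !inE eqxx orbT.
    * by move=> φ; rewrite !inE => /eqP->; rewrite eqxx.
  + by lia.
- by rewrite /end_cost; lia.
Qed.

Definition php_cost := 2 ^ D * (T + T + 4) + (m + 1) * (step_cost + 1) + end_cost + 1.

(** Cuts on [has_count j] for all [j] link the start value 0 to the impossible value [m.+1], one
    pigeon per link. *)
Lemma php_refutation : R php_cost [::].
Proof.
have chain j Γ : j <= m.+1 -> R (2 ^ D * (T + T + 4) + j * (step_cost + 1)) (dual (has_count j) :: Γ).
  elim: j Γ => [|j IHj] Γ lej; first by apply: ref_le (ref_start Γ); rewrite mul0n addn0.
  apply: (@ref_cut _ _ _ step_cost (2 ^ D * (T + T + 4) + j * (step_cost + 1)) _ (has_count j)).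
  - by apply: leq_trans bit_max; apply: rel_formula_size => //; apply: count_state_size; apply: ltnW.
  - exact: ref_step.
  - by apply: IHj; apply: ltnW.
  - by rewrite (mulSn j); lia.
apply: (@ref_cut _ _ _ end_cost (2 ^ D * (T + T + 4) + (m + 1) * (step_cost + 1)) _ (has_count m.+1)).
- by apply: leq_trans bit_max; apply: rel_formula_size => //; apply: count_state_size.
- exact: ref_end.
- by rewrite addn1; apply: chain.
- by rewrite /php_cost; lia.
Qed.

End Pigeonhole.

(** * Tree-like and dag-like proofs *)

Section Flatten.

Variables (S : eqType) (rule : seq S -> S -> Prop) (ssize : S -> nat).

Lemma derivation_nested_ind (P : derivation S -> Prop) :
  (forall s ds, (forall d, List.In d ds -> P d) -> P (Infer s ds)) -> forall d, P d.
Proof.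
move=> h; fix IH 1 => -[s ds]; apply: h.
by elim: ds => [|d ds IHds] d' /=; [case | case=> [<-|/IHds]].
Qed.

Fixpoint lines (d : derivation S) : seq S :=
  let: Infer s ds := d in rcons (flatten (map lines ds)) s.

Lemma conclusion_lines d : exists l, lines d = rcons l (conclusion d).
Proof. by case: d => s ds; exists (flatten (map lines ds)). Qed.

Lemma lines_size d : sumn (map ssize (lines d)) = tree_size ssize d.
Proof.
elim/derivation_nested_ind: d => s ds IH /=.
rewrite map_rcons sumn_rcons addnC; congr (_ + _).
elim: ds IH => //= d ds IHds IH; rewrite map_cat sumn_cat IH; last by left.
by rewrite IHds // => d' d'ds; apply: IH; right.
Qed.

Lemma dag_correct_cat l1 l2 : dag_correct rule l1 -> dag_correct rule l2 -> dag_correct rule (l1 ++ l2).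
Proof.
move=> h1; elim=> [|l ps s _ IH sub r]; first by rewrite cats0.
rewrite -rcons_cat; apply: dag_rcons IH _ r => p /sub pl.
by rewrite mem_cat pl orbT.
Qed.

Lemma lines_correct d : tree_correct rule d -> dag_correct rule (lines d).
Proof.
elim/derivation_nested_ind: d => s ds IH /= [r h].
apply: (dag_rcons _ _ r) => [|p].
  elim: ds IH h {r} => [|d ds IHds] IH /=; first by move=> _; apply: dag_nil.
  case=> hd hds; apply: dag_correct_cat; first by apply: IH => //; left.
  by apply: IHds => // d' d'ds; apply: IH; right.
elim: ds {IH h r} => //= d ds IHds; rewrite inE mem_cat => /orP[/eqP->|/IHds->]; last by rewrite orbT.
by have [l ->] := conclusion_lines d; rewrite mem_rcons mem_head.
Qed.

End Flatten.

Lemma prf_proof_of_size shape L k Γ C : prf L k Γ C ->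
  exists2 k', proof_of_size usize shape FLe (Γ, [:: C]) k' & k' <= k * L.
Proof.
move=> /prf_tree[d [dc de ds]]; exists (tree_size (sequent_size usize) d) => //.
case: shape => /=; first by exists d.
have [l e] := conclusion_lines d; exists l; rewrite -de -e.
by split; [apply: lines_correct | apply: lines_size].
Qed.

(** Reduces the lower bound to dag-like proofs and to their number of lines: the lines of a tree
    form a dag-like proof of the same size, and every line has size at least 1. *)
Lemma proof_of_size_dag (F : eqType) (fsize : F -> nat) shape rule (s : sequent F) k :
  proof_of_size fsize shape rule s k ->
  exists2 l, dag_correct rule (rcons l s) & (size l).+1 <= k.
Proof.
have le (l : seq (sequent F)) : size l <= sumn (map (sequent_size fsize) l).
  by elim: l => //= t l IHl; rewrite -add1n leq_add.
case: shape => /= [[d [dc de <-]]|[l [dc <-]]]; last first.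
  by exists l => //; have := le (rcons l s); rewrite size_rcons.
have [l e] := conclusion_lines d; rewrite de in e; exists l.
  by rewrite -e; apply: lines_correct.
by rewrite -lines_size -(size_rcons l s) -e; apply: le.
Qed.

Lemma provable_rule (F : eqType) (rule : seq (sequent F) -> sequent F -> Prop) ps s :
  rule ps s -> (forall p, List.In p ps -> provable rule p) -> provable rule s.
Proof.
move=> r h.
have [ds [eds hds]] : exists ds, map (@conclusion _) ds = ps
    /\ foldr (fun d P => tree_correct rule d /\ P) True ds.
  elim: ps h {r} => [|p ps IHps] h; first by exists [::].
  have [d [dc de]] := h p (or_introl erefl).
  have [|ds [eds hds]] := IHps; first by move=> q qps; apply: h; right.
  by exists (d :: ds); rewrite /= de eds.
by exists (Infer s ds); split=> //=; rewrite eds.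
Qed.

(** * Provability in LK *)

Lemma LK_nullary s : LK_rule [::] s -> provable LK s.
Proof. by move=> /up_to_perm_rule r; apply: (provable_rule r). Qed.

Lemma LK_unary p s : LK_rule [:: p] s -> provable LK p -> provable LK s.
Proof. by move=> /up_to_perm_rule r h; apply: (provable_rule r) => q [<-|[]]. Qed.

Lemma LK_binary p q s : LK_rule [:: p; q] s -> provable LK p -> provable LK q -> provable LK s.
Proof. by move=> /up_to_perm_rule r h h'; apply: (provable_rule r) => t [<-|[<-|[]]]. Qed.

Lemma LK_perm Γ Δ Γ' Δ' : perm_eq Γ Γ' -> perm_eq Δ Δ' ->
  provable LK (Γ, Δ) -> provable LK (Γ', Δ').
Proof.
move=> e1 e2 [[s ds] [[[ps' [s' [r eps es]]] hds] /= es0]]; rewrite es0 in es.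
exists (Infer (Γ', Δ') ds); split=> //=; split=> //; exists ps', s'; split=> //.
by apply: sequent_equiv_trans es; rewrite /sequent_equiv /= perm_sym e1 perm_sym e2.
Qed.

Lemma LK_boolean_axiom x : provable LK ([::], [:: forget (xform (boolean_axiom x))]).
Proof.
set X := PAtom x; have top : provable LK ([::], [:: PTop]) by apply/LK_nullary/LK_topR.
have ax A : provable LK ([:: A], [:: A]) by apply/LK_nullary/LK_ax.
have topl A : provable LK ([:: A], [:: PTop]) by apply: (LK_unary (LK_weakL _ _ _) top).
apply: (LK_binary (LK_andR _ _ _ _) _ top); apply: (LK_binary (LK_andR _ _ _ _)); last first.
  apply: (LK_binary (LK_andR _ _ _ _)); apply: (LK_unary (LK_impR _ _ _ _)); last exact: topl.
  apply: (LK_unary (LK_impR _ _ _ _)); apply: (LK_unary (LK_weakL _ _ _)); exact: ax.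
set P := PAnd X PTop; set N := PAnd (PImp X PBot) PTop.
apply: (LK_unary (LK_contrR _ _ _)); apply: (LK_unary (LK_orR1 _ _ _ _)).
apply: (@LK_perm [::] [:: POr P N; P]) => //; first by perm.
apply: (LK_unary (LK_orR2 _ _ _ _)); apply: (LK_binary (LK_andR _ _ _ _)); last first.
  apply: (@LK_perm [::] [:: P; PTop]) => //; first by perm.
  exact: (LK_unary (LK_weakR _ _ _) top).
apply: (LK_unary (LK_impR _ _ _ _)).
apply: (@LK_perm [:: X] [:: P; PBot]) => //; first by perm.
apply: (LK_binary (LK_andR _ _ _ _)).
  apply: (@LK_perm [:: X] [:: PBot; X]) => //; first by perm.
  exact: (LK_unary (LK_weakR _ _ _) (ax X)).
apply: (@LK_perm [:: X] [:: PBot; PTop]) => //.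
exact: (LK_unary (LK_weakR _ _ _) (topl X)).
Qed.

Lemma LK_pbigand s : (forall A, List.In A s -> provable LK ([::], [:: A])) ->
  provable LK ([::], [:: pbigand s]).
Proof.
elim: s => [|A [|B s] IHs] h; first by apply/LK_nullary/LK_topR.
  by apply: h; left.
apply: (LK_binary (LK_andR _ _ _ _)); first by apply: h; left.
by apply: IHs => C Cs; apply: h; right.
Qed.

(** * Polynomial bounds *)

(** The base is [n.+1] because it is at least 2 for positive [n], so that constants and sums are
    absorbed by a larger exponent. *)
Definition poly (f : nat -> nat) : Prop := exists c, forall n, 0 < n -> f n <= n.+1 ^ c.

Lemma poly_const k : poly (fun=> k).
Proof.
exists k => n n0; apply: leq_trans (ltnW (ltn_expl k (isT : 1 < 2))) _.
by case: k => // k; rewrite leq_exp2r.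
Qed.

Lemma poly_id : poly id.
Proof. by exists 1 => n _; rewrite expn1. Qed.

Lemma poly_mul f g : poly f -> poly g -> poly (fun n => f n * g n).
Proof. by move=> [a ha] [b hb]; exists (a + b) => n n0; rewrite expnD leq_mul ?ha ?hb. Qed.

Lemma poly_add f g : poly f -> poly g -> poly (fun n => f n + g n).
Proof.
move=> [a ha] [b hb]; exists (a + b).+1 => n n0.
apply: (@leq_trans (n.+1 ^ (a + b) + n.+1 ^ (a + b))).
  by apply: leq_add; [apply: leq_trans (ha n n0) _|apply: leq_trans (hb n n0) _];
    rewrite leq_exp2l // ?leq_addr ?leq_addl.
by rewrite addnn -mul2n expnS leq_mul2r ltnS n0 orbT.
Qed.

Lemma poly_S f : poly f -> poly (fun n => (f n).+1).
Proof.
move=> pf; have [c h] := poly_add pf (poly_const 1); exists c => n /h; by rewrite addn1.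
Qed.

Lemma poly_exp f k : poly f -> poly (fun n => f n ^ k).
Proof.
move=> pf; elim: k => [|k IHk]; first exact: poly_const.
by have [c h] := poly_mul pf IHk; exists c => n /h; rewrite expnS.
Qed.

Lemma poly_le g f : poly g -> (forall n, 0 < n -> f n <= g n) -> poly f.
Proof. by move=> [c h] le; exists c => n n0; apply: leq_trans (le n n0) (h n n0). Qed.

Lemma poly_bound f : poly f -> exists c, forall n, 0 < n -> f n <= c * n ^ c.
Proof.
move=> [c h]; exists (2 ^ c) => n n0; apply: leq_trans (h n n0) _.
apply: (@leq_trans ((2 * n) ^ c)); first by case: c {h} => // c; rewrite leq_exp2r //; lia.
by rewrite expnMn leq_mul2l leq_pexp2l ?orbT // ltnW // ltn_expl.
Qed.

Ltac poly :=
  lazymatch goal with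
  | |- poly (fun _ => ?k) => exact: (poly_const k)
  | |- poly (fun n => n) => exact: poly_id
  | |- poly (fun n => @?f n + @?g n) => refine (@poly_add f g _ _); poly
  | |- poly (fun n => @?f n * @?g n) => refine (@poly_mul f g _ _); poly
  | |- poly (fun n => (@?f n).+1) => refine (@poly_S f _); poly
  | |- poly (fun n => @?f n ^ @?k n) =>
      lazymatch k with
      | (fun _ => ?e) => refine (@poly_exp f e _); poly
      | _ => assumption
      end
  | |- poly ?f => match goal with H : poly ?g |- _ => constr_eq f g; exact: H end
  end.

Lemma poly_sqrt : poly (fun n => Nat.sqrt n).
Proof. by apply: (poly_le poly_id) => n _; have := Nat.sqrt_le_lin n; lia. Qed.

Lemma size_increasing_pairs n : size (increasing_pairs n) <= n ^ 2.
Proof. by rewrite size_filter; apply: leq_trans (count_size _ _) _; rewrite size_allpairs size_iota expnS expn1. Qed.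

Lemma size_distinct_pairs n : size (distinct_pairs n) <= n ^ 2.
Proof. by rewrite size_filter; apply: leq_trans (count_size _ _) _; rewrite size_allpairs size_iota expnS expn1. Qed.

Lemma poly_atoms : poly (fun n => size (atoms n)).
Proof.
have ps := poly_sqrt.
apply: (@poly_le (fun n => n ^ 2 + ((Nat.sqrt n).+1 * n + n * Nat.sqrt n))); first by poly.
move=> n _; rewrite /atoms 2!size_cat size_map !size_allpairs !size_iota leq_add2r.
exact: size_increasing_pairs.
Qed.

Lemma poly_clauses :
  poly (fun n => size (clique_clauses n (Nat.sqrt n).+1) + size (color_clauses n (Nat.sqrt n))).
Proof.
have ps := poly_sqrt.
apply: (@poly_le (fun n => ((Nat.sqrt n).+1 + ((Nat.sqrt n).+1 * n ^ 2 +
  ((Nat.sqrt n).+1 ^ 2 * n + (Nat.sqrt n).+1 ^ 2 * n ^ 2)))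
  + (n + (n * Nat.sqrt n ^ 2 + Nat.sqrt n * n ^ 2)))); first by poly.
move=> n _; rewrite /clique_clauses /color_clauses; move: (Nat.sqrt n) => m.
rewrite !size_cat !size_map !size_allpairs !size_iota.
have := size_increasing_pairs n; have := size_distinct_pairs n.
have := size_distinct_pairs m.+1; have := size_distinct_pairs m => a b c d.
by repeat (apply: leq_add || apply: leq_mul).
Qed.

Lemma usize_nest (op : uformula -> uformula -> uformula) e s b :
  (forall A B, usize (op A B) = (usize A + usize B).+1) -> usize e = 1 ->
  (forall A, List.In A s -> usize A <= b) -> usize (nest op e s) <= size s * b.+1 + 1.
Proof.
move=> eop ee; elim: s => [|A [|B s] IHs] h; first by rewrite ee.
  by rewrite /= mul1n addn1; apply: leqW; apply: leqW; apply: h; left.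
rewrite [nest _ _ _]/= eop [size _]/= mulSn.
have h1 := h A (or_introl erefl); have h2 := IHs (fun C Cs => h C (or_intror Cs)).
by move: h2; rewrite [size _]/= /=; lia.
Qed.

Lemma usize_literal l : usize (literal_formula l) <= 3.
Proof. by case: l => -[]. Qed.

Lemma List_In_map (T U : Type) (f : T -> U) s y : List.In y (map f s) -> exists2 x, List.In x s & y = f x.
Proof.
elim: s => //= x s IHs [<-|/IHs[z]]; first by exists x; [left|].
by exists z; [right|].
Qed.

Lemma List_In_mem (T : eqType) (s : seq T) x : List.In x s -> x \in s.
Proof. by elim: s => //= y s IHs [->|/IHs]; rewrite inE ?eqxx // => ->; rewrite orbT. Qed.

Lemma usize_Clique_ColorBar n : 0 < n ->
  usize (Clique n) + usize (ColorBar n)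
  <= (size (clique_clauses n (Nat.sqrt n).+1) + size (color_clauses n (Nat.sqrt n))) * (4 * n + 14) + 2.
Proof.
move=> n0; rewrite mulnDl.
have h (op op' : uformula -> uformula -> uformula) e e' (f : literal -> literal) C :
    (forall A B, usize (op A B) = (usize A + usize B).+1) -> usize e = 1 ->
    (forall A B, usize (op' A B) = (usize A + usize B).+1) -> usize e' = 1 ->
    {subset C <= clique_clauses n (Nat.sqrt n).+1 ++ color_clauses n (Nat.sqrt n)} ->
    usize (nest op e [seq nest op' e' [seq literal_formula (f l) | l <- c] | c <- C]) <= size C * (4 * n + 14) + 1.
  move=> h1 h2 h3 h4 sub.
  apply: leq_trans (usize_nest (b := 4 * n + 13) h1 h2 _) _; last by rewrite size_map -addnS.
  move=> A /(@List_In_map (seq literal) uformula)[c cC eA]; rewrite {}eA; have /andP[le _] := clause_small n0 (sub _ (List_In_mem cC)).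
  apply: leq_trans (usize_nest (b := 3) h3 h4 _) _.
    by move=> B /(@List_In_map literal uformula)[l _ ->]; apply: usize_literal.
  by rewrite size_map; apply: (@leq_trans ((n + 3) * 4 + 1)); [rewrite leq_add2r leq_mul2r le orbT | lia].
have h1 := h UAnd UOr UOne UZero id (clique_clauses n (Nat.sqrt n).+1)
  (fun _ _ => erefl) erefl (fun _ _ => erefl) erefl.
have h2 := h UOr UAnd UZero UOne complement (color_clauses n (Nat.sqrt n))
  (fun _ _ => erefl) erefl (fun _ _ => erefl) erefl.
rewrite -[2]/(1 + 1) addnACA; apply: leq_add; [apply: h1 | apply: h2] => c cC;
  by rewrite mem_cat cC ?orbT.
Qed.

(** * Choice of parameters and assembly *)

Definition log_holes (n : nat) : nat := up_log 2 (Nat.sqrt n).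
(** Counts up to [m.+1] must not wrap around, where [m] is the integer square root. For [m = 1] the
    logarithm is 0, and a single extra bit would not make [m.+1 < 2 ^ W] strict. *)
Definition bit_width (n : nat) : nat := (log_holes n).+2.

Lemma log_holes_bound n : 0 < n -> Nat.sqrt n <= 2 ^ log_holes n <= 2 * n.
Proof.
move=> n0; have le_mn : Nat.sqrt n <= n by have := Nat.sqrt_le_lin n; lia.
have m0 : 0 < Nat.sqrt n by have := Nat.sqrt_spec n; case: (Nat.sqrt n) => //; lia.
apply/andP; split; first exact: up_logP.
rewrite /log_holes; have [m1|m1] := leqP (Nat.sqrt n) 1.
  by rewrite (_ : Nat.sqrt n = 1) ?up_log1 ?expn0; lia.
have /andP[lt _] := up_log_bounds (isT : 1 < 2) m1.
have u0 : 0 < up_log 2 (Nat.sqrt n) by rewrite up_log_gt0.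
by rewrite -(prednK u0) expnS; lia.
Qed.

Lemma poly_table : poly (fun n => 2 ^ log_holes n).
Proof.
by apply: (@poly_le (fun n => 2 * n)); [poly | move=> n /log_holes_bound/andP[]].
Qed.

Lemma poly_width k : poly (fun n => 2 ^ (k * bit_width n)).
Proof.
have pt := poly_table; apply: (@poly_le (fun n => (4 * 2 ^ log_holes n) ^ k)); first by poly.
by move=> n _; rewrite mulnC expnM /bit_width !expnS mulnA.
Qed.

Lemma poly_512 : poly (fun n => 512 ^ log_holes n).
Proof.
have pt := poly_table; apply: (@poly_le (fun n => (2 ^ log_holes n) ^ 9)); first by poly.
by move=> n _; rewrite (_ : 512 = 2 ^ 9) // -!expnM mulnC.
Qed.

Lemma poly_max_size : poly (fun n => max_size n (log_holes n) (bit_width n)).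
Proof.
have := poly_sqrt; have := poly_512; have := poly_width 4 => a b c.
by rewrite /max_size /bit_size /hole_size; poly.
Qed.

Lemma poly_table_cost : poly (fun n => table_cost (bit_width n)).
Proof. have := poly_width 4; have := poly_width 8 => a b; by rewrite /table_cost; poly. Qed.

Lemma poly_php_cost : poly (fun n => php_cost n (log_holes n) (bit_width n)).
Proof.
have := poly_sqrt; have := poly_table; have := poly_table_cost => a b c.
by rewrite /php_cost /end_cost /step_cost /leaf_cost /hole_cost; poly.
Qed.

Lemma poly_clique_clauses : poly (fun n => size (clique_clauses n (Nat.sqrt n).+1)).
Proof. by apply: (poly_le poly_clauses) => n _; apply: leq_addr. Qed.

Lemma poly_color_clauses : poly (fun n => size (color_clauses n (Nat.sqrt n))).
Proof. by apply: (poly_le poly_clauses) => n _; apply: leq_addl. Qed.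

Lemma poly_sim_cost : poly (fun n => sim_cost n).
Proof.
have := poly_atoms; have := poly_clique_clauses; have := poly_color_clauses => a b c.
by rewrite /sim_cost; poly.
Qed.

Lemma poly_usize_Clique_ColorBar : poly (fun n => usize (Clique n) + usize (ColorBar n)).
Proof.
have a := poly_clique_clauses; have b := poly_color_clauses.
by apply: poly_le usize_Clique_ColorBar; poly.
Qed.

(** The supply demanded by [prf_refutation]: at most [max_size] copies for each cut, and 2 for a
    leaf. *)
Definition copy_number (n : nat) : nat :=
  php_cost n (log_holes n) (bit_width n) * max_size n (log_holes n) (bit_width n) + 2.

Definition Sigma (n : nat) : seq uformula := copies (atoms n) (copy_number n).

(** A generous bound, with room both for the requirements of the simulation and for the fusion
    formula that [prf_S] introduces. *)
Definition line_bound (n : nat) : nat :=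
  let M := max_size n (log_holes n) (bit_width n) in
  2 * (usize (Clique n) + usize (ColorBar n)) + (copy_number n).+2 * (21 * size (atoms n)) * 5
  + 10 * M * php_cost n (log_holes n) (bit_width n) + 60 * M + 40 * n + 300.

Definition line_number (n : nat) : nat :=
  let M := max_size n (log_holes n) (bit_width n) in
  php_cost n (log_holes n) (bit_width n)
  * (2 * (sim_cost n * 5) + 10 * size (atoms n) * (copy_number n).+1 + 10 * line_bound n
     + M * (5 * size (atoms n) + 14 * M + 100) + 100).

Lemma poly_copy_number : poly (fun n => copy_number n).
Proof.
have a := poly_max_size; have b := poly_php_cost.
by rewrite /copy_number; poly.
Qed.

Lemma poly_line_bound : poly (fun n => line_bound n).
Proof.
have a := poly_max_size; have b := poly_php_cost; have c := poly_copy_number.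
have d := poly_atoms.
have e : poly (fun n => usize (Clique n)) by apply: (poly_le poly_usize_Clique_ColorBar) => n _; apply: leq_addr.
have f : poly (fun n => usize (ColorBar n)) by apply: (poly_le poly_usize_Clique_ColorBar) => n _; apply: leq_addl.
by rewrite /line_bound; poly.
Qed.

Lemma poly_line_number : poly (fun n => line_number n).
Proof.
have a := poly_max_size; have b := poly_php_cost; have c := poly_copy_number.
have d := poly_atoms; have e := poly_line_bound; have f := poly_sim_cost.
by rewrite /line_number; poly.
Qed.

Lemma Sigma_size n : gsize (Sigma n) = copy_number n * (21 * size (atoms n)).
Proof. by rewrite gsize_copies axioms_sizeE. Qed.

Lemma mem_Sigma n A : A \in Sigma n -> exists2 x, x \in atoms n & A = boolean_axiom x.
Proof.
rewrite /Sigma /copies; elim: (copy_number n) => //= N IHN.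
by rewrite mem_cat => /orP[/mapP[x xX ->]|h]; [exists x | apply: IHN].
Qed.

Lemma prf_Clique_ColorBar n : 0 < n ->
  prf (line_bound n) (line_number n) (Clique n :: Sigma n) (ColorBar n).
Proof.
move=> n0; have /andP[le_mD _] := log_holes_bound n0.
have lt_mW : (Nat.sqrt n).+1 < 2 ^ bit_width n.
  have : 0 < 2 ^ log_holes n by rewrite expn_gt0.
  by rewrite /bit_width !expnS; lia.
have R := php_refutation n0 le_mD lt_mW.
have leL : usize (Clique n) + usize (ColorBar n) + axioms_size (atoms n) + 40 * n + 200 < line_bound n.
  by rewrite axioms_sizeE /line_bound !mulSn; lia.
have leC : sim_cost n <= sim_cost n * 5 by rewrite leq_pmulr.
have h := @prf_refutation (atoms n) (php_axioms n) (Clique n) (ColorBar n) (line_bound n)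
  (max_size n (log_holes n) (bit_width n)) (copy_number n) (sim_cost n * 5)
  (prf_le leC (Clique_one n0 leL)) (prf_le leC (zero_ColorBar n0 leL))
  (php_axioms_ColorBar n0 leL) _ _ R (copy_number n) (leqnn _) (leqnn _) isT.
rewrite /Sigma -[copies _ _]cats0; apply: h.
by rewrite gsize_nil axioms_sizeE /line_bound; lia.
Qed.

Lemma usize_bigfusion s : usize (bigfusion s) <= gsize s + size s + 1.
Proof.
elim: s => // A [|B s] IHs; first by rewrite /bigfusion /= gsize_cons; lia.
by move: IHs; rewrite /bigfusion [nest _ _ (A :: _)]/= !gsize_cons /=; lia.
Qed.

Lemma p_bigfusion L k s Γ C : gsize s + size s + 1 + gsize Γ + usize C < L ->
  prf L k (s ++ Γ) C -> prf L (k + size s + 1) (bigfusion s :: Γ) C.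
Proof.
elim: s Γ => [|A [|B s] IHs] Γ le h.
- by rewrite addn0 addn1; apply: p_oneL h; move: le; rewrite gsize_nil /=; lia.
- by apply: prf_le h; rewrite -addnA leq_addr.
have szF := usize_bigfusion (B :: s); move: le; rewrite gsize_cons [size (A :: _)]/= => le.
apply: (@prf_le _ (k + size (B :: s) + 1).+1); first by rewrite /=; lia.
have -> : bigfusion (A :: B :: s) = UMul A (bigfusion (B :: s)) by [].
apply: p_mulL.
  rewrite gsize_cons -[usize (UMul _ _)]/((usize A + usize (bigfusion (B :: s))).+1).
  by move: szF le; move: (usize (bigfusion _)) (gsize (B :: s)) => x y /=; lia.
apply: (@prf_perm _ _ (bigfusion (B :: s) :: A :: Γ)); first by perm.
apply: IHs; first by rewrite (gsize_cons A) /=; move: le => /=; lia.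
apply: prf_perm h; rewrite cat_cons -cat1s perm_catCA perm_refl //.
Qed.

Lemma prf_S n : 0 < n ->
  prf (line_bound n) (line_number n + gsize (Sigma n) + 2)
    (Clique n :: ps_rest n (Sigma n))
    (UImp (bigfusion (ps_part n (Sigma n))) (ColorBar n)).
Proof.
move=> n0; have h := prf_Clique_ColorBar n0.
have e : perm_eq (ps_part n (Sigma n) ++ ps_rest n (Sigma n)) (Sigma n) by apply/permPl/perm_filterC.
have es := gsize_perm e; rewrite gsize_cat in es.
have leB : usize (Clique n) + usize (ColorBar n) + 5 * gsize (Sigma n) + 200 < line_bound n.
  by rewrite Sigma_size /line_bound !mulSn; lia.
have szF := usize_bigfusion (ps_part n (Sigma n)).
have szs (s : seq uformula) : size s <= gsize s.
  by elim: s => //= A s IHs; rewrite gsize_cons; have := usize_gt0 A; lia.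
have szp := szs (ps_part n (Sigma n)).
apply: (@prf_le _ (line_number n + size (ps_part n (Sigma n)) + 1).+1); first by lia.
apply: p_impR.
  rewrite gsize_cons -[usize (UImp _ _)]/((usize (bigfusion (ps_part n (Sigma n))) + usize (ColorBar n)).+1).
  by move: leB es szF szp; clear; move: (line_bound n) => L; lia.
apply: p_bigfusion.
  by rewrite gsize_cons; move: leB es szp; clear; move: (line_bound n) => L; lia.
apply: prf_perm h; apply: (perm_trans (y := Clique n :: ps_part n (Sigma n) ++ ps_rest n (Sigma n))).
  by rewrite perm_cons perm_sym.
by rewrite -cat1s perm_catCA perm_refl.
Qed.

Lemma root_exists n : exists t, t ^ 20 <= n < t.+1 ^ 20.
Proof.
have P0 : exists t, t ^ 20 <= n by exists 0; rewrite exp0n.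
have bound t : t ^ 20 <= n -> t <= n.
  move=> le; apply: leq_trans le; case: t => // t.
  by rewrite -[X in X <= _]expn1 leq_pexp2l.
exists (ex_maxn P0 bound); case: ex_maxnP => t -> max /=.
by rewrite ltnNge; apply/negP=> /max; rewrite ltnn.
Qed.

(** From [n < t.+1 ^ 20] the exponent 1/40 gives at most the square root of [t.+1], which is below
    [t - 3] once [9 < t]. The gap between 1/40 and 1/20 pays for rounding the root and for the 3
    subtracted here. *)
Lemma pow2_pow_bound n t : 9 < t -> n < t.+1 ^ 20 -> 0 < n ->
  Rle (pow2_pow n (Rinv 40)) (INR (2 ^ (t - 3))).
Proof.
move=> t9 ltn n0.
have INR_pow a b : INR (a ^ b) = pow (INR a) b.
  by elim: b => //= b IHb; rewrite expnS mult_INR IHb.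
have t1 : Rlt 0 (INR t.+1) by apply/lt_0_INR; lia.
have le1 : Rle (Rpower (INR n) (Rinv 40)) (INR (t - 3)).
  apply: (Rle_trans _ (Rpower (INR (t.+1 ^ 20)) (Rinv 40))).
    apply: Rle_Rpower_l; first by lra.
    by split; [apply/lt_0_INR; lia | apply/le_INR; lia].
  rewrite INR_pow -Rpower_pow // Rpower_mult.
  have -> : Rmult (INR 20) (Rinv 40) = Rinv 2 by rewrite INR_IZR_INZ /=; field.
  rewrite Rpower_sqrt // -(sqrt_Rsqr (INR (t - 3))); last exact: pos_INR.
  apply: sqrt_le_1_alt; rewrite /Rsqr -mult_INR; apply/le_INR.
  have -> : t = (t - 10) + 10 by lia.
  by move: (t - 10) => s; clear; nia.
have two : INR 2 = IZR 2 by rewrite INR_IZR_INZ.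
rewrite INR_pow two -Rpower_pow; last by lra.
by apply: Rle_Rpower; [lra | exact: le1].
Qed.

Theorem theorem41 (shape : proof_shape) :
  exists Σ : nat -> seq uformula,
    (forall n, 0 < n -> all single_variable (Σ n))
    /\ (exists c, forall n, 0 < n -> sumn (map usize (Σ n)) <= c * n ^ c)
    /\ (forall n, 0 < n ->
          provable LK ([::], [:: pbigand (map (fun A => forget (xform A)) (Σ n))]))
    /\ (exists c, forall n, 0 < n -> exists2 k,
          proof_of_size usize shape FLe (Clique n :: Σ n, [:: ColorBar n]) k
          & k <= c * n ^ c)
    /\ (exists c, forall n, 0 < n -> exists2 k,
          proof_of_size usize shape FLe (S_sequent n (Σ n)) k
          & k <= c * n ^ c)
    /\ (exists eps : R, Rlt 0 eps /\ exists n0, forall n, n0 <= n -> forall k,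
          proof_of_size xsize shape LKbang_cutfree (xsequent (S_sequent n (Σ n))) k ->
          Rle (pow2_pow n eps) (INR k)).
Proof.
have pX := poly_atoms; have pC := poly_copy_number.
have pL := poly_line_bound; have pN := poly_line_number.
have pS : poly (fun n => gsize (Sigma n)).
  by apply: (@poly_le (fun n => copy_number n * (21 * size (atoms n)))); [poly | move=> n _; rewrite Sigma_size].
exists Sigma; split.
  move=> n _; apply/allP=> A /mem_Sigma[x _ ->].
  by rewrite /single_variable /= !inE eqxx.
split; first exact: poly_bound pS.
split.
  move=> n _; have := @mem_Sigma n; move: (Sigma n) => s hs.
  apply: LK_pbigand => A /(@List_In_map uformula pformula)[B Bs ->].
  by have [x _ ->] := hs B (List_In_mem Bs); apply: LK_boolean_axiom.
split.
  have [c h] := poly_bound (poly_mul pN pL); exists c => n n0.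
  have [k pk lek] := prf_proof_of_size shape (prf_Clique_ColorBar n0).
  by exists k => //; apply: leq_trans lek (h n n0).
split.
  have pS2 := poly_mul (poly_add (poly_add pN pS) (poly_const 2)) pL.
  have [c h] := poly_bound pS2; exists c => n n0.
  have [k pk lek] := prf_proof_of_size shape (prf_S n0).
  by exists k => //; apply: leq_trans lek (h n n0).
exists (Rinv 40); split; first by lra.
have [n1 hn1] : exists n1, forall n, n1 <= n -> 0 < n /\ exists t, [/\ 9 < t, t ^ 20 <= n & n < t.+1 ^ 20].
  (* From here on the integer twentieth root is at least 10, as the circuit bound requires. *)
  exists (10 ^ 20) => n le; have n0 : 0 < n by apply: leq_trans le; rewrite expn_gt0.
  split=> //; have [t /andP[le1 lt1]] := root_exists n; exists t; split=> //.
  rewrite ltnNge; apply/negP=> le9.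
  have mono a b : a <= b -> a ^ 20 <= b ^ 20 by move=> ab; rewrite leq_exp2r.
  by have := leq_trans lt1 (leq_trans (mono _ _ (le9 : t.+1 <= 10)) le); rewrite ltnn.
exists n1 => n /hn1[n0 [t [t9 le lt]]] k /proof_of_size_dag[l dl lek].
have taut A v : A \in Sigma n -> xeval v (xform A).
  by move=> /mem_Sigma[x _ ->] /=; case: (v x).
(* An axiom about an r-atom releases only the constants [0] and [1] as r-free subformulas; the other
   axioms contain no r at all. *)
have side A : A \in Sigma n -> has_r (xform A) -> clique_side true (xform A).
  by move=> /mem_Sigma[[i j|u i|i a] _ ->].
have lb := S_dag_lower_bound n0 taut side t9 le dl.
apply: (Rle_trans _ _ _ (pow2_pow_bound t9 lt n0)); apply/le_INR.
(* The factor 5, the number of gates per proof line, is absorbed by [2 ^ 3]. *)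
have : 2 ^ (t - 3) * 8 <= 5 * k.
  rewrite (_ : 8 = 2 ^ 3) // -expnD subnK; last by lia.
  by apply: leq_trans lb _; rewrite leq_mul2l lek.
by lia.
Qed.
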